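(* Let $\mathbf W=(W_1,W_2)$ be a standard planar Brownian motion started at the origin, let $\mathsf r(t)$ be the inradius of the convex hull of $\{\mathbf W(s):s\in[0,t]\}$, and let $\Theta^{\mathsf r}=\inf\{t\ge0:\mathsf r(t)>1\}$. Then $$5.2\cdot10^{-11}\le \mathrm{Var}(\Theta^{\mathsf r})\le 709.599 .$$
   Context: Standard planar Brownian motion: $\mathbf W(t)=(W_1(t),W_2(t))$ with $W_1,W_2$ independent standard one-dimensional Brownian motions started at $0$. The inradius of a compact convex set in $\mathbb R^2$ is the radius of the largest disk contained in it ($0$ if the set has empty interior). *)

(* Defs.v *)
From HB Require Import structures.
From mathcomp Require Import all_boot all_order all_algebra.
From mathcomp Require Import all_classical all_reals all_analysis.

Set Implicit Arguments.
Unset Strict Implicit.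
Unset Printing Implicit Defensive.

Import Order.TTheory GRing.Theory Num.Theory.
Import numFieldNormedType.Exports.

Local Open Scope classical_set_scope.
Local Open Scope ring_scope.

Section brownian_motion.
Context (d : measure_display) (T : measurableType d) (R : realType)
  (P : probability T R).

(* Since some of the A i may be setT, the product rule for the whole family
   contains the product rule for each of its subfamilies. *)
Definition mutually_independent (n : nat) (X : 'I_n -> T -> R) : Prop :=
  forall A : 'I_n -> set R, (forall i, measurable (A i)) ->
    P (\bigcap_(i in [set: 'I_n]) X i @^-1` A i) =
    (\prod_(i < n) P (X i @^-1` A i))%E.

(* A process is a map B : R -> T -> R; only the times t >= 0 are relevant.
   The second parameter of normal_prob is the standard deviation. *)
Record brownian_motion (B : R -> T -> R) : Prop := BrownianMotion {
  bm_measurable : forall t : R, 0 <= t -> measurable_fun setT (B t) ;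
  bm_start : {ae P, forall w, B 0 w = 0} ;
  bm_increments_independent : forall (n : nat) (t : nat -> R),
    0 <= t 0%N -> (forall i, t i <= t i.+1) ->
    mutually_independent (fun (i : 'I_n) w => B (t i.+1) w - B (t i) w) ;
  bm_increments_normal : forall s t : R, 0 <= s -> s < t ->
    forall A : set R, measurable A ->
      P ((fun w => B t w - B s w) @^-1` A) = normal_prob 0 (Num.sqrt (t - s)) A ;
  bm_continuous :
    {ae P, forall w, {within `[0, +oo[, continuous (fun t => B t w)}} }.

Definition process_sigma_algebra (B : R -> T -> R) : set (set T) :=
  <<s \bigcup_(t in `[0, +oo[) preimage_set_system setT (B t) measurable >>.

Definition independent_processes (B1 B2 : R -> T -> R) : Prop :=
  forall A1 A2 : set T,
    process_sigma_algebra B1 A1 -> process_sigma_algebra B2 A2 ->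
    P (A1 `&` A2) = (P A1 * P A2)%E.

Definition planar_brownian_motion (W1 W2 : R -> T -> R) : Prop :=
  [/\ brownian_motion W1, brownian_motion W2 & independent_processes W1 W2].

End brownian_motion.

Section inradius.
Context (R : realType).

Definition convex_hull (E : lmodType R) (A : set E) : set E :=
  smallest (@convex_set R E) A.

(* The product norm of R * R is the sup norm, hence the explicit formula. *)
Definition euclidean_disk (c : R^o * R^o) (rho : R) : set (R^o * R^o) :=
  [set p | (p.1 - c.1) ^+ 2 + (p.2 - c.2) ^+ 2 <= rho ^+ 2].

(* Points are disks of radius 0, so a nonempty compact convex set with empty
   interior has inradius 0. *)
Definition inradius (K : set (R^o * R^o)) : R :=
  sup [set rho | 0 <= rho /\ exists c, euclidean_disk c rho `<=` K].

End inradius.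

Section inradius_time.
Context (T : Type) (R : realType) (W1 W2 : R -> T -> R).

Definition path_hull (t : R) (w : T) : set (R^o * R^o) :=
  convex_hull [set ((W1 s w, W2 s w) : R^o * R^o) | s in `[0, t]].

(* +oo if the inradius never exceeds 1. *)
Definition inradius_time (w : T) : \bar R :=
  ereal_inf [set t%:E | t in
    [set t : R | 0 <= t /\ 1 < inradius (path_hull t w)]].

End inradius_time.

(* Main.v *)
Require Import Defs.
From HB Require Import structures.
From mathcomp Require Import all_boot all_order all_algebra.
From mathcomp Require Import all_classical all_reals all_analysis.
From mathcomp Require Import measurable_realfun.
From mathcomp Require Import ring lra.

Import Order.TTheory GRing.Theory Num.Theory.
Import numFieldNormedType.Exports HBNNSimple.

Local Open Scope classical_set_scope.
Local Open Scope ring_scope.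

(** Let tau be the first time at which the inradius of the hull of the planar
    path exceeds 1.

    Upper bound.  Cut time into blocks of length 45.  By the theorem of
    Steinhagen (lemma [disk_or_strip]) a finite set of points whose convex hull
    contains no disk of radius [rho] lies in a strip of width [3 * rho].
    Hence, if during a block the path sampled on a fine grid produces no disk
    of radius 301/300, then either one coordinate has moved by more than 120,
    or all the samples lie in one of 8000 * 38 fixed strips of half-width
    127/80 (lemma [strip_net_cover]).  In a fixed direction the sampled path is
    a Gaussian random walk, and testing it against [cos (kappa * x)], which is
    multiplied by a fixed factor at each step, bounds the probability of
    staying in an interval from above ([confined_prob_le]) and from below
    ([confined_prob_ge]).  Altogether a block fails with probability at most
    1/25, conditionally on the past ([block_fail_prob]).  So tau exceeds [45 m]
    with probability at most [(1/25)^m], and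
    [(tau - 45/2)^2 <= (45/2)^2 * (1 + sum_(m >= 1) 8 m 1_(F m))] almost surely,
    where [F m] says that the first m blocks fail.  The right-hand side has
    mean at most 683.

    The variance is the least mean square deviation, but tau is not shown to be
    measurable: for such an integrand the integral is a supremum over smaller
    simple functions.  [lower_envelope] provides a measurable function below
    tau with the same integral and above all measurable minorants, which
    reduces [variance_le_real] to the measurable case.

    Lower bound.  If tau is at most 8 and at least 10, each with probability at
    least [p], then the mean square distance of tau to any number is at least
    [p * ((10 - 8) / 2)^2] ([variance_ge]).  The first event contains the one
    where the path is near (6, 0) at time 4 and near (6, 6) at time 8, because
    the triangle with these vertices and the origin has an incircle of radius
    greater than 1.  The second one contains the event that the first
    coordinate stays in [-1, 1] up to time 10; the lower confinement bound along
    dyadic grids and the continuity of paths give its probability.  Both are at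
    least [10^-10]. *)

Set Implicit Arguments.
Unset Strict Implicit.
Unset Printing Implicit Defensive.

(** * Polynomial bounds for the cosine *)

Section trigonometric_bounds.
Context {R : realType}.
Implicit Types x : R.

Lemma nondecreasing_from0 (f df : R -> R) :
  (forall x, is_derive x 1 f (df x)) -> (forall x, 0 <= x -> 0 <= df x) ->
  forall x, 0 <= x -> f 0 <= f x.
Proof.
move=> fdf df0 x x0; rewrite -subr_ge0.
have cf : {within `[0, x], continuous f}.
  apply: continuous_subspaceT => y.
  by apply/differentiable_continuous/derivable1_diffP; case: (fdf y).
have [c + ->] := MVT_segment x0 (fun y _ => fdf y) cf.
by rewrite in_itv/= => /andP[c0 _]; rewrite subr0 mulr_ge0 ?df0.
Qed.

Lemma sin_le_id x : 0 <= x -> sin x <= x.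
Proof.
move=> x0; rewrite -subr_ge0.
have dB (y : R) : is_derive y 1 (fun z : R => z - sin z) (1 - cos y).
  exact: is_deriveB.
have d0 (y : R) : 0 <= y -> 0 <= 1 - cos y by rewrite subr_ge0 cos_le1.
by have := nondecreasing_from0 dB d0 x0; rewrite sin0 subrr.
Qed.

Lemma norm_sin_le x : `|sin x| <= `|x|.
Proof.
wlog x0 : x / 0 <= x => [wl|].
  have [/wl//|/ltW x0] := leP 0 x.
  by have := wl (- x); rewrite sinN !normrN oppr_ge0 => /(_ x0).
have [x1|x1] := leP x 1; last first.
  by rewrite (ger0_norm x0) (le_trans (sin_max x)) // ltW.
rewrite (ger0_norm x0) ger0_norm ?sin_le_id//.
by rewrite sin_ge0_pi// x0 (le_trans x1)// (le_trans _ (@pi_ge2 R))// ler1n.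
Qed.

Lemma cos_half x : cos x = 1 - 2 * sin (x / 2) ^+ 2.
Proof.
have {1}-> : x = (x / 2) *+ 2 by rewrite mulr2n -splitr.
by rewrite cos_mulr2n cos2sin2; ring.
Qed.

(** Holds for all x because it is [sin (x / 2)^2 <= (x / 2)^2]. *)
Lemma cos_ge_quad x : 1 - x ^+ 2 / 2 <= cos x.
Proof.
rewrite cos_half.
have : sin (x / 2) ^+ 2 <= (x / 2) ^+ 2.
  by rewrite -(real_normK (num_real (x/2))) -(real_normK (num_real (sin _))) lerXn2r ?nnegrE ?norm_sin_le.
lra.
Qed.

Lemma sin_ge_cubic x : 0 <= x -> x - x ^+ 3 / 6 <= sin x.
Proof.
move=> x0; rewrite -subr_ge0.
have dX (y : R) : is_derive y 1 (fun z : R => z ^+ 3) (3 * y ^+ 2).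
  rewrite -[X in is_derive _ _ X]/(id ^+ 3).
  by apply: is_derive_eq; rewrite /GRing.scale/= mulr1.
have dB (y : R) : is_derive y 1 (fun z : R => sin z - (z - 6^-1 *: (z ^+ 3)))
    (cos y - (1 - 6^-1 *: (3 * y ^+ 2))).
  by apply: is_deriveB; apply: is_deriveB; exact: is_deriveZ.
have d0 (y : R) : 0 <= y -> 0 <= cos y - (1 - 6^-1 *: (3 * y ^+ 2)).
  move=> _; have := cos_ge_quad y; rewrite /GRing.scale/=; lra.
have := nondecreasing_from0 dB d0 x0.
by rewrite sin0 expr0n/= scaler0 !subrr /GRing.scale/= [6^-1 * _]mulrC.
Qed.

(** The matching upper bound; a cubic error term is enough, as it is to be
    integrated against a Gaussian of small standard deviation. *)
Lemma cos_le_cubic x : cos x <= 1 - x ^+ 2 / 2 + `|x| ^+ 3.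
Proof.
wlog x0 : x / 0 <= x => [wl|].
  have [/wl//|/ltW x0] := leP 0 x.
  by have := wl (- x); rewrite cosN normrN sqrrN oppr_ge0 => /(_ x0).
rewrite (ger0_norm x0).
have [x2|x2] := leP x 2; last first.
  by have := cos_le1 x; nra.
have y0 : 0 <= x / 2 by lra.
have := sin_ge_cubic y0; rewrite cos_half.
set y := x / 2 in y0 *; set s := sin y.
have -> : x = 2 * y by rewrite /y; field.
have y1 : y <= 1 by rewrite /y; lra.
move=> ys.
have : (y - y ^+ 3 / 6) ^+ 2 <= s ^+ 2.
  rewrite lerXn2r ?nnegrE//; last apply: le_trans ys; nra.
nra.
Qed.

End trigonometric_bounds.

(** * Moments of the centred normal distribution *)

Section gaussian_moments.
Context {R : realType} (sigma : R).
Hypothesis sigma_gt0 : 0 < sigma.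
Local Notation leb := (@lebesgue_measure R).
Local Notation nu := (normal_prob (0:R) sigma).
Local Notation e := (normal_fun (0:R) sigma).

Let sigma_neq0 : sigma != 0. Proof. by rewrite gt_eqF. Qed.

(** The density of the normal distribution is its Radon-Nikodym derivative, so
    the change of variables formula applies. *)
Lemma ge0_integral_normal_prob (f : R -> \bar R) :
  measurable_fun setT f -> (forall x, 0 <= f x)%E ->
  (\int[nu]_x f x = \int[leb]_x (f x * (normal_pdf 0 sigma x)%:E))%E.
Proof.
move=> mf f0.
have dom := normal_prob_dominates (0:R) sigma.
rewrite -(@Radon_Nikodym_SigmaFinite.change_of_variables _ _ _ nu leb dom)//.
have mrn : measurable_fun setT (Radon_Nikodym_SigmaFinite.f nu leb).
  by apply: measurable_int; exact: Radon_Nikodym_SigmaFinite.f_integrable.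
have mpdf : measurable_fun setT (fun x => (normal_pdf 0 sigma x)%:E).
  by apply/measurable_EFinP; exact: measurable_normal_pdf.
apply: ae_eq_integral => //.
- exact: emeasurable_funM.
- exact: emeasurable_funM.
have /filterS : ae_eq leb setT (Radon_Nikodym_SigmaFinite.f nu leb)
    (fun x => (normal_pdf 0 sigma x)%:E).
  apply: integral_ae_eq => //.
    exact: Radon_Nikodym_SigmaFinite.f_integrable.
  by move=> A _ mA; rewrite -(Radon_Nikodym_SigmaFinite.f_integral dom).
by apply => x /(_ I) -> _.
Qed.

Lemma derive_normal_fun (x : R) :
  is_derive x 1 e (- (x / sigma ^+ 2) * e x).
Proof.
rewrite /normal_fun.
have dX : is_derive x 1 (fun z : R => - (z - 0) ^+ 2 / (sigma ^+ 2 *+ 2))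
   (- (x / sigma ^+ 2)).
  rewrite [X in is_derive _ _ X _](_ : _ = (- (sigma ^+ 2 *+ 2)^-1) \*: (id ^+ 2)); last first.
    by apply/funext => z /=; rewrite subr0 /GRing.scale/= exprfctE; ring.
  apply: is_derive_eq; rewrite /GRing.scale/= mulr1; field.
  exact: sigma_neq0.
rewrite mulrC; exact: (is_derive1_comp (is_derive_expR _) dX).
Qed.

Lemma continuous_normal_fun : continuous e.
Proof.
move=> x; apply/differentiable_continuous/derivable1_diffP.
by case: (derive_normal_fun x).
Qed.

Lemma normal_fun_tail (x : R) : 0 < x -> e x <= 8 * sigma ^+ 4 / x ^+ 4.
Proof.
move=> x0; rewrite /normal_fun subr0 mulNr expRN.
set y := x ^+ 2 / (sigma ^+ 2 *+ 2).
have y0 : 0 < y by rewrite divr_gt0 ?exprn_gt0 ?mulrn_wgt0 ?exprn_gt0.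
have := expR_ge1Dxn 1 (ltW y0).
rewrite (_ : 2`!%:R = 2)// => h.
have {}h : y ^+ 2 / 2 <= expR y by apply: le_trans h; rewrite lerDr.
have -> : 8 * sigma ^+ 4 / x ^+ 4 = (y ^+ 2 / 2)^-1.
  by rewrite /y; field; rewrite sigma_neq0 gt_eqF.
by rewrite lef_pV2 ?posrE ?expR_gt0// divr_gt0 ?exprn_gt0.
Qed.

(** The boundary terms at infinity in the integrations by parts below. *)
Lemma cvg_normal_fun_pow k : (k <= 2)%N -> x ^+ k * e x @[x --> +oo] --> (0:R).
Proof.
move=> k2; apply: (@squeeze_cvgr _ _ _ _ (cst 0) (fun x => 8 * sigma ^+ 4 * x^-1)).
- near=> x; have x1 : 1 <= x by near: x; exact: nbhs_pinfty_ge.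
  have x0 : 0 < x by rewrite (lt_le_trans _ x1).
  rewrite /= mulr_ge0 ?normal_fun_ge0 ?exprn_ge0 ?(ltW x0)//=.
  apply: (@le_trans _ _ (x ^+ 3 * e x)).
    by rewrite ler_wpM2r ?normal_fun_ge0// ler_weXn2l// (leq_trans k2).
  apply: (@le_trans _ _ (x ^+ 3 * (8 * sigma ^+ 4 / x ^+ 4))).
    by rewrite ler_wpM2l ?exprn_ge0 ?(ltW x0)// normal_fun_tail.
  rewrite le_eqVlt; apply/orP; left; apply/eqP.
  by field; rewrite gt_eqF.
- exact: cvg_cst.
- rewrite -[X in _ --> X](mulr0 (8 * sigma ^+ 4)); apply: cvgMl_tmp.
  apply/gtr0_cvgV0; first exact: nbhs_pinfty_gt.
  by [].
Unshelve. all: by end_near. Qed.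

(** An antiderivative of [x^3 * exp (- x^2 / (2 sigma^2))] is minus
    [(sigma^2 * x^2 + 2 * sigma^4) * exp (- x^2 / (2 sigma^2))]. *)
Lemma integral_cube_normal_fun :
  (\int[leb]_(x in `[0%R, +oo[) (x ^+ 3 * e x)%:E = (2 * sigma ^+ 4)%:E)%E.
Proof.
pose F x := - (sigma ^+ 2 * (x ^+ 2 * e x) + 2 * sigma ^+ 4 * (x ^+ 0 * e x)).
have dF (x : R) : is_derive x 1 F (x ^+ 3 * e x).
  have dX : is_derive x 1 (fun z : R => z ^+ 2) (2 * x).
    rewrite -[X in is_derive _ _ X]/(id ^+ 2).
    by apply: is_derive_eq; rewrite /GRing.scale/= mulr1 expr1.
  have de := derive_normal_fun x.
  have d2 := is_deriveM dX de.
  have d2s := is_deriveZ (sigma ^+ 2) d2.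
  have d0s := is_deriveZ (2 * sigma ^+ 4) de.
  have dN := is_deriveN (is_deriveD d2s d0s).
  have -> : x ^+ 3 * e x = - (sigma ^+ 2 *: (x ^+ 2 *: (- (x / sigma ^+ 2) * e x) + e x *: (2 * x))
      + 2 * sigma ^+ 4 *: (- (x / sigma ^+ 2) * e x)).
    by rewrite /GRing.scale/=; field.
  rewrite [X in is_derive _ _ X](_ : _ = - ((sigma ^+ 2 \*: ((fun z : R => z ^+ 2) * e)) + ((2 * sigma ^+ 4) \*: (e : R -> R)))) //.
  by apply/funext => z; rewrite /F expr0 mul1r.
rewrite (@ge0_continuous_FTC2y _ _ F 0 0).
- rewrite -EFinB; congr EFin; rewrite /F /normal_fun subrr expr0n/= mul0r expr0.
  by rewrite !(mul0r, mulr0) oppr0 mul0r expR0; ring.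
- by move=> x x0; rewrite mulr_ge0 ?exprn_ge0 ?normal_fun_ge0.
- apply: continuous_subspaceT => x; apply: cvgM.
    exact: exprn_continuous.
  exact: continuous_normal_fun.
- have -> : 0 = - (sigma ^+ 2 * 0 + 2 * sigma ^+ 4 * 0) :> R.
    by rewrite !mulr0 addr0 oppr0.
  exact: cvgN (cvgD (cvgMl_tmp (@cvg_normal_fun_pow 2 isT))
    (cvgMl_tmp (@cvg_normal_fun_pow 0 isT))).
- by move=> x _; case: (dF x).
- apply: cvg_at_right_filter; apply/differentiable_continuous/derivable1_diffP.
  by case: (dF 0).
- by move=> x _; rewrite derive1E; case: (dF x).
Qed.

Local Lemma ge0_normal_fun_measurable (f : R -> R) : continuous f ->
  measurable_fun [set: R] (fun x => (f x * e x)%:E).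
Proof.
move=> cf; apply/measurable_EFinP; apply: measurable_funM.
  exact: continuous_measurable_fun.
exact: measurable_normal_fun.
Qed.

Let F2 x := sigma ^+ 2 * (x ^+ 1 * e x).

Let dF2 (x : R) : is_derive x 1 F2 ((sigma ^+ 2 - x ^+ 2) * e x).
Proof.
have de := derive_normal_fun x.
have dp := is_deriveZ (sigma ^+ 2) (is_deriveM (is_derive_id x 1) de).
have -> : (sigma ^+ 2 - x ^+ 2) * e x =
    sigma ^+ 2 *: (x *: (- (x / sigma ^+ 2) * e x) + e x *: 1).
  by rewrite /GRing.scale/=; field.
rewrite [X in is_derive _ _ X](_ : _ = (sigma ^+ 2 \*: (id * (e : R -> R)))).
  exact: dp.
by apply/funext => z; rewrite /F2 expr1.
Qed.

(** [sigma^2 * x * exp (- x^2 / (2 sigma^2))] has derivative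
    [(sigma^2 - x^2) * exp (- x^2 / (2 sigma^2))], which changes sign at
    [sigma]: the half line is cut there, so that only integrals of nonnegative
    functions occur. *)
Lemma integral_square_normal_fun :
  (\int[leb]_(x in `[0%R, +oo[) (x ^+ 2 * e x)%:E =
   (sigma ^+ 2)%:E * \int[leb]_(x in `[0%R, +oo[) (e x)%:E)%E.
Proof.
have cF2 : continuous F2.
  move=> x; apply/differentiable_continuous/derivable1_diffP.
  by case: (dF2 x).
have csq : continuous (fun x : R => sigma ^+ 2 - x ^+ 2).
  by move=> x; apply: cvgB; [exact: cvg_cst|exact: exprn_continuous].
have A : (\int[leb]_(x in `[sigma, +oo[) ((x ^+ 2 - sigma ^+ 2) * e x)%:E =
    (F2 sigma)%:E)%E.
  rewrite (@ge0_continuous_FTC2y _ _ (\- F2) sigma 0).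
  - by rewrite -EFinB/= sub0r opprK.
  - move=> x sx; rewrite mulr_ge0 ?normal_fun_ge0// subr_ge0 lerXn2r ?nnegrE ?(ltW sigma_gt0)//.
    by rewrite (le_trans (ltW sigma_gt0)).
  - apply: continuous_subspaceT => x; apply: cvgM; last exact: continuous_normal_fun.
    by apply: cvgB; [exact: exprn_continuous|exact: cvg_cst].
  - have -> : 0 = - (sigma ^+ 2 * 0) :> R by rewrite mulr0 oppr0.
    exact: cvgN (cvgMl_tmp (@cvg_normal_fun_pow 1 isT)).
  - by move=> x _; apply: derivableN; case: (dF2 x).
  - by apply: cvg_at_right_filter; apply: cvgN; exact: cF2.
  - move=> x _; have := dF2 x => /is_deriveN h; rewrite derive1E.
    by case: h => _ ->; ring.
have B : (\int[leb]_(x in `[0%R, sigma]) ((sigma ^+ 2 - x ^+ 2) * e x)%:E =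
    (F2 sigma)%:E)%E.
  rewrite (@continuous_FTC2 _ _ F2)//.
  - by rewrite {2}/F2 expr1 mul0r mulr0 sube0.
  - by apply: continuous_subspaceT => x; apply: cvgM; [exact: csq|exact: continuous_normal_fun].
  - split.
    + by move=> x _; case: (dF2 x).
    + by apply: cvg_at_right_filter; exact: cF2.
    + by apply: cvg_at_left_filter; exact: cF2.
  - by move=> x _; rewrite derive1E; case: (dF2 x).
have split_int (f : R -> R) : continuous f -> (forall x, 0 <= f x) ->
    (\int[leb]_(x in `[0%R, +oo[) (f x * e x)%:E =
     \int[leb]_(x in `[0%R, sigma]) (f x * e x)%:E +
     \int[leb]_(x in `[sigma, +oo[) (f x * e x)%:E)%E.
  move=> cf f0.
  have -> : `[0%R, +oo[%classic = `[0%R, sigma]%classic `|` `]sigma, +oo[%classic :> set R.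
    by rewrite -itv_bndbnd_setU ?bnd_simp// ltW.
  rewrite ge0_integral_setU//=.
  - by rewrite integral_itv_obnd_cbnd//; apply: measurable_funTS; exact: ge0_normal_fun_measurable.
  - by apply: measurable_funTS; exact: ge0_normal_fun_measurable.
  - by move=> x _; rewrite lee_fin mulr_ge0 ?normal_fun_ge0.
  - apply/disj_setPS => x /=; rewrite !in_itv/= !andbT => -[/andP[_ xs]].
    by rewrite ltNge xs.
have csq2 : continuous (fun x : R => x ^+ 2) by exact: exprn_continuous.
have cs2 : continuous (fun x : R => sigma ^+ 2) by move=> x; exact: cvg_cst.
have -> : ((sigma ^+ 2)%:E * \int[leb]_(x in `[0%R, +oo[) (e x)%:E =
    \int[leb]_(x in `[0%R, +oo[) (sigma ^+ 2 * e x)%:E)%E.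
  rewrite -ge0_integralZl_EFin ?sqr_ge0//.
  - by move=> x _; rewrite lee_fin normal_fun_ge0.
  - by apply/measurable_funTS/measurable_EFinP; exact: measurable_normal_fun.
rewrite !split_int//; try by move=> x; exact: sqr_ge0.
have mB (D : set R) : measurable D -> measurable_fun D (fun x => ((sigma ^+ 2 - x ^+ 2) * e x)%:E).
  by move=> mD; apply: measurable_funTS; apply: ge0_normal_fun_measurable.
have -> : (\int[leb]_(x in `[0%R, sigma]) (sigma ^+ 2 * e x)%:E =
    \int[leb]_(x in `[0%R, sigma]) (x ^+ 2 * e x)%:E + (F2 sigma)%:E)%E.
  rewrite -B -ge0_integralD//=.
  - by apply: eq_integral => x _; rewrite -EFinD; congr EFin; ring.
  - by move=> x _; rewrite lee_fin mulr_ge0 ?sqr_ge0 ?normal_fun_ge0.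
  - by apply: measurable_funTS; exact: ge0_normal_fun_measurable.
  - move=> x; rewrite in_itv/= => /andP[x0 xs]; rewrite lee_fin mulr_ge0 ?normal_fun_ge0//.
    by rewrite subr_ge0 lerXn2r ?nnegrE// ltW.
  - exact: mB.
have -> : (\int[leb]_(x in `[sigma, +oo[) (x ^+ 2 * e x)%:E =
    \int[leb]_(x in `[sigma, +oo[) (sigma ^+ 2 * e x)%:E + (F2 sigma)%:E)%E.
  rewrite -A -ge0_integralD//=.
  - by apply: eq_integral => x _; rewrite -EFinD; congr EFin; ring.
  - by move=> x _; rewrite lee_fin mulr_ge0 ?sqr_ge0 ?normal_fun_ge0.
  - by apply: measurable_funTS; exact: ge0_normal_fun_measurable.
  - move=> x; rewrite in_itv/= andbT => sx; rewrite lee_fin mulr_ge0 ?normal_fun_ge0//.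
    by rewrite subr_ge0 lerXn2r ?nnegrE ?(ltW sigma_gt0)// (le_trans (ltW sigma_gt0)).
  - apply: measurable_funTS; apply: ge0_normal_fun_measurable => x.
    by apply: cvgB; [exact: exprn_continuous|exact: cvg_cst].
by rewrite addeA addeAC.
Qed.

Let peak := normal_peak sigma.

Lemma ge0_even_integral_normal_prob (f : R -> R) :
  continuous f -> (forall x, 0 <= f x) -> f =1 f \o -%R ->
  (\int[nu]_x (f x)%:E =
   (2 * peak)%:E * \int[leb]_(x in `[0%R, +oo[) (f x * e x)%:E)%E.
Proof.
move=> cf f0 fN.
rewrite ge0_integral_normal_prob//; last first.
  by apply/measurable_EFinP; exact: continuous_measurable_fun.
under eq_integral do rewrite normal_pdfE//= -/peak -EFinM mulrCA EFinM.
rewrite ge0_integralZl_EFin ?normal_peak_ge0//; last first.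
  exact: ge0_normal_fun_measurable.
  by move=> x _; rewrite lee_fin mulr_ge0 ?normal_fun_ge0.
rewrite (@ge0_symfun_integralT _ (fun x => f x * e x)).
- by rewrite -set_itvcy muleA -EFinM mulrC.
- by move=> x; rewrite mulr_ge0 ?normal_fun_ge0.
- by move=> x; apply: cvgM; [exact: cf|exact: continuous_normal_fun].
- by move=> x /=; rewrite (fN x) /normal_fun !subr0 sqrrN.
Qed.

Lemma normal_second_moment :
  (\int[nu]_x (x ^+ 2)%:E = (sigma ^+ 2)%:E)%E.
Proof.
rewrite ge0_even_integral_normal_prob.
- rewrite integral_square_normal_fun muleCA.
  have nu1 : (\int[nu]_x (cst 1 x)%:E = 1)%E.
    rewrite ge0_integral_normal_prob//; last first.
      by apply/measurable_EFinP; exact: measurable_cst.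
    under eq_integral do rewrite mul1e.
    exact: integral_normal_pdf.
  transitivity ((sigma ^+ 2)%:E * 1)%E; last by rewrite mule1.
  congr (_ * _)%E; rewrite -nu1.
  rewrite ge0_even_integral_normal_prob//; last by move=> x; exact: cvg_cst.
  by under [in RHS]eq_integral do rewrite /= mul1r.
- exact: exprn_continuous.
- by move=> x; exact: sqr_ge0.
- by move=> x /=; rewrite sqrrN.
Qed.

(** The exact value is [4 * sigma^3 / sqrt (2 pi)]; the rounder bound follows
    from [pi >= 2]. *)
Lemma normal_third_moment :
  (\int[nu]_x (`|x| ^+ 3)%:E <= (2 * sigma ^+ 3)%:E)%E.
Proof.
rewrite ge0_even_integral_normal_prob.
- have -> : (\int[leb]_(x in `[0%R, +oo[) (`|x| ^+ 3 * e x)%:E =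
      \int[leb]_(x in `[0%R, +oo[) (x ^+ 3 * e x)%:E)%E.
    by apply: eq_integral => x; rewrite inE/= in_itv/= andbT => x0; rewrite ger0_norm.
  rewrite integral_cube_normal_fun -EFinM lee_fin.
  suff : peak * sigma <= 2^-1.
    move=> h; have -> : 2 * peak * (2 * sigma ^+ 4) = (4 * sigma ^+ 3) * (peak * sigma) by ring.
    have -> : 2 * sigma ^+ 3 = (4 * sigma ^+ 3) * 2^-1 by field.
    by rewrite ler_wpM2l// mulr_ge0// exprn_ge0// ltW.
  have q_ge : 2 * sigma <= Num.sqrt (sigma ^+ 2 * pi *+ 2).
    have s2 : 0 < sigma ^+ 2 by rewrite exprn_gt0.
    rewrite -[leLHS]ger0_norm ?mulr_ge0 ?(ltW sigma_gt0)// -sqrtr_sqr.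
    by rewrite ler_wsqrtr// -mulr_natr; have := @pi_ge2 R; nra.
  have q_gt0 : 0 < Num.sqrt (sigma ^+ 2 * pi *+ 2).
    by apply: lt_le_trans q_ge; rewrite mulr_gt0.
  rewrite /peak /normal_peak ler_pdivrMl//; lra.
- move=> x; have := @exprn_continuous R 3 `|x|.
  by apply: cvg_comp; exact: norm_continuous.
- by move=> x; rewrite exprn_ge0.
- by move=> x /=; rewrite normrN.
Qed.

(** Symmetry of the centred normal distribution. *)
Lemma normal_prob_sym (f : R -> \bar R) :
  measurable_fun [set: R] f -> (forall x, 0 <= f x)%E ->
  (\int[nu]_x f x = \int[nu]_x f (- x)%R)%E.
Proof.
move=> mf f0.
have mfN : measurable_fun [set: R] (fun x => f (- x)%R).
  by apply: measurableT_comp.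
have mpdf : measurable_fun [set: R] (fun x => (normal_pdf 0 sigma x)%:E).
  by apply/measurable_EFinP; exact: measurable_normal_pdf.
rewrite !ge0_integral_normal_prob//.
have mN : measurable_fun [set: measurableTypeR R] (-%R : measurableTypeR R -> measurableTypeR R).
  exact: oppr_measurable.
transitivity (\int[pushforward leb (-%R : R -> measurableTypeR R)]_x
  (f x * (normal_pdf 0 sigma x)%:E))%E.
  by apply: eq_measure_integral => A mA _; have /= := lebesgue_measureN mA.
have mF : measurable_fun [set: R] (fun x => f x * (normal_pdf 0 sigma x)%:E)%E.
  exact: emeasurable_funM.
have F0 : {in [set: R], forall x : R, (0 <= f x * (normal_pdf 0 sigma x)%:E)%E}.
  by move=> x _; rewrite mule_ge0// lee_fin normal_pdf_ge0.
have pdfN (x : R) : normal_pdf 0 sigma (- x) = normal_pdf 0 sigma x.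
  by rewrite !normal_pdfE//= /normal_fun !subr0 sqrrN.
have := ge0_integral_pushforward mN leb measurableT mF F0.
move=> ->; rewrite preimage_setT.
by apply: eq_integral => x _ /=; rewrite pdfN.
Qed.

End gaussian_moments.

(** * Gaussian random variables *)

Section bounded_integrands.
Context {d : measure_display} {T : measurableType d} {R : realType}.
Variable P : probability T R.

Lemma bounded_integrable_prob (f : T -> R) (M : R) (A : set T) :
  measurable A -> measurable_fun [set: T] f -> (forall x, `|f x| <= M) ->
  P.-integrable A (EFin \o f).
Proof.
move=> mA mf fM; apply: measurable_bounded_integrable => //.
- by rewrite (le_lt_trans (probability_le1 P mA))// ltry.
- exact: measurable_funTS.
- exists M; split; first exact: num_real.
  by move=> x Mx y _ /=; rewrite (le_trans (fM y))// ltW.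
Qed.

Lemma integrable_cos (f : T -> R) (A : set T) :
  measurable A -> measurable_fun [set: T] f ->
  P.-integrable A (EFin \o (cos \o f)).
Proof.
move=> mA mf; apply: (@bounded_integrable_prob _ 1) => //.
  by apply: measurableT_comp => //; exact: continuous_measurable_fun (@continuous_cos R).
by move=> x; exact: cos_max.
Qed.

Lemma integrable_sin (f : T -> R) (A : set T) :
  measurable A -> measurable_fun [set: T] f ->
  P.-integrable A (EFin \o (sin \o f)).
Proof.
move=> mA mf; apply: (@bounded_integrable_prob _ 1) => //.
  by apply: measurableT_comp => //; exact: continuous_measurable_fun (@continuous_sin R).
by move=> x; exact: sin_max.
Qed.

Lemma integrable_EFinB (f g : T -> R) (A : set T) : measurable A ->
  P.-integrable A (EFin \o f) -> P.-integrable A (EFin \o g) ->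
  P.-integrable A (EFin \o (fun w => f w - g w)).
Proof. by move=> mA f_int g_int; have := integrableB mA f_int g_int. Qed.

Lemma integrable_EFinD (f g : T -> R) (A : set T) : measurable A ->
  P.-integrable A (EFin \o f) -> P.-integrable A (EFin \o g) ->
  P.-integrable A (EFin \o (fun w => f w + g w)).
Proof. by move=> mA f_int g_int; have := integrableD mA f_int g_int. Qed.

Lemma integrable_EFinZ (f : T -> R) (a : R) (A : set T) : measurable A ->
  P.-integrable A (EFin \o f) -> P.-integrable A (EFin \o (fun w => a * f w)).
Proof. by move=> mA f_int; have := integrableZl mA a f_int. Qed.

End bounded_integrands.

Section gaussian_variables.
Context {d : measure_display} {T : measurableType d} {R : realType}.
Variable P : probability T R.

Definition gaussian_variable (X : T -> R) (sigma : R) : Prop :=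
  measurable_fun [set: T] X /\
  forall A : set R, measurable A -> P (X @^-1` A) = normal_prob 0 sigma A.

Variables (X : T -> R) (sigma : R).
Hypotheses (sigma_gt0 : 0 < sigma) (hX : gaussian_variable X sigma).

Let mX : measurable_fun [set: T] X. Proof. by case: hX. Qed.

Lemma ge0_expectation_gaussian (f : R -> \bar R) :
  measurable_fun [set: R] f -> (forall x, 0 <= f x)%E ->
  (\int[P]_w f (X w) = \int[normal_prob 0 sigma]_x f x)%E.
Proof.
move=> mf f0.
have mX' : measurable_fun [set: T] (X : T -> measurableTypeR R) by exact: mX.
have f0' : {in [set: measurableTypeR R], forall x, (0 <= f x)%E} by move=> x _.
have := @ge0_integral_pushforward _ _ T (measurableTypeR R) R X mX' P setT f
  measurableT mf f0'.
rewrite preimage_setT => <-.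
by apply: eq_measure_integral => A mA _; case: hX => _; exact.
Qed.

Let mXpow k : measurable_fun [set: T] (fun w => `|X w| ^+ k).
Proof.
apply: (measurable_funX k).
by apply: measurableT_comp.
Qed.

Lemma gaussian_second_moment : (\int[P]_w (X w ^+ 2)%:E = (sigma ^+ 2)%:E)%E.
Proof.
rewrite (@ge0_expectation_gaussian (fun x => (x ^+ 2)%:E)) ?normal_second_moment//.
- by apply/measurable_EFinP; exact: exprn_measurable.
- by move=> x; rewrite lee_fin sqr_ge0.
Qed.

Lemma gaussian_third_moment : (\int[P]_w (`|X w| ^+ 3)%:E <= (2 * sigma ^+ 3)%:E)%E.
Proof.
rewrite (@ge0_expectation_gaussian (fun x => (`|x| ^+ 3)%:E)) ?normal_third_moment//.
exact/measurable_EFinP/measurable_funX.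
Qed.

Let i2 : P.-integrable [set: T] (fun w => (X w ^+ 2)%:E).
Proof.
apply/integrableP; split.
  by apply/measurable_EFinP; exact: measurable_funX.
under eq_integral do rewrite gee0_abs ?lee_fin ?sqr_ge0//.
by rewrite gaussian_second_moment ltry.
Qed.

Let i3 : P.-integrable [set: T] (fun w => (`|X w| ^+ 3)%:E).
Proof.
apply/integrableP; split.
  by apply/measurable_EFinP.
under eq_integral do rewrite gee0_abs ?lee_fin ?exprn_ge0//.
by rewrite (le_lt_trans gaussian_third_moment)// ltry.
Qed.

Let R2 : \int[P]_w (X w ^+ 2) = sigma ^+ 2.
Proof. by rewrite /Rintegral gaussian_second_moment. Qed.

Let R3 : \int[P]_w (`|X w| ^+ 3) <= 2 * sigma ^+ 3.
Proof.
rewrite -lee_fin /Rintegral fineK ?gaussian_third_moment//.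
exact: integrable_fin_num i3.
Qed.

Let R1 : \int[P]_w 1 = 1 :> R.
Proof. by rewrite /Rintegral integral_cst// mul1e; exact: (congr1 fine (probability_setT P)). Qed.

Let maX a : measurable_fun [set: T] (fun w => a * X w).
Proof. exact: measurable_funM. Qed.

Let i1 : P.-integrable [set: T] (EFin \o (fun _ => 1 : R)).
Proof. by apply: (@bounded_integrable_prob _ _ _ _ _ 1) => // x; rewrite normr1. Qed.

Let sinX_measurable a : measurable_fun [set: R] (fun x : R => (1 + sin (a * x))%:E).
Proof.
apply/measurable_EFinP; apply: continuous_measurable_fun => x.
apply: cvgD; first exact: cvg_cst.
apply: (@continuous_comp _ _ _ (fun y => a * y) sin); last exact: continuous_sin.
exact: mulrl_continuous.
Qed.

(** By symmetry; [1 + sin] is used to stay with nonnegative integrands. *)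
Lemma gaussian_sin a : \int[P]_w sin (a * X w) = 0.
Proof.
have isin b : P.-integrable [set: T] (EFin \o (fun w => sin (b * X w))).
  exact: integrable_sin.
have sin1 b (x : R) : (0 <= (1 + sin (b * x))%:E)%E.
  by rewrite lee_fin; have := sin_geN1 (b * x); lra.
have E b : (\int[P]_w (1 + sin (b * X w))%:E)%E = (1 + \int[P]_w sin (b * X w))%:E.
  rewrite -[X in (X + _)%:E]R1 -RintegralD// /Rintegral fineK//.
  by apply: integrable_fin_num => //; exact: (integrableD _ i1 (isin b)).
have : (\int[P]_w (1 + sin (a * X w))%:E = \int[P]_w (1 + sin (- a * X w))%:E)%E.
  rewrite (@ge0_expectation_gaussian (fun x => (1 + sin (a * x))%:E))//.
  rewrite (@ge0_expectation_gaussian (fun x => (1 + sin (- a * x))%:E))//.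
  rewrite normal_prob_sym//; apply: eq_integral => x _.
  by rewrite mulrN mulNr.
rewrite !E => -[/addrI]; under [in X in _ = X -> _]eq_Rintegral do rewrite mulNr sinN -mulN1r.
rewrite RintegralZl// => h; lra.
Qed.

(** The two bounds on the characteristic function follow by integrating the
    polynomial bounds on the cosine. *)
Lemma gaussian_cos_ge a : 1 - a ^+ 2 * sigma ^+ 2 / 2 <= \int[P]_w cos (a * X w).
Proof.
have i2a : P.-integrable [set: T] (EFin \o (fun w => a ^+ 2 / 2 * X w ^+ 2)).
  exact: integrable_EFinZ.
have -> : 1 - a ^+ 2 * sigma ^+ 2 / 2 = \int[P]_w (1 - (a ^+ 2 / 2) * X w ^+ 2).
  by rewrite RintegralB// R1 RintegralZl// R2; field.
apply: le_Rintegral => //.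
- exact: integrable_EFinB.
- exact: integrable_cos.
- by move=> w _; apply: le_trans (cos_ge_quad _); rewrite exprMn; lra.
Qed.

Lemma gaussian_cos_le a :
  \int[P]_w cos (a * X w) <= 1 - a ^+ 2 * sigma ^+ 2 / 2 + 2 * `|a| ^+ 3 * sigma ^+ 3.
Proof.
have i2a : P.-integrable [set: T] (EFin \o (fun w => a ^+ 2 / 2 * X w ^+ 2)).
  exact: integrable_EFinZ.
have i3a : P.-integrable [set: T] (EFin \o (fun w => `|a| ^+ 3 * `|X w| ^+ 3)).
  exact: integrable_EFinZ.
have iB : P.-integrable [set: T] (EFin \o (fun w => 1 - (a ^+ 2 / 2) * X w ^+ 2)).
  exact: integrable_EFinB.
apply: (@le_trans _ _ (\int[P]_w (1 - (a ^+ 2 / 2) * X w ^+ 2 + `|a| ^+ 3 * `|X w| ^+ 3))).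
  apply: le_Rintegral => //.
  - exact: integrable_cos.
  - exact: integrable_EFinD.
  - move=> w _; apply: le_trans (cos_le_cubic _) _.
    by rewrite normrM !exprMn; lra.
rewrite RintegralD// RintegralB// R1 !RintegralZl// R2.
have : `|a| ^+ 3 * \int[P]_w `|X w| ^+ 3 <= `|a| ^+ 3 * (2 * sigma ^+ 3).
  by rewrite ler_wpM2l// exprn_ge0.
lra.
Qed.

(** Markov's inequality for the third absolute moment.  The power 3 matters:
    over a fixed time there are of order [sigma^-2] steps, so the total
    probability of a large step is of order [sigma]. *)
Lemma gaussian_tail (r : R) : 0 < r ->
  fine (P [set w | r < `|X w|]) <= 2 * sigma ^+ 3 / r ^+ 3.
Proof.
move=> r0; have mA : measurable [set w | r < `|X w|].
  rewrite -[X in measurable X]setTI.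
  have mN : measurable_fun [set: T] (fun w => `|X w|) by exact: (mXpow 1).
  rewrite (_ : [set w | _] = (fun w => `|X w|) @^-1` `]r, +oo[%classic); last first.
    by apply/seteqP; split => w /=; rewrite in_itv/= andbT.
  exact: mN.
rewrite ler_pdivlMr ?exprn_gt0// -lee_fin EFinM fineK; last exact: fin_num_measure.
apply: le_trans gaussian_third_moment.
rewrite muleC -integral_cst// integral_mkcond; apply: ge0_le_integral => //.
- by move=> w _; rewrite patchE; case: ifP => // _; rewrite lee_fin exprn_ge0// ltW.
- apply/(measurable_restrictT _ mA)/measurable_cst => //.
- by apply/measurable_EFinP.
- move=> w _; rewrite patchE; case: ifPn => [|_]; last by rewrite lee_fin exprn_ge0.
  rewrite inE/= => rX; rewrite lee_fin lerXn2r ?nnegrE// ltW//.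
Qed.

End gaussian_variables.

(** * Independence of the past of a sequence *)

Section independence.
Context {d : measure_display} {T : measurableType d} {R : realType}.
Variable P : probability T R.

(** The law of a pair of independent variables is the product of their laws. *)
Lemma independent_fubini d1 d2 (T1 : measurableType d1) (T2 : measurableType d2)
    (U : {mfun T >-> T1}) (X : {mfun T >-> T2}) :
  (forall B C, measurable B -> measurable C ->
     P (U @^-1` B `&` X @^-1` C) = (P (U @^-1` B) * P (X @^-1` C))%E) ->
  forall F : T1 * T2 -> \bar R, measurable_fun [set: T1 * T2] F ->
  (forall z, 0 <= F z)%E ->
  (\int[P]_w F (U w, X w) = \int[P]_w \int[P]_v F (U w, X v))%E.
Proof.
move=> UX F mF F0.
have mUX : measurable_fun [set: T] (fun w => (U w, X w)).
  exact: measurable_fun_pair.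
pose UXm : {mfun T >-> (T1 * T2)%type} := HB.pack (fun w => (U w, X w))
  (isMeasurableFun.Build _ _ _ _ _ mUX).
have prodE S : measurable S ->
    (distribution P U \x distribution P X)%E S = distribution P UXm S.
  by apply: product_measure_unique => B C mB mC; exact: UX.
rewrite -(@ge0_integral_distribution _ _ _ _ _ P UXm F)//.
transitivity (\int[(distribution P U \x distribution P X)%E]_z F z)%E.
  by apply: eq_measure_integral => S mS _; exact: (esym (prodE S mS)).
rewrite fubini_tonelli1//.
have mG := @measurable_fun_fubini_tonelli_F _ _ _ _ _ (distribution P X) F mF F0.
rewrite ge0_integral_distribution//; last first.
  by move=> y; exact: integral_ge0.
apply: eq_integral => w _ /=.
rewrite /fubini_F ge0_integral_distribution//.
exact: measurableT_comp.
Qed.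

Variable Z : nat -> T -> R.
Hypothesis mZ : forall j, measurable_fun [set: T] (Z j).
Hypothesis indepZ : forall (n : nat) (B : nat -> set R),
  (forall j, measurable (B j)) ->
  P (\bigcap_(j in `I_n) Z j @^-1` B j) = (\prod_(j < n) P (Z j @^-1` B j))%E.

(** A pi-system generating the sigma-algebra of the first [k] variables. *)
Definition boxes (k : nat) : set (set T) :=
  [set A | exists B : nat -> set R, (forall j, measurable (B j)) /\
     A = \bigcap_(j in `I_k) Z j @^-1` B j].

Definition past (k : nat) := g_sigma_algebraType (boxes k).

Let mZpre j (B : set R) : measurable B -> measurable (Z j @^-1` B).
Proof. by move=> mB; rewrite -[X in measurable X]setTI; exact: mZ. Qed.

Lemma boxes_subset k l : (k <= l)%N -> boxes k `<=` boxes l.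
Proof.
move=> kl A [B [mB ->]].
exists (fun j => if (j < k)%N then B j else setT); split.
  by move=> j; case: ifP.
apply/seteqP; split=> [w Bw j /= jl|w Bw j /= jk].
  by case: ifP => // jk; exact: Bw.
by have := Bw j (leq_trans jk kl); rewrite /= jk.
Qed.

Lemma past_measurable k (A : set T) : @measurable _ (past k) A -> measurable A.
Proof.
apply: smallest_sub => [|_ [B [mB ->]]].
  split; first exact: measurable0.
  - by move=> S mS; rewrite setTD; exact: measurableC.
  - by move=> F mF; exact: bigcupT_measurable.
by apply: bigcap_measurableType => j _; exact: mZpre.
Qed.

Lemma past_subset k l (A : set T) : (k <= l)%N ->
  @measurable _ (past k) A -> @measurable _ (past l) A.
Proof.
move=> kl; apply: sub_smallest2r; first exact: smallest_sigma_algebra.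
exact: boxes_subset.
Qed.

Lemma boxes_setI k : setI_closed (boxes k).
Proof.
move=> _ _ [B [mB ->]] [C [mC ->]].
exists (fun j => B j `&` C j); split; first by move=> j; exact: measurableI.
apply/seteqP; split => [w [Bw Cw] j jk|w BCw]; first by split; [exact: Bw|exact: Cw].
by split=> j jk; have [] := BCw j jk.
Qed.

(** The product rule on boxes extends to the generated sigma-algebra by
    Dynkin's pi-lambda theorem. *)
Lemma past_indep k (A : set T) (C : set R) : @measurable _ (past k) A ->
  measurable C -> P (A `&` Z k @^-1` C) = (P A * P (Z k @^-1` C))%E.
Proof.
move=> mA mC.
apply: (@dynkin_induction _ (past k) (boxes k)
  (fun A => P (A `&` Z k @^-1` C) = (P A * P (Z k @^-1` C))%E)) => //.
- exact: boxes_setI.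
- by rewrite setTI probability_setT mul1e.
- move=> _ [B [mB ->]].
  pose B' j := if (j < k)%N then B j else C.
  have mB' j : measurable (B' j) by rewrite /B'; case: ifP.
  have -> : \bigcap_(j in `I_k) Z j @^-1` B j `&` Z k @^-1` C =
      \bigcap_(j in `I_k.+1) Z j @^-1` B' j.
    apply/seteqP; split => [w [Bw Cw] j /= jk1|w B'w].
      rewrite /B'; case: ifPn => [jk|]; first exact: Bw.
      by rewrite -leqNgt => kj; have -> : j = k by apply/eqP; rewrite eqn_leq kj -ltnS jk1.
    split; first by move=> j /= jk; have := B'w j (ltnW jk); rewrite /= /B' jk.
    by have := B'w k (ltnSn k); rewrite /= /B' ltnn.
  rewrite !indepZ// big_ord_recr/= /B' ltnn; congr (_ * _)%E.
  by apply: eq_bigr => j _; rewrite ltn_ord.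
- move=> S /past_measurable mS SC.
  have mD : measurable (Z k @^-1` C) by exact: mZpre.
  have Doo : (P (Z k @^-1` C) < +oo)%E.
    by rewrite (le_lt_trans (probability_le1 P mD))// ltry.
  have DE : P (Z k @^-1` C `\` S) = (P (Z k @^-1` C) - P (Z k @^-1` C `&` S))%E.
    exact: measureD.
  rewrite probability_setC// setIC -setDE DE [Z k @^-1` C `&` S]setIC SC.
  have : P S \is a fin_num by exact: fin_num_measure.
  have : P (Z k @^-1` C) \is a fin_num by exact: fin_num_measure.
  case: (P (Z k @^-1` C)) (P S) => [b||] [a||]// _ _.
  by rewrite -EFinM -!EFinB -EFinM mulrBl mul1r.
- move=> F mF tF FC; rewrite setI_bigcupl.
  have mF' n : @measurable _ T (F n) by apply: (@past_measurable k); exact: mF.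
  have -> : P (\bigcup_n (F n `&` Z k @^-1` C)) = (\sum_(0 <= n <oo | n \in [set: nat]) P (F n `&` Z k @^-1` C))%E.
    apply: measure_bigcup => [n _|]; first by apply: measurableI => //; exact: mZpre.
    exact: trivIset_setIr.
  have -> : P (\bigcup_n F n) = (\sum_(0 <= n <oo | n \in [set: nat]) P (F n))%E.
    exact: measure_bigcup.
  rewrite muleC -[P (Z k @^-1` C)]fineK ?fin_num_measure//; last exact: mZpre.
  rewrite -nneseriesZl//; apply: eq_eseriesr => n _.
  by rewrite FC muleC fineK ?fin_num_measure//; exact: mZpre.
Qed.

End independence.

(** * The cosine test function along a Gaussian walk *)

Section gaussian_walk.
Context {d : measure_display} {T : measurableType d} {R : realType}.
Variable P : probability T R.
Variables (Z : nat -> T -> R) (sigma : R).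

Definition gaussian_noise : Prop :=
  (forall j, gaussian_variable P (Z j) sigma) /\
  (forall (n : nat) (B : nat -> set R), (forall j, measurable (B j)) ->
    P (\bigcap_(j in `I_n) Z j @^-1` B j) = (\prod_(j < n) P (Z j @^-1` B j))%E).

Hypotheses (sigma_gt0 : 0 < sigma) (hZ : gaussian_noise).

Let mZ j : measurable_fun [set: T] (Z j).
Proof. by case: hZ => gZ _; case: (gZ j). Qed.

Let indepZ := hZ.2.

Local Notation past := (past Z).

Lemma noise_past_measurable k j : (j < k)%N -> measurable_fun [set: past k] (Z j).
Proof.
move=> jk _ B mB; rewrite setTI; apply: sub_gen_smallest.
exists (fun i => if i == j then B else setT); split; first by move=> i; case: ifP.
apply/seteqP; split => [w Bw i /= _|w Bw]; first by case: eqP => // ->.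
by have := Bw j jk; rewrite /= eqxx.
Qed.

Lemma past_fun_measurable k (f : T -> R) :
  measurable_fun [set: past k] f -> measurable_fun [set: T] f.
Proof.
move=> mf _ B mB; rewrite setTI; apply: (past_measurable mZ).
by rewrite -[X in measurable X]setTI; exact: mf.
Qed.

Lemma past_fun_subset k l (f : T -> R) : (k <= l)%N ->
  measurable_fun [set: past k] f -> measurable_fun [set: past l] f.
Proof.
move=> kl mf _ B mB; rewrite setTI; apply: (past_subset kl).
by rewrite -[X in measurable X]setTI; exact: mf.
Qed.

Local Lemma Rintegral_indic (A : set T) (f : T -> R) :
  \int[P]_(w in A) f w = \int[P]_w (\1_A w * f w).
Proof.
rewrite Rintegral_mkcond; apply: eq_Rintegral => w _.
by rewrite patchE indicE; case: ifP; rewrite ?mul1r ?mul0r.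
Qed.

Local Lemma integral_EFin_Rintegral (f : T -> R) : P.-integrable [set: T] (EFin \o f) ->
  (\int[P]_w (f w)%:E = (\int[P]_w f w)%:E)%E.
Proof. by move=> f_int; rewrite fineK//; exact: integrable_fin_num. Qed.

(** [cos (V + c Z) = cos V * cos (c Z) - sin V * sin (c Z)], where [Z] is
    independent of [V] and of [A], and the sine term vanishes by symmetry.
    Thus a cosine of the walk is an eigenfunction of one step, also on an
    event of the past. *)
Lemma cos_step k (A : set T) (V : T -> R) (c : R) :
  @measurable _ (past k) A -> measurable_fun [set: past k] V ->
  \int[P]_(w in A) cos (V w + c * Z k w) =
  (\int[P]_w cos (c * Z k w)) * \int[P]_(w in A) cos (V w).
Proof.
move=> mA mV.
have mAT : measurable A by exact: (past_measurable mZ mA).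
have mVT : measurable_fun [set: T] V by exact: (past_fun_measurable mV).
set chi := \int[P]_w cos (c * Z k w).
have mcZ : measurable_fun [set: T] (fun w => c * Z k w) by exact: measurable_funM.
have mid : measurable_fun [set: T] (id : T -> past k).
  by move=> _ B mB; rewrite setTI; exact: (past_measurable mZ mB).
pose U : {mfun T >-> past k} := HB.pack (id : T -> past k)
  (isMeasurableFun.Build _ _ _ _ _ mid).
pose X : {mfun T >-> R} := HB.pack (Z k) (isMeasurableFun.Build _ _ _ _ _ (mZ k)).
pose F (z : past k * R) : \bar R := (\1_A z.1 * (1 + cos (V z.1 + c * z.2)))%:E.
have mF : measurable_fun [set: past k * R] F.
  apply/measurable_EFinP; apply: measurable_funM.
    by apply: measurableT_comp => //; exact: measurable_indic.
  apply: measurable_funD => //.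
  apply: measurableT_comp; first exact: continuous_measurable_fun (@continuous_cos R).
  apply: measurable_funD; first by apply: measurableT_comp.
  exact: measurable_funM.
have F0 z : (0 <= F z)%E.
  rewrite lee_fin mulr_ge0//; have := cos_geN1 (V z.1 + c * z.2); lra.
have UX (B : set (past k)) (C : set R) : measurable B -> measurable C ->
    P (U @^-1` B `&` X @^-1` C) = (P (U @^-1` B) * P (X @^-1` C))%E.
  by move=> mB mC; exact: (past_indep mZ indepZ).
have R1 : \int[P]_w 1 = 1 :> R.
  by rewrite /Rintegral integral_cst// mul1e; exact: (congr1 fine (probability_setT P)).
have i1 : P.-integrable [set: T] (EFin \o (fun _ => 1 : R)).
  by apply: (@bounded_integrable_prob _ _ _ _ _ 1) => // x; rewrite normr1.
have inner w : (\int[P]_v F (U w, X v) = (\1_A w * (1 + chi * cos (V w)))%:E)%E.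
  have iC : P.-integrable [set: T] (EFin \o (fun v => cos (V w) * cos (c * Z k v))).
    by apply: integrable_EFinZ => //; exact: integrable_cos.
  have iS : P.-integrable [set: T] (EFin \o (fun v => sin (V w) * sin (c * Z k v))).
    by apply: integrable_EFinZ => //; exact: integrable_sin.
  have iB := integrable_EFinB measurableT iC iS.
  have iD := integrable_EFinD measurableT i1 iB.
  transitivity (\int[P]_v (\1_A w * (1 + (cos (V w) * cos (c * Z k v) -
      sin (V w) * sin (c * Z k v))))%:E)%E.
    by apply: eq_integral => v _; rewrite /F/= cosD.
  rewrite integral_EFin_Rintegral; last exact: integrable_EFinZ.
  congr EFin; rewrite RintegralZl//; congr (_ * _).
  rewrite RintegralD// R1 RintegralB// !RintegralZl//; last 2 first.
  - exact: integrable_sin.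
  - exact: integrable_cos.
  by rewrite (gaussian_sin sigma_gt0 (hZ.1 k)) mulr0 subr0 mulrC.
have mA1 : measurable_fun [set: T] (\1_A : T -> R) by exact: measurable_indic.
have bnd (f : T -> R) : measurable_fun [set: T] f -> (forall w, `|f w| <= 1) ->
    P.-integrable [set: T] (EFin \o (fun w => \1_A w * f w)).
  move=> mf f1; apply: (@bounded_integrable_prob _ _ _ _ _ 1) => //.
    exact: measurable_funM.
  move=> w; rewrite normrM mulr_ile1// indicE.
  by case: (_ \in _); rewrite ?normr1 ?normr0.
have mcos (f : T -> R) : measurable_fun [set: T] f -> measurable_fun [set: T] (cos \o f).
  by move=> mf; apply: measurableT_comp => //; exact: continuous_measurable_fun (@continuous_cos R).
have iV : P.-integrable [set: T] (EFin \o (fun w => \1_A w * cos (V w))).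
  by apply: bnd => [|w]; [exact: mcos|exact: cos_max].
have iVZ : P.-integrable [set: T] (EFin \o (fun w => \1_A w * cos (V w + c * Z k w))).
  by apply: bnd => [|w]; [apply: mcos; exact: measurable_funD|exact: cos_max].
have iA : P.-integrable [set: T] (EFin \o (fun w => \1_A w * (1 : R))).
  by apply: (bnd (cst 1)) => // w; rewrite normr1.
have iVc := integrable_EFinZ chi measurableT iV.
have E1 : (\int[P]_w F (U w, X w) = (\int[P]_w (\1_A w * 1) +
    \int[P]_w (\1_A w * cos (V w + c * Z k w)))%:E)%E.
  rewrite -RintegralD// -integral_EFin_Rintegral; last exact: integrable_EFinD.
  by apply: eq_integral => w _; rewrite /F/= mulrDr.
have E2 : (\int[P]_w \int[P]_v F (U w, X v) = (\int[P]_w (\1_A w * 1) +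
    \int[P]_w (chi * (\1_A w * cos (V w))))%:E)%E.
  transitivity (\int[P]_w (\1_A w * (1 + chi * cos (V w)))%:E)%E.
    by apply: eq_integral => w _; exact: inner.
  rewrite -RintegralD// -integral_EFin_Rintegral; last exact: integrable_EFinD.
  by apply: eq_integral => w _; congr EFin; ring.
have E := addrI _ (EFin_inj (etrans (esym E1) (etrans (independent_fubini UX mF F0) E2))).
by rewrite Rintegral_indic E RintegralZl// [in RHS](Rintegral_indic A).
Qed.

End gaussian_walk.

Lemma measurable_norm_gt {R : realType} (r : R) :
  measurable [set x : R | r < `|x|].
Proof.
rewrite (_ : [set x | _] = [set x | `|x| \in `]r, +oo[]); last first.
  by apply/seteqP; split => x /=; rewrite in_itv/= andbT.
rewrite -[X in measurable X]setTI.
by have := @normr_measurable R setT measurableT _ (measurable_itv `]r, +oo[).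
Qed.

(** * Steps of a planar walk in a fixed direction *)

Section planar_walk.
Context {d : measure_display} {T : measurableType d} {R : realType}.
Variable P : probability T R.
Variables (Z : nat -> T -> R) (sigma : R).
Hypotheses (sigma_gt0 : 0 < sigma) (hZ : gaussian_noise P Z sigma).
Variables a b : R.
Hypothesis ab1 : a ^+ 2 + b ^+ 2 = 1.

Local Notation Pr A := (fine (P A)).
Local Notation past := (past Z).

Let mZ j : measurable_fun [set: T] (Z j).
Proof. by case: hZ => gZ _; case: (gZ j). Qed.

(** The even and the odd entries of the noise are the two coordinates of the
    planar walk; this is its step [m] in the direction [(a, b)]. *)
Definition noise_increment (m : nat) (w : T) : R := a * Z m.*2 w + b * Z m.*2.+1 w.

Lemma noise_increment_measurable m :
  measurable_fun [set: past m.+1.*2] (noise_increment m).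
Proof.
by apply: measurable_funD; apply: measurable_funM => //;
  apply: noise_past_measurable; rewrite ?doubleS.
Qed.

Let a_le1 : `|a| <= 1.
Proof.
rewrite -(@expr_le1 _ 2)// real_normK ?num_real//.
by rewrite -ab1 lerDl sqr_ge0.
Qed.

Let b_le1 : `|b| <= 1.
Proof.
rewrite -(@expr_le1 _ 2)// real_normK ?num_real//.
by rewrite -ab1 lerDr sqr_ge0.
Qed.

Let mA_T k (A : set T) : @measurable _ (past k) A -> measurable A.
Proof. exact: (past_measurable mZ). Qed.

Let mf_T k (f : T -> R) : measurable_fun [set: past k] f -> measurable_fun [set: T] f.
Proof. exact: (past_fun_measurable hZ). Qed.

(** One of the two coordinates exceeds [r / 2], hence the factor
    [2 * 2 * 2^3 = 32]. *)
Lemma noise_increment_tail m (A : set T) (r : R) : 0 < r ->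
  @measurable _ (past m.*2) A ->
  Pr (A `&` [set w | r < `|noise_increment m w|]) <= 32 * sigma ^+ 3 / r ^+ 3 * Pr A.
Proof.
move=> r0 mA; have r20 : 0 < r / 2 by rewrite divr_gt0.
have mAT := mA_T mA.
pose E j := [set w | r / 2 < `|Z j w|].
have mC := measurable_norm_gt (r / 2).
have mE j : measurable (E j).
  by rewrite -[E j]setTI; have := @mZ j measurableT _ mC.
have Etail j : (m.*2 <= j)%N -> Pr (A `&` E j) <= 16 * sigma ^+ 3 / r ^+ 3 * Pr A.
  move=> mj; have mAj : @measurable _ (past j) A := past_subset mj mA.
  have -> : P (A `&` E j) = (P A * P (E j))%E by exact: (past_indep mZ hZ.2 mAj mC).
  rewrite fineM ?fin_num_measure// mulrC ler_wpM2r ?fine_ge0//.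
  apply: le_trans (gaussian_tail sigma_gt0 (hZ.1 j) r20) _.
  by rewrite le_eqVlt; apply/orP; left; apply/eqP; field; rewrite gt_eqF.
have mI : measurable [set w | r < `|noise_increment m w|].
  rewrite -[X in measurable X]setTI.
  have mNI : measurable_fun [set: T] (noise_increment m).
    exact: mf_T (@noise_increment_measurable m).
  by have := mNI measurableT _ (measurable_norm_gt r).
apply: (@le_trans _ _ (Pr (A `&` E m.*2) + Pr (A `&` E m.*2.+1))); last first.
  have := Etail m.*2 (leqnn _); have := Etail m.*2.+1 (leqnSn _); lra.
have mAE j : measurable (A `&` E j) by exact: measurableI.
rewrite -fineD ?fin_num_measure// fine_le ?fin_numD ?fin_num_measure//.
  exact: measurableI.
apply: (@le_trans _ _ (P ((A `&` E m.*2) `|` (A `&` E m.*2.+1)))).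
  apply: le_measure; rewrite ?inE; [exact: measurableI|exact: measurableU|].
  move=> w [Aw /= rw].
  have [h1|h1] := ltP (r / 2) `|Z m.*2 w|; first by left.
  have [h2|h2] := ltP (r / 2) `|Z m.*2.+1 w|; first by right.
  move: rw; rewrite ltNge; suff -> : `|noise_increment m w| <= r by [].
  rewrite /noise_increment (le_trans (ler_normD _ _))// !normrM.
  have h3 : `|a| * `|Z m.*2 w| <= 1 * (r / 2) by rewrite ler_pM.
  have h4 : `|b| * `|Z m.*2.+1 w| <= 1 * (r / 2) by rewrite ler_pM.
  lra.
exact: measureU2.
Qed.

(** The eigenvalue of one planar step for the test function
    [cos (kappa * x)]; it does not involve the direction to second order. *)
Definition cos_contraction (kappa : R) (m : nat) : R :=
  (\int[P]_w cos (kappa * a * Z m.*2 w)) * (\int[P]_w cos (kappa * b * Z m.*2.+1 w)).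

Lemma cos_noise_increment kappa m (A : set T) (V : T -> R) :
  @measurable _ (past m.*2) A -> measurable_fun [set: past m.*2] V ->
  \int[P]_(w in A) cos (kappa * (V w + noise_increment m w)) =
  cos_contraction kappa m * \int[P]_(w in A) cos (kappa * V w).
Proof.
move=> mA mV; rewrite /cos_contraction.
have mV' : measurable_fun [set: past m.*2] (fun w => kappa * V w) by exact: measurable_funM.
rewrite mulrAC -(cos_step sigma_gt0 hZ _ mA mV').
have mV'' : measurable_fun [set: past m.*2.+1] (fun w => kappa * V w + kappa * a * Z m.*2 w).
  apply: measurable_funD; first exact: (past_fun_subset (leqnSn _) mV').
  by apply: measurable_funM => //; apply: noise_past_measurable.
have mA' : @measurable _ (past m.*2.+1) A := past_subset (leqnSn _) mA.
rewrite mulrC -(cos_step sigma_gt0 hZ _ mA' mV'').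
by apply: eq_Rintegral => w _; congr cos; rewrite /noise_increment; ring.
Qed.

Lemma cos_contraction_ge kappa m : kappa ^+ 2 * sigma ^+ 2 <= 2 ->
  1 - kappa ^+ 2 * sigma ^+ 2 / 2 <= cos_contraction kappa m.
Proof.
move=> ks; rewrite /cos_contraction.
have := gaussian_cos_ge sigma_gt0 (hZ.1 m.*2) (kappa * a).
have := gaussian_cos_ge sigma_gt0 (hZ.1 m.*2.+1) (kappa * b).
set ca := (X in _ <= X); set cb := (X in _ -> _ <= X -> _).
rewrite !exprMn; set s := kappa ^+ 2 * sigma ^+ 2 in ks *.
have -> : kappa ^+ 2 * a ^+ 2 * sigma ^+ 2 = s * a ^+ 2 by rewrite /s; ring.
have -> : kappa ^+ 2 * b ^+ 2 * sigma ^+ 2 = s * b ^+ 2 by rewrite /s; ring.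
have s0 : 0 <= s by rewrite mulr_ge0 ?sqr_ge0.
have := sqr_ge0 a; have := sqr_ge0 b.
move: ab1; set a2 := a ^+ 2; set b2 := b ^+ 2 => ab b20 a20 hb ha.
have b1 : 0 <= 1 - s * b2 / 2 by nra.
have a1 : 0 <= 1 - s * a2 / 2 by nra.
apply: (@le_trans _ _ ((1 - s * a2 / 2) * (1 - s * b2 / 2))).
  have : 0 <= (s * a2) * (s * b2) by apply: mulr_ge0; apply: mulr_ge0.
  have : s * (a2 + b2) = s by rewrite ab mulr1.
  lra.
by rewrite ler_pM.
Qed.

Lemma cos_contraction_le kappa m : 0 <= kappa ->
  cos_contraction kappa m <= 1 - kappa ^+ 2 * sigma ^+ 2 / 2
    + 4 * kappa ^+ 3 * sigma ^+ 3 + kappa ^+ 4 * sigma ^+ 4 / 4.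
Proof.
move=> k0; rewrite /cos_contraction.
have := gaussian_cos_ge sigma_gt0 (hZ.1 m.*2) (kappa * a).
have := gaussian_cos_ge sigma_gt0 (hZ.1 m.*2.+1) (kappa * b).
have := gaussian_cos_le sigma_gt0 (hZ.1 m.*2) (kappa * a).
have := gaussian_cos_le sigma_gt0 (hZ.1 m.*2.+1) (kappa * b).
have cos_le1' j c : \int[P]_w cos (c * Z j w) <= 1.
  have <- : \int[P]_w 1 = 1 :> R.
    by rewrite /Rintegral integral_cst// mul1e; exact: (congr1 fine (probability_setT P)).
  apply: le_Rintegral => //.
  - by apply: integrable_cos => //; exact: measurable_funM.
  - by apply: (@bounded_integrable_prob _ _ _ _ _ 1) => // x; rewrite normr1.
have := cos_le1' m.*2 (kappa * a); have := cos_le1' m.*2.+1 (kappa * b).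
set ca := \int[P]_w cos (kappa * a * _); set cb := \int[P]_w cos (kappa * b * _).
rewrite !normrM !exprMn (ger0_norm k0).
have -> : kappa ^+ 2 * a ^+ 2 * sigma ^+ 2 = kappa ^+ 2 * sigma ^+ 2 * a ^+ 2 by ring.
have -> : kappa ^+ 2 * b ^+ 2 * sigma ^+ 2 = kappa ^+ 2 * sigma ^+ 2 * b ^+ 2 by ring.
have -> : kappa ^+ 4 * sigma ^+ 4 / 4 = (kappa ^+ 2 * sigma ^+ 2) ^+ 2 / 4 by field.
have -> : 2 * (kappa ^+ 3 * `|a| ^+ 3) * sigma ^+ 3 = 2 * (kappa ^+ 3 * sigma ^+ 3) * `|a| ^+ 3 by ring.
have -> : 2 * (kappa ^+ 3 * `|b| ^+ 3) * sigma ^+ 3 = 2 * (kappa ^+ 3 * sigma ^+ 3) * `|b| ^+ 3 by ring.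
have -> : 4 * kappa ^+ 3 * sigma ^+ 3 = 4 * (kappa ^+ 3 * sigma ^+ 3) by ring.
have s0 : 0 <= kappa ^+ 2 * sigma ^+ 2 by rewrite mulr_ge0 ?sqr_ge0.
have t0 : 0 <= kappa ^+ 3 * sigma ^+ 3 by rewrite mulr_ge0 ?exprn_ge0// ltW.
have a3 : `|a| ^+ 3 <= 1 by rewrite exprn_ile1.
have b3 : `|b| ^+ 3 <= 1 by rewrite exprn_ile1.
move: ab1 (sqr_ge0 a) (sqr_ge0 b) s0 t0 a3 b3.
set s := kappa ^+ 2 * sigma ^+ 2; set t := kappa ^+ 3 * sigma ^+ 3.
set a2 := a ^+ 2; set b2 := b ^+ 2; set a3 := `|a| ^+ 3; set b3 := `|b| ^+ 3.
move=> ab a20 b20 s0 t0 a31 b31 cb1 ca1 cb_le ca_le cb_ge ca_ge.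
have ta : t * a3 <= t by rewrite ler_piMr.
have tb : t * b3 <= t by rewrite ler_piMr.
have sa : s * a2 <= s by rewrite ler_piMr//; lra.
have sb : s * b2 <= s by rewrite ler_piMr//; lra.
have : (1 - ca) * (1 - cb) <= (s / 2) * (s / 2) by rewrite ler_pM//; lra.
have : s * (a2 + b2) = s by rewrite ab mulr1.
lra.
Qed.

End planar_walk.

(** * Probability that a walk stays in an interval *)

Section integral_bounds.
Context {d : measure_display} {T : measurableType d} {R : realType}.
Variable P : probability T R.
Local Notation Pr A := (fine (P A)).

Lemma Rintegral_ge_cst (A : set T) (f : T -> R) (g : R) : measurable A ->
  P.-integrable A (EFin \o f) -> (forall w, A w -> g <= f w) ->
  g * Pr A <= \int[P]_(w in A) f w.
Proof.
move=> mA f_int gf; rewrite -(@Rintegral_cst _ _ _ P A mA g).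
apply: le_Rintegral => //.
by apply: (@bounded_integrable_prob _ _ _ _ _ `|g|).
Qed.

Lemma Rintegral_le_cst (A : set T) (f : T -> R) (g : R) : measurable A ->
  P.-integrable A (EFin \o f) -> (forall w, A w -> f w <= g) ->
  \int[P]_(w in A) f w <= g * Pr A.
Proof.
move=> mA f_int gf; rewrite -(@Rintegral_cst _ _ _ P A mA g).
apply: le_Rintegral => //.
by apply: (@bounded_integrable_prob _ _ _ _ _ `|g|).
Qed.

Lemma Rintegral_ge_exception (D E : set T) (f : T -> R) :
  measurable D -> measurable E -> P.-integrable D (EFin \o f) ->
  (forall w, -1 <= f w) -> (forall w, D w -> ~ E w -> 0 <= f w) ->
  - Pr (D `&` E) <= \int[P]_(w in D) f w.
Proof.
move=> mD mE f_int f_geN1 f_ge0.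
have mDE : measurable (D `&` E) by exact: measurableI.
have mDNE : measurable (D `\` E) by exact: measurableD.
have -> : \int[P]_(w in D) f w = \int[P]_(w in D `&` E) f w + \int[P]_(w in D `\` E) f w.
  rewrite -Rintegral_setU ?setUIDK//.
  by apply/disj_setPS => w [[_ Bw] [_ /(_ Bw)]].
have := @Rintegral_ge_cst _ f (-1) mDE _ (fun w _ => f_geN1 w).
have := @Rintegral_ge_cst _ f 0 mDNE _ (fun w h => f_ge0 w h.1 h.2).
move=> h1 h2; have {}h1 := h1 (integrableS mD mDNE (@subDsetl _ _ _) f_int).
have {}h2 := h2 (integrableS mD mDE (@subIsetl _ _ _) f_int).
lra.
Qed.

Lemma Pr_le (A B : set T) : measurable A -> measurable B -> A `<=` B -> Pr A <= Pr B.
Proof.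
by move=> mA mB AB; rewrite fine_le ?fin_num_measure// le_measure ?inE.
Qed.

End integral_bounds.

Section confinement.
Context {d : measure_display} {T : measurableType d} {R : realType}.
Variable P : probability T R.
Variables (Z : nat -> T -> R) (sigma : R).
Hypotheses (sigma_gt0 : 0 < sigma) (hZ : gaussian_noise P Z sigma).
Variables a b : R.
Hypothesis ab1 : a ^+ 2 + b ^+ 2 = 1.

Local Notation Pr A := (fine (P A)).
Local Notation past := (past Z).
Local Notation zeta := (noise_increment Z a b).

Let mZ j : measurable_fun [set: T] (Z j).
Proof. by case: hZ => gZ _; case: (gZ j). Qed.

Let mA_T k (A : set T) : @measurable _ (past k) A -> measurable A.
Proof. exact: (past_measurable mZ). Qed.

Let mf_T k (f : T -> R) : measurable_fun [set: past k] f -> measurable_fun [set: T] f.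
Proof. exact: (past_fun_measurable hZ). Qed.

Lemma measurable_le_norm k (f : T -> R) (h : R) :
  measurable_fun [set: past k] f -> @measurable _ (past k) [set w | `|f w| <= h].
Proof.
move=> mf; rewrite (_ : [set w | _] = f @^-1` (~` [set x | h < `|x|])); last first.
  by apply/seteqP; split => w /=; rewrite leNgt => /negP.
rewrite -[X in measurable X]setTI.
by have := mf measurableT _ (measurableC (measurable_norm_gt h)).
Qed.

(** The part of the integral lost by restricting to the paths that remain in
    [[-h, h]] is nonnegative up to the paths that jump by more than [r], since
    the cosine is nonnegative on [[-h - r, h + r]].  As the cosine is at least
    [g] on [[-h, h]], the probability of such jumps is absorbed in the factor. *)
Lemma confined_cos_le kappa m (A : set T) (V : T -> R) (h r g : R) :
  0 < r -> 0 < g ->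
  @measurable _ (past m.*2) A -> measurable_fun [set: past m.*2] V ->
  (forall w, A w -> `|V w| <= h) ->
  (forall x, `|x| <= h -> g <= cos (kappa * x)) ->
  (forall x, `|x| <= h + r -> 0 <= cos (kappa * x)) ->
  \int[P]_(w in A `&` [set w | `|V w + zeta m w| <= h]) cos (kappa * (V w + zeta m w)) <=
  (cos_contraction P Z a b kappa m + 32 * sigma ^+ 3 / r ^+ 3 / g) *
  \int[P]_(w in A) cos (kappa * V w).
Proof.
move=> r0 g0 mA mV AV cos_ge_g cos_ge0.
have mA' : @measurable _ (past m.+1.*2) A by apply: past_subset mA; rewrite doubleS !leqW.
have mV' : measurable_fun [set: past m.+1.*2] V.
  by apply: past_fun_subset mV; rewrite doubleS !leqW.
have mVz : measurable_fun [set: past m.+1.*2] (fun w => V w + zeta m w).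
  by apply: measurable_funD => //; exact: noise_increment_measurable.
set B := [set w | `|V w + zeta m w| <= h].
have mB : measurable B by exact: mA_T (measurable_le_norm h mVz).
have mAT := mA_T mA.
have mVzT := mf_T mVz; have mVT := mf_T mV.
have mE : measurable [set w | r < `|zeta m w|].
  have mzT : measurable_fun [set: T] (zeta m) by exact: mf_T (@noise_increment_measurable _ _ _ _ _ _ _).
  rewrite -[X in measurable X]setTI.
  by have := mzT measurableT _ (measurable_norm_gt r).
have icos (D : set T) : measurable D ->
    P.-integrable D (EFin \o (fun w => cos (kappa * (V w + zeta m w)))).
  by move=> mD; apply: integrable_cos => //; exact: measurable_funM.
have icosV (D : set T) : measurable D ->
    P.-integrable D (EFin \o (fun w => cos (kappa * V w))).
  by move=> mD; apply: integrable_cos => //; exact: measurable_funM.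
have mAB : measurable (A `&` B) by exact: measurableI.
have mAD : measurable (A `\` B) by exact: measurableD.
have split_A : \int[P]_(w in A) cos (kappa * (V w + zeta m w)) =
    \int[P]_(w in A `&` B) cos (kappa * (V w + zeta m w)) +
    \int[P]_(w in A `\` B) cos (kappa * (V w + zeta m w)).
  rewrite -Rintegral_setU//.
  - by rewrite setUIDK.
  - by rewrite setUIDK; exact: icos.
  - by apply/disj_setPS => w [[_ Bw] [_ /(_ Bw)]].
have outside : - Pr (A `&` [set w | r < `|zeta m w|]) <=
    \int[P]_(w in A `\` B) cos (kappa * (V w + zeta m w)).
  apply: le_trans (Rintegral_ge_exception mAD mE (icos _ mAD) _ _).
  - rewrite lerN2; apply: Pr_le; [exact: measurableI|exact: measurableI|].
    by move=> w [[]].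
  - by move=> w; exact: cos_geN1.
  - move=> w [Aw _] /negP; rewrite -leNgt => zr; apply: cos_ge0.
    by rewrite (le_trans (ler_normD _ _))// lerD// AV.
have := noise_increment_tail sigma_gt0 hZ ab1 r0 mA.
have cosA : g * Pr A <= \int[P]_(w in A) cos (kappa * V w).
  by apply: Rintegral_ge_cst => // [|w /AV]; [exact: icosV|exact: cos_ge_g].
rewrite (cos_noise_increment sigma_gt0 hZ)// in split_A.
rewrite mulrDl.
have e0 : 0 <= 32 * sigma ^+ 3 / r ^+ 3 by rewrite divr_ge0 ?mulr_ge0 ?exprn_ge0 ?ltW.
have : 32 * sigma ^+ 3 / r ^+ 3 * Pr A <=
    32 * sigma ^+ 3 / r ^+ 3 / g * \int[P]_(w in A) cos (kappa * V w).
  by rewrite -[leRHS]mulrA ler_wpM2l// ler_pdivlMl.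
move: split_A outside; lra.
Qed.

(** Here the cosine vanishes at [h], so the part lost is nonpositive up to the
    jumps larger than [r]. *)
Lemma confined_cos_ge kappa m (A : set T) (V : T -> R) (h r : R) :
  0 < r ->
  @measurable _ (past m.*2) A -> measurable_fun [set: past m.*2] V ->
  (forall w, A w -> `|V w| <= h) ->
  (forall x, h < `|x| -> `|x| <= h + r -> cos (kappa * x) <= 0) ->
  cos_contraction P Z a b kappa m * \int[P]_(w in A) cos (kappa * V w) -
    32 * sigma ^+ 3 / r ^+ 3 * Pr A <=
  \int[P]_(w in A `&` [set w | `|V w + zeta m w| <= h]) cos (kappa * (V w + zeta m w)).
Proof.
move=> r0 mA mV AV cos_le0.
have mV' : measurable_fun [set: past m.+1.*2] V.
  by apply: past_fun_subset mV; rewrite doubleS !leqW.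
have mVz : measurable_fun [set: past m.+1.*2] (fun w => V w + zeta m w).
  by apply: measurable_funD => //; exact: noise_increment_measurable.
set B := [set w | `|V w + zeta m w| <= h].
have mB : measurable B by exact: mA_T (measurable_le_norm h mVz).
have mAT := mA_T mA.
have mVzT := mf_T mVz.
have mE : measurable [set w | r < `|zeta m w|].
  have mzT : measurable_fun [set: T] (zeta m) by exact: mf_T (@noise_increment_measurable _ _ _ _ _ _ _).
  rewrite -[X in measurable X]setTI.
  by have := mzT measurableT _ (measurable_norm_gt r).
have icos (D : set T) : measurable D ->
    P.-integrable D (EFin \o (fun w => cos (kappa * (V w + zeta m w)))).
  by move=> mD; apply: integrable_cos => //; exact: measurable_funM.
have mAB : measurable (A `&` B) by exact: measurableI.
have mAD : measurable (A `\` B) by exact: measurableD.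
have split_A : \int[P]_(w in A) cos (kappa * (V w + zeta m w)) =
    \int[P]_(w in A `&` B) cos (kappa * (V w + zeta m w)) +
    \int[P]_(w in A `\` B) cos (kappa * (V w + zeta m w)).
  rewrite -Rintegral_setU//.
  - by rewrite setUIDK.
  - by rewrite setUIDK; exact: icos.
  - by apply/disj_setPS => w [[_ Bw] [_ /(_ Bw)]].
have icosN (D : set T) : measurable D ->
    P.-integrable D (EFin \o (fun w => -1 * cos (kappa * (V w + zeta m w)))).
  by move=> mD; apply: integrable_EFinZ => //; exact: icos.
have outside : - Pr (A `&` [set w | r < `|zeta m w|]) <=
    - \int[P]_(w in A `\` B) cos (kappa * (V w + zeta m w)).
  rewrite -[leRHS]mulN1r -RintegralZl//; last exact: icos.
  apply: le_trans (Rintegral_ge_exception mAD mE (icosN _ mAD) _ _).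
  - rewrite lerN2; apply: Pr_le; [exact: measurableI|exact: measurableI|].
    by move=> w [[]].
  - by move=> w; rewrite mulN1r lerN2 cos_le1.
  - move=> w [Aw /negP]; rewrite -ltNge => hV /negP; rewrite -leNgt => zr.
    suff : cos (kappa * (V w + zeta m w)) <= 0 by lra.
    apply: cos_le0 => //.
    by rewrite (le_trans (ler_normD _ _))// lerD// AV.
have := noise_increment_tail sigma_gt0 hZ ab1 r0 mA.
rewrite (cos_noise_increment sigma_gt0 hZ)// in split_A.
move: split_A outside; lra.
Qed.

Definition displacement (k n : nat) (w : T) : R := \sum_(i < n) zeta (k + i) w.

Lemma displacementS k n w : displacement k n.+1 w = displacement k n w + zeta (k + n) w.
Proof. by rewrite /displacement big_ord_recr. Qed.

Lemma displacement_measurable k n : measurable_fun [set: past (k + n).*2] (displacement k n).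
Proof.
elim: n => [|n IH].
  rewrite (_ : displacement k 0 = cst 0); first exact: measurable_cst.
  by apply/funext => w; rewrite /displacement big_ord0.
rewrite (_ : displacement k n.+1 = (fun w => displacement k n w + zeta (k + n) w)); last first.
  by apply/funext => w; exact: displacementS.
apply: measurable_funD; last by rewrite addnS; exact: noise_increment_measurable.
by apply: past_fun_subset IH; rewrite leq_double addnS.
Qed.

Fixpoint confined (A : set T) (k : nat) (u h : R) (n : nat) : set T :=
  if n is n'.+1 then
    confined A k u h n' `&` [set w | `|displacement k n'.+1 w - u| <= h]
  else A.

Lemma confined_measurable (A : set T) (k : nat) (u h : R) (n : nat) : @measurable _ (past k.*2) A ->
  @measurable _ (past (k + n).*2) (confined A k u h n).
Proof.
move=> mA; elim: n => [|n IH]; first by rewrite addn0.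
apply: measurableI.
  by apply: past_subset IH; rewrite leq_double addnS.
apply: measurable_le_norm; apply: measurable_funB; last exact: measurable_cst.
exact: displacement_measurable.
Qed.

Lemma confined_bound (A : set T) (k : nat) (u h : R) (n : nat) (w : T) : `|u| <= h -> confined A k u h n w ->
  `|displacement k n w - u| <= h.
Proof.
case: n => [uh _|n uh [_ //]].
by rewrite /displacement big_ord0 sub0r normrN.
Qed.

Let mdisp k n (u : R) : measurable_fun [set: past (k + n).*2] (fun w => displacement k n w - u).
Proof.
apply: measurable_funB; last exact: measurable_cst.
exact: displacement_measurable.
Qed.

Let confinedSE (A : set T) (k : nat) (u h : R) (n : nat) : confined A k u h n.+1 =
  confined A k u h n `&` [set w | `|(displacement k n w - u) + zeta (k + n) w| <= h].
Proof. by apply/seteqP; split => w /=; rewrite displacementS addrAC. Qed.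

(** The test function is at least [g] and at most 1 on the interval, so the
    factor gained at each step bounds the probability itself.  The event [A]
    of the past makes the bound a conditional one. *)
Lemma confined_prob_le kappa (A : set T) k (u h r g th : R) n :
  0 < r -> 0 < g -> 0 <= th -> `|u| <= h ->
  @measurable _ (past k.*2) A ->
  (forall x, `|x| <= h -> g <= cos (kappa * x)) ->
  (forall x, `|x| <= h + r -> 0 <= cos (kappa * x)) ->
  (forall m, cos_contraction P Z a b kappa m + 32 * sigma ^+ 3 / r ^+ 3 / g <= th) ->
  Pr (confined A k u h n) <= th ^+ n * Pr A / g.
Proof.
move=> r0 g0 th0 uh mA cos_ge_g cos_ge0 th_ge.
have mC i := @confined_measurable A k u h i mA.
have mCT i : measurable (confined A k u h i) := mA_T (mC i).
pose D i := \int[P]_(w in confined A k u h i) cos (kappa * (displacement k i w - u)).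
have icos i : P.-integrable (confined A k u h i)
    (EFin \o (fun w => cos (kappa * (displacement k i w - u)))).
  apply: integrable_cos => //; apply: measurable_funM => //.
  exact: mf_T (@mdisp k i u).
have D_ge i : g * Pr (confined A k u h i) <= D i.
  by apply: Rintegral_ge_cst => // w Cw; apply: cos_ge_g; exact: confined_bound Cw.
have D_ge0 i : 0 <= D i by apply: le_trans (D_ge i); rewrite mulr_ge0 ?fine_ge0 ?(ltW g0).
have DS i : D i.+1 <= th * D i.
  rewrite /D confinedSE.
  have Cb w : confined A k u h i w -> `|displacement k i w - u| <= h by exact: confined_bound.
  have := confined_cos_le r0 g0 (mC i) (@mdisp k i u) Cb cos_ge_g cos_ge0.
  have -> : \int[P]_(w in confined A k u h i `&`
      [set w | `|displacement k i w - u + zeta (k + i) w| <= h])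
      cos (kappa * (displacement k i w - u + zeta (k + i) w)) =
    \int[P]_(w in confined A k u h i `&`
      [set w | `|displacement k i w - u + zeta (k + i) w| <= h])
      cos (kappa * (displacement k i.+1 w - u)).
    by apply: eq_Rintegral => w _; rewrite displacementS addrAC.
  by move=> /le_trans -> //; rewrite ler_wpM2r//; exact: D_ge0.
have Dn : D n <= th ^+ n * D 0%N.
  elim: n => [|n IH]; first by rewrite expr0 mul1r.
  by rewrite (le_trans (DS n))// exprS -mulrA ler_wpM2l.
have D0 : D 0%N <= Pr A.
  rewrite -[leRHS]mul1r; apply: Rintegral_le_cst; [exact: mCT 0%N|exact: icos 0%N|].
  by move=> w _; exact: cos_le1.
rewrite ler_pdivlMr// mulrC (le_trans (D_ge n))// (le_trans Dn)//.
by rewrite ler_wpM2l// exprn_ge0.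
Qed.

(** The companion lower bound, with the cosine whose half period is the
    interval; errors of the individual steps add up. *)
Lemma confined_prob_ge kappa (A : set T) k (h r rho : R) n :
  0 < r -> 0 <= h -> 0 <= rho <= 1 ->
  @measurable _ (past k.*2) A ->
  (forall x, h < `|x| -> `|x| <= h + r -> cos (kappa * x) <= 0) ->
  (forall x, `|x| <= h -> 0 <= cos (kappa * x)) ->
  (forall m, rho <= cos_contraction P Z a b kappa m) ->
  (rho ^+ n - n%:R * (32 * sigma ^+ 3 / r ^+ 3)) * Pr A <= Pr (confined A k 0 h n).
Proof.
move=> r0 h0 /andP[rho0 rho1] mA cos_le0 cos_ge0 rho_le.
have mC i := @confined_measurable A k 0 h i mA.
have mCT i : measurable (confined A k 0 h i) := mA_T (mC i).
set e := 32 * sigma ^+ 3 / r ^+ 3.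
have e0 : 0 <= e by rewrite divr_ge0 ?mulr_ge0 ?exprn_ge0 ?ltW.
pose D i := \int[P]_(w in confined A k 0 h i) cos (kappa * (displacement k i w - 0)).
have icos i : P.-integrable (confined A k 0 h i)
    (EFin \o (fun w => cos (kappa * (displacement k i w - 0)))).
  apply: integrable_cos => //; apply: measurable_funM => //.
  exact: mf_T (@mdisp k i 0).
have Cb i w : confined A k 0 h i w -> `|displacement k i w - 0| <= h.
  by apply: confined_bound; rewrite normr0.
have D_ge0 i : 0 <= D i.
  by apply: Rintegral_ge0 => w Cw; apply: cos_ge0; exact: Cb Cw.
have D_le i : D i <= Pr (confined A k 0 h i).
  rewrite -[leRHS]mul1r; apply: Rintegral_le_cst => // w _; exact: cos_le1.
have C_le i : Pr (confined A k 0 h i) <= Pr A.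
  apply: Pr_le => //; first exact: mCT 0%N.
  by elim: i => //= i IH w [/IH].
have DS i : rho * D i - e * Pr A <= D i.+1.
  rewrite /D confinedSE.
  have := confined_cos_ge r0 (mC i) (@mdisp k i 0) (Cb i) cos_le0.
  have -> : \int[P]_(w in confined A k 0 h i `&`
      [set w | `|displacement k i w - 0 + zeta (k + i) w| <= h])
      cos (kappa * (displacement k i w - 0 + zeta (k + i) w)) =
    \int[P]_(w in confined A k 0 h i `&`
      [set w | `|displacement k i w - 0 + zeta (k + i) w| <= h])
      cos (kappa * (displacement k i.+1 w - 0)).
    by apply: eq_Rintegral => w _; rewrite displacementS addrAC.
  apply: le_trans; rewrite lerB//; last by rewrite ler_wpM2l.
  by rewrite ler_wpM2r//; exact: D_ge0.
have D0 : D 0%N = Pr A.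
  rewrite /D /= (_ : (fun w => _) = cst 1).
    by rewrite Rintegral_cst ?mul1r//; exact: mCT 0%N.
  by apply/funext => w; rewrite /displacement big_ord0 subr0 mulr0 cos0.
apply: le_trans (D_le n).
elim: n => [|n IH]; first by rewrite D0 expr0 mul0r subr0 mul1r.
apply: le_trans (DS n).
have PA0 : 0 <= Pr A by rewrite fine_ge0.
have := ler_wpM2l rho0 IH; rewrite exprS -natr1.
have : rho * (n%:R * e * Pr A) <= n%:R * e * Pr A.
  by rewrite ler_piMl// mulr_ge0// mulr_ge0.
lra.
Qed.

End confinement.

(** * Brownian motion on a grid *)

Section brownian_noise.
Context {d : measure_display} {T : measurableType d} {R : realType}.
Variable P : probability T R.
Variables W1 W2 : R -> T -> R.
Hypothesis hW : planar_brownian_motion P W1 W2.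
Variable s : R.
Hypothesis s_gt0 : 0 < s.

Definition grid_increment (B : R -> T -> R) (i : nat) (w : T) : R :=
  B (i.+1%:R * s) w - B (i%:R * s) w.

(** The increments of the two coordinates over the cells of a grid of mesh
    [s], interleaved so that the sigma-algebra of the first [2 k] terms is the
    past at time [k * s]. *)
Definition brownian_noise (j : nat) : T -> R :=
  if odd j then grid_increment W2 j./2 else grid_increment W1 j./2.

Let grid_ge0 i : 0 <= i%:R * s. Proof. by rewrite mulr_ge0 ?ler0n ?ltW. Qed.

Lemma grid_increment_gaussian (B : R -> T -> R) i : brownian_motion P B ->
  gaussian_variable P (grid_increment B i) (Num.sqrt s).
Proof.
case=> mB _ _ normalB _; split.
  by apply: measurable_funB; exact: mB.
move=> A mA; have lt_grid : i%:R * s < i.+1%:R * s.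
  by rewrite ltr_pM2r// ltr_nat.
have stepE : i.+1%:R * s - i%:R * s = s by rewrite -mulrBl -natrB// subSnn mul1r.
have := normalB _ _ (grid_ge0 i) lt_grid A mA.
by rewrite stepE.
Qed.

Let mgrid (B : R -> T -> R) i : brownian_motion P B ->
  measurable_fun [set: T] (grid_increment B i).
Proof. by move=> /(grid_increment_gaussian i)[]. Qed.

Lemma grid_increment_prod (B : R -> T -> R) n (A : nat -> set R) :
  brownian_motion P B -> (forall i, measurable (A i)) ->
  P (\bigcap_(i in `I_n) grid_increment B i @^-1` A i) =
  (\prod_(i < n) P (grid_increment B i @^-1` A i))%E.
Proof.
move=> [_ _ indB _ _] mA.
have := indB n (fun i => i%:R * s) (grid_ge0 0%N).
have grid_le i : i%:R * s <= i.+1%:R * s by rewrite ler_pM2r// ler_nat.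
move=> /(_ grid_le (fun i : 'I_n => A i) (fun i => mA i)) <-.
congr (P _); apply/seteqP; split => [w Aw [i ilt] _|w Aw i ilt]; first exact: Aw.
by have := Aw (Ordinal ilt) I.
Qed.

Lemma grid_increment_process (B : R -> T -> R) n (A : nat -> set R) :
  (forall i, measurable (A i)) ->
  process_sigma_algebra B (\bigcap_(i in `I_n) grid_increment B i @^-1` A i).
Proof.
move=> mA.
pose G := \bigcup_(t in `[0, +oo[) preimage_set_system [set: T] (B t) measurable.
have mB t : 0 <= t -> measurable_fun [set: g_sigma_algebraType G] (B t).
  move=> t0 _ Y mY; rewrite setTI; apply: sub_gen_smallest.
  exists t; first by rewrite /= in_itv/= t0.
  by exists Y => //; rewrite setTI.
apply: (@bigcap_measurableType _ (g_sigma_algebraType G)) => i _.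
rewrite -[X in measurable X]setTI.
have mI : measurable_fun [set: g_sigma_algebraType G] (grid_increment B i).
  by apply: measurable_funB; exact: mB.
by have := mI measurableT _ (mA i).
Qed.

Let noise_even i : brownian_noise i.*2 = grid_increment W1 i.
Proof. by rewrite /brownian_noise odd_double doubleK. Qed.

Let noise_odd i : brownian_noise i.*2.+1 = grid_increment W2 i.
Proof. by rewrite /brownian_noise /= odd_double/= uphalf_double. Qed.

(* Independence of the two processes separates the coordinates; then the
   independence of increments applies to each of them. *)
Let noise_prod_even n (A : nat -> set R) : (forall j, measurable (A j)) ->
  P (\bigcap_(j in `I_n.*2) brownian_noise j @^-1` A j) =
  (\prod_(j < n.*2) P (brownian_noise j @^-1` A j))%E.
Proof.
move=> mA; case: hW => bm1 bm2 ind12.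
have -> : \bigcap_(j in `I_n.*2) brownian_noise j @^-1` A j =
    (\bigcap_(i in `I_n) grid_increment W1 i @^-1` A i.*2) `&`
    (\bigcap_(i in `I_n) grid_increment W2 i @^-1` A i.*2.+1).
  apply/seteqP; split => [w Aw|w [A1w A2w] j jn].
    split=> i /= ilt.
      by have := Aw i.*2; rewrite /= noise_even ltn_double; exact.
    by have := Aw i.*2.+1; rewrite /= noise_odd ltn_Sdouble; exact.
  rewrite -(odd_double_half j) /= in jn *.
  have hlt : (j./2 < n)%N.
    by rewrite -ltn_double (leq_ltn_trans _ jn)// leq_addl.
  case: (odd j) => /=; rewrite ?add1n ?add0n ?noise_odd ?noise_even.
    exact: A2w.
  exact: A1w.
have m1 i : measurable (A i.*2) by exact: mA.
have m2 i : measurable (A i.*2.+1) by exact: mA.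
rewrite ind12; [|by apply: grid_increment_process|by apply: grid_increment_process].
rewrite (grid_increment_prod n bm1 m1) (grid_increment_prod n bm2 m2).
pose p j := P (brownian_noise j @^-1` A j).
rewrite -(big_mkord predT p).
rewrite -(big_mkord predT (fun i => P (grid_increment W1 i @^-1` A i.*2))).
rewrite -(big_mkord predT (fun i => P (grid_increment W2 i @^-1` A i.*2.+1))).
elim: n => [|n IH]; first by rewrite !big_geq// mule1.
rewrite doubleS !big_nat_recr//= -IH /p noise_even noise_odd.
by rewrite muleACA muleA.
Qed.

Lemma brownian_gaussian_noise : gaussian_noise P brownian_noise (Num.sqrt s).
Proof.
case: (hW) => bm1 bm2 _; split.
  by move=> j; rewrite /brownian_noise; case: ifP => _; exact: grid_increment_gaussian.
move=> n A mA.
pose A' j := if (j < n)%N then A j else setT.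
have mA' j : measurable (A' j) by rewrite /A'; case: ifP.
have -> : \bigcap_(j in `I_n) brownian_noise j @^-1` A j =
    \bigcap_(j in `I_n.*2) brownian_noise j @^-1` A' j.
  apply/seteqP; split => [w Aw j _|w A'w j jn].
    by rewrite /A' /=; case: ifPn => // jn; exact: Aw.
  have := A'w j; rewrite /A' /= jn; apply.
  by rewrite (leq_trans jn)// -addnn leq_addr.
rewrite noise_prod_even// -(big_mkord predT (fun j => P (brownian_noise j @^-1` A' j))).
rewrite (@big_cat_nat _ _ _ n)//=; last by rewrite -addnn leq_addr.
rewrite [X in (_ * X)%E]big1_seq ?mule1.
  rewrite big_mkord; apply: eq_bigr => j _.
  by rewrite /A' ltn_ord.
move=> j /andP[_]; rewrite mem_index_iota => /andP[nj _].
by rewrite /A' ltnNge nj/= preimage_setT probability_setT.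
Qed.

End brownian_noise.

(** * Convex hulls of finite planar sets *)

Section planar_geometry.
Context {R : realType}.
Local Notation point := (R^o * R^o)%type.

Lemma convex_setE (K : set point) (x y : point) (t : R) : convex_set K ->
  0 <= t <= 1 -> K x -> K y ->
  K (t * x.1 + (1 - t) * y.1, t * x.2 + (1 - t) * y.2).
Proof.
move=> cK /andP[t0 t1] Kx Ky.
have := cK x y (Itv01 t0 t1); rewrite !inE => /(_ Kx Ky).
exact: id.
Qed.

Lemma convex_hull_triangle (A : set point) (x1 x2 x3 : point) (l1 l2 l3 : R) :
  A x1 -> A x2 -> A x3 -> 0 <= l1 -> 0 <= l2 -> 0 <= l3 -> l1 + l2 + l3 = 1 ->
  convex_hull A (l1 * x1.1 + l2 * x2.1 + l3 * x3.1, l1 * x1.2 + l2 * x2.2 + l3 * x3.2).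
Proof.
move=> A1 A2 A3 l10 l20 l30 l1E K [cK AK].
have [/eqP l31|l3N1] := eqVneq (1 - l3) 0.
  have -> : l3 = 1 by move: l31 => /eqP; lra.
  have -> : l1 = 0 by move: l31 => /eqP; lra.
  have -> : l2 = 0 by move: l31 => /eqP; lra.
  by rewrite !mul0r !add0r !mul1r -surjective_pairing; exact: AK.
have l3gt0 : 0 < 1 - l3 by rewrite lt_def l3N1; lra.
have t01 : 0 <= l1 / (1 - l3) <= 1.
  by rewrite divr_ge0 ?(ltW l3gt0)//= ler_pdivrMr// mul1r; lra.
have s01 : 0 <= l3 <= 1 by lra.
have := convex_setE cK s01 (AK _ A3) (convex_setE cK t01 (AK _ A1) (AK _ A2)).
move=> /=; congr (K (_, _)).
  have -> : l2 = 1 - l3 - l1 by lra.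
  by field.
have -> : l2 = 1 - l3 - l1 by lra.
by field.
Qed.

(** Planar separation with an explicit triangle: from any vector turn
    counterclockwise by less than a half-turn, as far as possible; some vector
    lies to the left of the last one reached, and it cannot lie to the left of
    the first one.  The weights are the cross products of the three vectors. *)
Lemma zero_in_triangle m (a b : 'I_m.+1 -> R) :
  (forall n1 n2 : R, (n1, n2) != (0, 0) -> exists i, 0 < n1 * a i + n2 * b i) ->
  exists i j k (l1 l2 l3 : R), [/\ 0 <= l1, 0 <= l2, 0 <= l3 & l1 + l2 + l3 = 1] /\
    (l1 * a i + l2 * a j + l3 * a k = 0 /\ l1 * b i + l2 * b j + l3 * b k = 0).
Proof.
move=> out.
pose cr i j := a i * b j - b i * a j.
pose dt i j := a i * a j + b i * b j.
have out_cr i : (a i, b i) != (0, 0) -> exists j, 0 < cr i j.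
  move=> i0; have [|j] := out (- b i) (a i).
    apply: contra i0 => /eqP[/eqP]; rewrite oppr_eq0 => /eqP -> ->; exact: eqxx.
  by move=> j0; exists j; rewrite /cr; lra.
have [i1 i1P] : exists i, 0 < 1 * a i + 0 * b i.
  by apply: out; rewrite xpair_eqE oner_eq0.
have v1N0 : (a i1, b i1) != (0, 0).
  by apply/eqP => -[a0 b0]; move: i1P; rewrite a0 b0; lra.
have [j0 j0P] := out_cr i1 v1N0.
case: (@arg_minP _ _ _ j0 (fun j => 0 < cr i1 j) (fun j => dt i1 j / cr i1 j) j0P).
move=> i2 i2P i2min.
have v2N0 : (a i2, b i2) != (0, 0).
  by apply/eqP => -[a0 b0]; move: i2P; rewrite /cr a0 b0; lra.
have [i3 i3P] := out_cr i2 v2N0.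
have c31 : 0 <= cr i3 i1.
  rewrite leNgt; apply/negP => c13.
  have i3in : 0 < cr i1 i3 by move: c13; rewrite /cr; lra.
  have := i2min i3 i3in; rewrite ler_pdivrMr// mulrAC ler_pdivlMr// => le23.
  have : (a i1 ^+ 2 + b i1 ^+ 2) * cr i2 i3 <= 0.
    have -> : (a i1 ^+ 2 + b i1 ^+ 2) * cr i2 i3 = dt i1 i2 * cr i1 i3 - dt i1 i3 * cr i1 i2.
      by rewrite /dt /cr; ring.
    by rewrite subr_le0.
  have : 0 < (a i1 ^+ 2 + b i1 ^+ 2) * cr i2 i3.
    apply: mulr_gt0 => //; have := sqr_ge0 (b i1).
    have : 0 < a i1 ^+ 2 by apply: exprn_gt0; lra.
    by lra.
  by lra.
pose S := cr i2 i3 + cr i3 i1 + cr i1 i2.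
have S0 : 0 < S by rewrite /S; lra.
exists i1, i2, i3, (cr i2 i3 / S), (cr i3 i1 / S), (cr i1 i2 / S); split.
  split; try by apply: divr_ge0; [lra|exact: ltW].
  by rewrite -!mulrDl divff// gt_eqF.
split.
  have -> : cr i2 i3 / S * a i1 + cr i3 i1 / S * a i2 + cr i1 i2 / S * a i3 =
    (cr i2 i3 * a i1 + cr i3 i1 * a i2 + cr i1 i2 * a i3) / S by field; rewrite gt_eqF.
  have -> : cr i2 i3 * a i1 + cr i3 i1 * a i2 + cr i1 i2 * a i3 = 0 by rewrite /cr; ring.
  by rewrite mul0r.
have -> : cr i2 i3 / S * b i1 + cr i3 i1 / S * b i2 + cr i1 i2 / S * b i3 =
  (cr i2 i3 * b i1 + cr i3 i1 * b i2 + cr i1 i2 * b i3) / S by field; rewrite gt_eqF.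
have -> : cr i2 i3 * b i1 + cr i3 i1 * b i2 + cr i1 i2 * b i3 = 0 by rewrite /cr; ring.
by rewrite mul0r.
Qed.

Lemma finite_hull_mem m (p : 'I_m.+1 -> point) (y : point) :
  (forall n1 n2 : R, (n1, n2) != (0, 0) ->
    exists i, 0 < n1 * ((p i).1 - y.1) + n2 * ((p i).2 - y.2)) ->
  convex_hull (range p) y.
Proof.
move=> /zero_in_triangle[i [j [k [l1 [l2 [l3 [[l10 l20 l30 lE] [aE bE]]]]]]]].
have pin i0 : range p (p i0) by exists i0.
have := convex_hull_triangle (pin i) (pin j) (pin k) l10 l20 l30 lE.
rewrite [y]surjective_pairing; congr (convex_hull _ (_, _)).
  have : y.1 = (l1 + l2 + l3) * y.1 by rewrite lE mul1r.
  by lra.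
have : y.2 = (l1 + l2 + l3) * y.2 by rewrite lE mul1r.
by lra.
Qed.

Lemma cauchy_schwarz_unit (n1 n2 e1 e2 rho : R) : 0 <= rho -> n1 ^+ 2 + n2 ^+ 2 = 1 ->
  e1 ^+ 2 + e2 ^+ 2 <= rho ^+ 2 -> n1 * e1 + n2 * e2 <= rho.
Proof.
move=> rho0 n1E eE; apply: le_trans (ler_norm _) _.
rewrite -(@ler_pXn2r _ 2)// ?nnegrE// real_normK ?num_real//.
apply: le_trans eE; have := sqr_ge0 (n1 * e2 - n2 * e1).
have -> : (n1 * e2 - n2 * e1) ^+ 2 =
  (n1 ^+ 2 + n2 ^+ 2) * (e1 ^+ 2 + e2 ^+ 2) - (n1 * e1 + n2 * e2) ^+ 2 by ring.
by rewrite n1E mul1r subr_ge0.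
Qed.

(** A disk is in the hull as soon as it is nowhere beyond the support
    function of the points. *)
Lemma disk_in_finite_hull m (p : 'I_m.+1 -> point) (c : point) (rho : R) : 0 <= rho ->
  (forall n1 n2 : R, n1 ^+ 2 + n2 ^+ 2 = 1 ->
    exists i, rho < n1 * ((p i).1 - c.1) + n2 * ((p i).2 - c.2)) ->
  euclidean_disk c rho `<=` convex_hull (range p).
Proof.
move=> rho0 out y yc; apply: finite_hull_mem => n1 n2 nN0.
have nn0 : 0 < n1 ^+ 2 + n2 ^+ 2.
  rewrite lt_def addr_ge0 ?sqr_ge0// andbT.
  by rewrite paddr_eq0 ?sqr_ge0// !sqrf_eq0 -xpair_eqE.
pose s := Num.sqrt (n1 ^+ 2 + n2 ^+ 2).
have s0 : 0 < s by rewrite sqrtr_gt0.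
have sE : s ^+ 2 = n1 ^+ 2 + n2 ^+ 2 by rewrite sqr_sqrtr// ltW.
have unit_n : (n1 / s) ^+ 2 + (n2 / s) ^+ 2 = 1.
  by rewrite !expr_div_n -mulrDl -sE divff// gt_eqF// exprn_gt0.
have [i iP] := out _ _ unit_n; exists i.
have := cauchy_schwarz_unit rho0 unit_n yc => ey.
have : 0 < s * (n1 / s * ((p i).1 - y.1) + n2 / s * ((p i).2 - y.2)).
  by apply: mulr_gt0 => //; lra.
have -> : s * (n1 / s * ((p i).1 - y.1) + n2 / s * ((p i).2 - y.2)) =
  n1 * ((p i).1 - y.1) + n2 * ((p i).2 - y.2) by field; rewrite gt_eqF.
by [].
Qed.
End planar_geometry.

(** * Disks and strips *)

Section hull_inradius.
Context {R : realType}.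
Local Notation point := (R^o * R^o)%type.

(** Steinhagen's theorem, with the constant 3 that is optimal in the plane.
    Take a triangle of maximal area among the points, with centroid [g].  If
    the disk of radius [rho] at [g] is not in the hull, then in some unit
    direction all points are at most [rho] beyond [g].  A point of the set has
    barycentric coordinates at most 1 in the triangle, by maximality, which
    puts it at most [2 * rho] behind [g]. *)
Lemma disk_or_strip m (p : 'I_m.+1 -> point) (rho : R) : 0 <= rho ->
  (exists c, euclidean_disk c rho `<=` convex_hull (range p)) \/
  (exists n1 n2 b : R, n1 ^+ 2 + n2 ^+ 2 = 1 /\
    forall i, b <= n1 * (p i).1 + n2 * (p i).2 <= b + 3 * rho).
Proof.
move=> rho0.
pose cr (i j k : 'I_m.+1) := ((p j).1 - (p i).1) * ((p k).2 - (p i).2) -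
  ((p j).2 - (p i).2) * ((p k).1 - (p i).1).
case: (@arg_maxP _ _ _ (ord0, ord0, ord0) predT
  (fun t : 'I_m.+1 * 'I_m.+1 * 'I_m.+1 => cr t.1.1 t.1.2 t.2) isT).
move=> [[i j] k] _ /= cr_max.
have cr_le a b c : cr a b c <= cr i j k by exact: (cr_max (a, b, c) isT).
have [D0|D_le0] := ltP 0 (cr i j k); last first.
  right.
  have cr0 a b c : cr a b c = 0.
    apply: le_anti; rewrite (le_trans (cr_le _ _ _))//=.
    by have := le_trans (cr_le a c b) D_le0; rewrite /cr; lra.
  have [all_eq|/existsNP[a aN]] := pselect (forall a, p a = p ord0).
    exists 1, 0, (p ord0).1; split; first by rewrite expr1n expr0n addr0.
    by move=> a; rewrite all_eq; lra.
  pose e1 := (p a).1 - (p ord0).1; pose e2 := (p a).2 - (p ord0).2.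
  have ee0 : 0 < e1 ^+ 2 + e2 ^+ 2.
    rewrite lt_def addr_ge0 ?sqr_ge0// andbT paddr_eq0 ?sqr_ge0// !sqrf_eq0 !subr_eq0.
    apply/negP => /andP[/eqP x1 /eqP x2]; apply: aN.
    by rewrite [LHS]surjective_pairing x1 x2 -surjective_pairing.
  pose s := Num.sqrt (e1 ^+ 2 + e2 ^+ 2).
  have s0 : 0 < s by rewrite sqrtr_gt0.
  have sE : s ^+ 2 = e1 ^+ 2 + e2 ^+ 2 by rewrite sqr_sqrtr// ltW.
  exists (- e2 / s), (e1 / s), (- e2 / s * (p ord0).1 + e1 / s * (p ord0).2); split.
    by rewrite !expr_div_n sqrrN -mulrDl addrC -sE divff// gt_eqF// exprn_gt0.
  move=> l.
  have -> : - e2 / s * (p l).1 + e1 / s * (p l).2 =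
      - e2 / s * (p ord0).1 + e1 / s * (p ord0).2 + cr ord0 a l / s.
    by rewrite /cr -/e1 -/e2; ring.
  by rewrite cr0 mul0r addr0 lexx/=; lra.
pose g : point := (((p i).1 + (p j).1 + (p k).1) / 3, ((p i).2 + (p j).2 + (p k).2) / 3).
have [far|/existsNP[n1 /existsNP[n2 /not_implyP[n1E /forallNP close]]]] :=
    pselect (forall n1 n2 : R, n1 ^+ 2 + n2 ^+ 2 = 1 ->
      exists l, rho < n1 * ((p l).1 - g.1) + n2 * ((p l).2 - g.2)).
  by left; exists g; exact: disk_in_finite_hull.
right; exists n1, n2, (n1 * g.1 + n2 * g.2 - 2 * rho); split => // l.
have t_le a : n1 * ((p a).1 - g.1) + n2 * ((p a).2 - g.2) <= rho.
  by rewrite leNgt; apply/negP; exact: close.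
apply/andP; split; last by have := t_le l; lra.
(* barycentric coordinates of p l in the triangle are at most 1 *)
pose t a := n1 * ((p a).1 - g.1) + n2 * ((p a).2 - g.2).
have t0 : t i + t j + t k = 0 by rewrite /t /g /=; lra.
have tlE : cr i j k * t l = cr l j k * t i + cr i l k * t j + cr i j l * t k.
  by rewrite /cr /t /g /=; field.
have bary1 : cr l j k + cr i l k + cr i j l = cr i j k by rewrite /cr; ring.
have : cr i j k * (- (2 * rho)) <= cr i j k * t l.
  have u1 : (cr i j k - cr l j k) * t i <= (cr i j k - cr l j k) * rho.
    by rewrite ler_wpM2l ?subr_ge0//; exact: t_le.
  have u2 : (cr i j k - cr i l k) * t j <= (cr i j k - cr i l k) * rho.
    by rewrite ler_wpM2l ?subr_ge0//; exact: t_le.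
  have u3 : (cr i j k - cr i j l) * t k <= (cr i j k - cr i j l) * rho.
    by rewrite ler_wpM2l ?subr_ge0//; exact: t_le.
  have : cr i j k * (t i + t j + t k) = 0 by rewrite t0 mulr0.
  have : (cr l j k + cr i l k + cr i j l) * rho = cr i j k * rho by rewrite bary1.
  by rewrite tlE; lra.
by rewrite ler_pM2l// /t; lra.
Qed.

Lemma convex_hull_sub (A B : set point) : A `<=` B -> convex_hull A `<=` convex_hull B.
Proof. by move=> AB x Ax K [cK BK]; apply: Ax; split => // y /AB /BK. Qed.

(** Gives both an upper bound on the inradius and the boundedness needed to
    bound it from below as a supremum. *)
Lemma disk_in_slab (A : set point) c (rho M : R) : 0 <= rho ->
  (forall y, A y -> `|y.1| <= M) ->
  euclidean_disk c rho `<=` convex_hull A -> rho <= M.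
Proof.
move=> rho0 AM cA.
have slab y : convex_hull A y -> `|y.1| <= M.
  move=> /(_ [set y : point | `|y.1| <= M]); apply; split => //.
  move=> x z l; rewrite !inE/= => xM zM.
  have l0 : 0 <= l%:num by [].
  have l1 : l%:num <= 1 by [].
  have l1' : 0 <= 1 - l%:num by rewrite subr_ge0.
  change (`|l%:num * x.1 + (1 - l%:num) * z.1| <= M).
  rewrite (le_trans (ler_normD _ _))// (normrM _ x.1) (normrM _ z.1).
  rewrite (ger0_norm l0) (ger0_norm l1').
  have := ler_wpM2l l0 xM.
  have := ler_wpM2l l1' zM.
  by lra.
have /slab/= : convex_hull A (c.1 + rho, c.2).
  by apply: cA; rewrite /euclidean_disk/=; rewrite addrAC !subrr add0r expr0n addr0.
have /slab/= : convex_hull A (c.1 - rho, c.2).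
  by apply: cA; rewrite /euclidean_disk/= addrAC !subrr add0r expr0n addr0 sqrrN.
by rewrite !ler_norml; lra.
Qed.

Lemma inradius_gt (A : set point) c (rho M r : R) : 0 <= rho -> r < rho ->
  (forall y, A y -> `|y.1| <= M) ->
  euclidean_disk c rho `<=` convex_hull A -> r < inradius (convex_hull A).
Proof.
move=> rho0 r_lt AM cA; apply: lt_le_trans r_lt _.
apply: ub_le_sup; last by split => //; exists c.
by exists M => x [x0 [e eA]]; exact: disk_in_slab eA.
Qed.

Lemma inradius_le (A : set point) (M : R) : 0 <= M ->
  (forall y, A y -> `|y.1| <= M) -> inradius (convex_hull A) <= M.
Proof.
move=> M0 AM; rewrite /inradius.
set S := [set rho | _]; have [S0|/nonemptyPn ->] := pselect (S !=set0).
  by apply: ge_sup => // x [x0 [e eA]]; exact: disk_in_slab eA.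
by rewrite sup0.
Qed.

(** A perturbation of the triangle (0, 0), (6, 0), (6, 6), whose inradius is
    about 1.76.  The disk is on the inner side of the three edges, and the
    cross products that express this are the barycentric coordinates. *)
Lemma triangle_disk (A : set point) (x1 y1 x2 y2 : R) :
  A (0, 0) -> A (x1, y1) -> A (x2, y2) ->
  11 / 2 <= x1 <= 13 / 2 -> `|y1| <= 1 / 2 -> `|x2 - x1| <= 1 / 2 -> 11 / 2 <= y2 - y1 <= 13 / 2 ->
  euclidean_disk (17 / 4, 7 / 4) (101 / 100) `<=` convex_hull A.
Proof.
move=> A0 A1 A2 /andP[x1l x1u]; rewrite !ler_norml => /andP[y1l y1u] /andP[x2l x2u] /andP[y2l y2u].
move=> [x y]; rewrite /euclidean_disk/= => xy.
have cross_le (v1 v2 s : R) : 0 <= s -> (v1 ^+ 2 + v2 ^+ 2) * (101 / 100) ^+ 2 <= s ^+ 2 ->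
    v2 * (x - 17 / 4) - v1 * (y - 7 / 4) <= s.
  move=> s0 vs; apply: le_trans (ler_norm _) _.
  rewrite -(@ler_pXn2r _ 2)// ?nnegrE// real_normK ?num_real//.
  apply: le_trans vs; have := sqr_ge0 (v1 * (x - 17 / 4) + v2 * (y - 7 / 4)).
  have : (v1 ^+ 2 + v2 ^+ 2) * ((x - 17 / 4) ^+ 2 + (y - 7 / 4) ^+ 2) <=
      (v1 ^+ 2 + v2 ^+ 2) * (101 / 100) ^+ 2 by rewrite ler_wpM2l// addr_ge0 ?sqr_ge0.
  by lra.
pose D := x1 * y2 - y1 * x2.
have D0 : 0 < D by rewrite /D; nra.
pose l3 := x1 * y - y1 * x.
pose l1 := (x2 - x1) * (y - y1) - (y2 - y1) * (x - x1).
pose l2 := y2 * x - x2 * y.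
have l30 : 0 <= l3.
  suff : y1 * (x - 17 / 4) - x1 * (y - 7 / 4) <= x1 * (7 / 4) - y1 * (17 / 4) by rewrite /l3; lra.
  by apply: cross_le; nra.
have l10 : 0 <= l1.
  suff : (y2 - y1) * (x - 17 / 4) - (x2 - x1) * (y - 7 / 4) <= (x2 - x1) * (7 / 4 - y1) - (y2 - y1) * (17 / 4 - x1) by rewrite /l1; lra.
  have s_ge : 5 / 4 * (y2 - y1) - 9 / 8 <= (x2 - x1) * (7 / 4 - y1) - (y2 - y1) * (17 / 4 - x1).
    have : 0 <= (y2 - y1) * (x1 - 11 / 2) by apply: mulr_ge0; lra.
    have : 0 <= (x2 - x1 + 1 / 2) * (7 / 4 - y1) by apply: mulr_ge0; lra.
    lra.
  apply: cross_le; first by apply: le_trans s_ge; lra.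
  apply: (@le_trans _ _ ((5 / 4 * (y2 - y1) - 9 / 8) ^+ 2)); last first.
    by rewrite ler_pXn2r// nnegrE; [lra|apply: le_trans s_ge; lra].
  have : 0 <= (1 / 2 - (x2 - x1)) * (1 / 2 + (x2 - x1)) by apply: mulr_ge0; lra.
  have : 0 <= (y2 - y1 - 11 / 2) ^+ 2 by apply: sqr_ge0.
  lra.
have l20 : 0 <= l2.
  suff : (- y2) * (x - 17 / 4) - (- x2) * (y - 7 / 4) <= y2 * (17 / 4) - x2 * (7 / 4) by rewrite /l2; lra.
  by apply: cross_le; nra.
have lE : l1 / D + l2 / D + l3 / D = 1.
  have -> : l1 / D + l2 / D + l3 / D = (l1 + l2 + l3) / D by field; exact: lt0r_neq0.
  have -> : l1 + l2 + l3 = D by rewrite /l1 /l2 /l3 /D; ring.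
  by rewrite divff// lt0r_neq0.
have := convex_hull_triangle A0 A1 A2 (divr_ge0 l10 (ltW D0)) (divr_ge0 l20 (ltW D0))
  (divr_ge0 l30 (ltW D0)) lE.
congr (convex_hull _ (_, _)); rewrite /= /l1 /l2 /l3 /D; field; exact: lt0r_neq0.
Qed.
End hull_inradius.

(** * A finite net of strips *)

Section strip_net.
Context {R : realType}.

(** Midpoints of the cells of length 1/2000 of the interval of length 4, which
    contains [0, pi]. *)
Definition net_angle (j : nat) : R := (j%:R + 1 / 2) / 2000.
(** A strip of width 301/100 that contains the origin is identified up to 2/25
    by 38 cells; this is the middle of the strip for the middle of the cell. *)
Definition net_center (l : nat) : R := 301 / 200 - (l%:R + 1 / 2) * (2 / 25).

Lemma net_center_le l : (l < 38)%N -> `|net_center l| <= 127 / 80.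
Proof.
rewrite ltnS => l38; have : l%:R <= 37%:R :> R by rewrite ler_nat.
have : 0 <= l%:R :> R by rewrite ler0n.
by rewrite /net_center ler_norml; lra.
Qed.

Lemma norm_le_sqr (z c : R) : 0 <= c -> z ^+ 2 <= c ^+ 2 -> `|z| <= c.
Proof.
by move=> c0 zc; rewrite -(@ler_pXn2r _ 2)// ?nnegrE// real_normK ?num_real.
Qed.

(** Points of the square of half-side 120 are at distance at most [120 sqrt 2]
    from 0, and [120 sqrt 2 / 4000 <= 17/400]. *)
Lemma direction_shift (phi psi x y : R) : `|phi - psi| <= 1 / 4000 -> `|x| <= 120 -> `|y| <= 120 ->
  `|(cos phi * x + sin phi * y) - (cos psi * x + sin psi * y)| <= 17 / 400.
Proof.
move=> close xb yb.
apply: norm_le_sqr; first by lra.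
have sq (z c : R) : `|z| <= c -> z ^+ 2 <= c ^+ 2.
  move=> zc; rewrite -(real_normK (num_real z)) ler_pXn2r// nnegrE//.
  by rewrite (le_trans _ zc).
have := sq _ _ close; have := sq _ _ xb; have := sq _ _ yb => y2 x2 c2.
have := cos_ge_quad (phi - psi); rewrite cosB.
have c1 := cos2Dsin2 phi; have c1' := cos2Dsin2 psi.
set c := cos phi in c1 *; set s := sin phi in c1 *.
set c' := cos psi in c1' *; set s' := sin psi in c1' *.
move=> q.
have D2 : (c - c') ^+ 2 + (s - s') ^+ 2 <= (phi - psi) ^+ 2 by lra.
have cs : (c * x + s * y - (c' * x + s' * y)) ^+ 2 <=
    ((c - c') ^+ 2 + (s - s') ^+ 2) * (x ^+ 2 + y ^+ 2).
  by have := sqr_ge0 ((c - c') * y - (s - s') * x); lra.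
apply: le_trans cs _.
apply: (@le_trans _ _ ((1 / 4000) ^+ 2 * (120 ^+ 2 + 120 ^+ 2))); last by lra.
apply: ler_pM; rewrite ?addr_ge0 ?sqr_ge0//; lra.
Qed.

(** The half-width is [301/200] for the strip, [17/400] for the direction and
    [1/25] for the position: [301/200 + 17/400 + 1/25 = 127/80]. *)
Lemma upper_strip_net m (x y : 'I_m.+1 -> R) (n1 n2 b : R) :
  n1 ^+ 2 + n2 ^+ 2 = 1 -> 0 <= n2 ->
  x ord0 = 0 -> y ord0 = 0 ->
  (forall i, `|x i| <= 120) -> (forall i, `|y i| <= 120) ->
  (forall i, b <= n1 * x i + n2 * y i <= b + 301 / 100) ->
  exists j l, [/\ (j < 8000)%N, (l < 38)%N &
    forall i, `|cos (net_angle j) * x i + sin (net_angle j) * y i - net_center l| <= 127 / 80].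
Proof.
move=> nE n20 x0 y0 xb yb strip.
have n1b : -1 <= n1 <= 1.
  by have := sqr_ge0 n2; nra.
pose phi := acos n1.
have phi0 : 0 <= phi by exact: acos_ge0.
have phi4 : phi < 4 by have := acos_lepi n1b; have := @pihalf_lt2 R; rewrite /phi; lra.
have cphi : cos phi = n1 by exact: acosK.
have sphi : sin phi = n2.
  by rewrite sin_acos// -[1]nE addrAC subrr add0r sqrtr_sqr ger0_norm.
pose j := Num.truncn (phi * 2000).
have /andP[j_le j_gt] : j%:R <= phi * 2000 < j.+1%:R by apply: truncn_itv; lra.
have j8000 : (j < 8000)%N by rewrite -(ltr_nat R); apply: le_lt_trans j_le _; lra.
have b0 : b <= 0 <= b + 301 / 100 by have := strip ord0; rewrite x0 y0; lra.
pose l := Num.truncn (- b * (25 / 2)).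
have /andP[l_le l_gt] : l%:R <= - b * (25 / 2) < l.+1%:R by apply: truncn_itv; lra.
have l38 : (l < 38)%N by rewrite -(ltr_nat R); apply: le_lt_trans l_le _; lra.
exists j, l; split => // i.
have near : `|phi - net_angle j| <= 1 / 4000.
  by rewrite /net_angle ler_norml; rewrite -[j.+1%:R]natr1 in j_gt; lra.
have := direction_shift near (xb i) (yb i); rewrite cphi sphi.
have := strip i; rewrite -[l.+1%:R]natr1 in l_gt; rewrite /net_center !ler_norml.
lra.
Qed.

Lemma strip_net_cover m (x y : 'I_m.+1 -> R) (n1 n2 b : R) :
  n1 ^+ 2 + n2 ^+ 2 = 1 ->
  x ord0 = 0 -> y ord0 = 0 ->
  (forall i, `|x i| <= 120) -> (forall i, `|y i| <= 120) ->
  (forall i, b <= n1 * x i + n2 * y i <= b + 301 / 100) ->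
  exists j l, [/\ (j < 8000)%N, (l < 38)%N &
    forall i, `|cos (net_angle j) * x i + sin (net_angle j) * y i - net_center l| <= 127 / 80].
Proof.
move=> nE x0 y0 xb yb strip; have [n20|n20] := leP 0 n2.
  exact: (upper_strip_net nE n20 x0 y0 xb yb strip).
apply: (@upper_strip_net _ x y (- n1) (- n2) (- b - 301 / 100)) => //.
- by rewrite !sqrrN.
- by lra.
- by move=> i; have := strip i; lra.
Qed.
End strip_net.

(** * Numerical bounds *)

Section numeric_bounds.
Context {R : realType}.

Lemma bernoulli_ge (x : R) n : 0 <= x <= 1 -> 1 - n%:R * x <= (1 - x) ^+ n.
Proof.
move=> /andP[x0 x1]; elim: n => [|n IH]; first by rewrite mul0r subr0 expr0.
rewrite exprS; apply: (@le_trans _ _ ((1 - x) * (1 - n%:R * x))); last first.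
  by rewrite ler_wpM2l// subr_ge0.
have : 0 <= n%:R * x ^+ 2 by rewrite mulr_ge0// sqr_ge0.
rewrite -[n.+1%:R]natr1; lra.
Qed.

(** The quadratic bound at [x / 4], followed by two duplications; [u] and [v]
    bound the cosine of [x / 4] and of [x / 2] from below. *)
Lemma cos_quarter_ge (u v x : R) : 0 <= u -> 0 <= v ->
  x ^+ 2 <= 32 * (1 - u) -> v <= 2 * u ^+ 2 - 1 -> 2 * v ^+ 2 - 1 <= cos x.
Proof.
move=> u0 v0 xu uv; have q := cos_ge_quad (x / 4).
have x4 : x / 4 = (x / 2) / 2 by field.
have qE : (x / 4) ^+ 2 / 2 = x ^+ 2 / 32 by field.
rewrite qE in q.
have dbl (y : R) : cos y = 2 * cos (y / 2) ^+ 2 - 1.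
  by have := cos2Dsin2 (y / 2); rewrite [cos y]cos_half; lra.
have sq_le (a b : R) : 0 <= a -> a <= b -> a ^+ 2 <= b ^+ 2.
  by move=> a0 ab; rewrite ler_pXn2r// nnegrE// (le_trans a0).
have u_le : u ^+ 2 <= cos (x / 4) ^+ 2 by apply: sq_le => //; lra.
have v_le : v <= cos (x / 2) by rewrite dbl -x4; lra.
by have := sq_le _ _ v0 v_le; rewrite [cos x]dbl; lra.
Qed.

(** The cosine that vanishes at [h] and at [- h]. *)
Lemma cos_wave_ge0 (h x : R) : 0 < h -> `|x| <= h -> 0 <= cos (pi / 2 / h * x).
Proof.
move=> h0; rewrite ler_norml => /andP[x1 x2]; apply: cos_ge0_pihalf.
have p0 : 0 < pi / 2 / h :> R by rewrite !divr_gt0 ?pi_gt0.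
have hE : pi / 2 / h * h = pi / 2 :> R by rewrite divfK// gt_eqF.
have := ler_wpM2l (ltW p0) x1; have := ler_wpM2l (ltW p0) x2.
by rewrite mulrN hE => -> ->.
Qed.

Lemma cos_wave_le0 (h x : R) : 0 < h -> h <= `|x| <= 3 * h -> cos (pi / 2 / h * x) <= 0.
Proof.
move=> h0 /andP[x1 x2].
have -> : cos (pi / 2 / h * x) = cos (pi / 2 / h * `|x|).
  by case: (ger0P x) => // _; rewrite mulrN cosN.
have p0 : 0 < pi / 2 / h :> R by rewrite !divr_gt0 ?pi_gt0.
have hE : pi / 2 / h * h = pi / 2 :> R by rewrite divfK// gt_eqF.
rewrite -[X in cos X](subrK pi) cosDpi oppr_le0; apply: cos_ge0_pihalf.
have := ler_wpM2l (ltW p0) x1; have := ler_wpM2l (ltW p0) x2.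
by rewrite mulrCA hE; lra.
Qed.

Lemma expR1_ge : 27 / 10 <= expR 1 :> R.
Proof.
have nd : nondecreasing_seq (series (exp_coeff (1 : R))).
  apply/nondecreasing_seqP => n; rewrite !seriesEnat/= big_nat_recr//= lerDl.
  by rewrite /exp_coeff/= expr1n divr_ge0// ler0n.
have := nondecreasing_cvgn_le nd (is_cvg_series_exp_coeff 1) 5%N.
apply: le_trans; rewrite seriesEnat/= !big_nat_recr//= big_geq// /exp_coeff/= !expr1n.
rewrite !factS fact0 /=.
lra.
Qed.

(** The decay over a block: [43/100 * 45 = 1935/100]. *)
Lemma expR_block_le : expR (- (1935 / 100)) <= 1 / (2 * 10 ^+ 8) :> R.
Proof.
have e35 : 135 / 100 <= expR (35 / 100) :> R.
  by apply: le_trans (expR_ge1Dx _); lra.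
have e19 : (27 / 10) ^+ 19 <= expR 19 :> R.
  have -> : 19 = 19%:R * 1 :> R by rewrite mulr1.
  have p : 0 <= 27 / 10 :> R by lra.
  by rewrite expRM_natl; apply: lerXn2r; rewrite ?nnegrE ?expR_ge0 ?expR1_ge.
have E : 1935 / 100 = 19 + 35 / 100 :> R by lra.
rewrite expRN E expRD mul1r lef_pV2 ?posrE ?mulr_gt0 ?expR_gt0//.
apply: (@le_trans _ _ ((27 / 10) ^+ 19 * (135 / 100))); first by lra.
by apply: ler_pM => //; lra.
Qed.
End numeric_bounds.

(** * One block of the path *)

Section blocks.
Context {d : measure_display} {T : measurableType d} {R : realType}.
Variable P : probability T R.
Local Notation Pr A := (fine (P A)).

Lemma PrU_le (A B : set T) : measurable A -> measurable B ->
  Pr (A `|` B) <= Pr A + Pr B.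
Proof.
move=> mA mB; have U2 : (P (A `|` B) <= P A + P B)%E by exact: measureU2.
rewrite -fineD ?fin_num_measure//; apply: fine_le => //.
- by apply: fin_num_measure; exact: measurableU.
- by rewrite fin_numD !fin_num_measure.
Qed.

Lemma Pr_bigsetU_le (F : nat -> set T) (c : R) n :
  (forall i, measurable (F i)) -> (forall i, (i < n)%N -> Pr (F i) <= c) ->
  Pr (\big[setU/set0]_(i < n) F i) <= n%:R * c.
Proof.
move=> mF; elim: n => [|n IH] Fc; first by rewrite big_ord0 measure0 mul0r.
rewrite big_ord_recr/= -natr1 mulrDl mul1r.
apply: le_trans (PrU_le _ (mF n)) _; first exact: bigsetU_measurable.
by apply: lerD; [apply: IH => i /ltnW; exact: Fc|exact: Fc].
Qed.

Lemma confinedP (Z : nat -> T -> R) (a b : R) (A : set T) (k : nat) (u h : R) (n : nat) (w : T) :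
  confined Z a b A k u h n w <->
  A w /\ forall i, (0 < i <= n)%N -> `|displacement Z a b k i w - u| <= h.
Proof.
elim: n => [|n IH]; first by split => [Aw|[]//]; split => // -[].
split => [[/IH[Aw near] last]|[Aw near]].
  split => // i /andP[i0]; rewrite leq_eqVlt => /orP[/eqP ->//|].
  by rewrite ltnS => i_n; apply: near; rewrite i0.
split; last by apply: near; rewrite leqnn.
by apply/IH; split => // i /andP[i0 i_n]; apply: near; rewrite i0 leqW.
Qed.

Lemma PrD (A B : set T) : measurable A -> measurable B -> B `<=` A ->
  Pr (A `\` B) = Pr A - Pr B.
Proof.
move=> mA mB BA; rewrite measureD// ?ltey_eq ?fin_num_measure//.
rewrite (setIidr BA) fineB ?fin_num_measure//.
Qed.

Variables W1 W2 : R -> T -> R.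
Hypothesis hW : planar_brownian_motion P W1 W2.
Variable s : R.
Hypothesis s_gt0 : 0 < s.
Local Notation Z := (brownian_noise W1 W2 s).
Local Notation past := (past Z).
Local Notation sigma := (Num.sqrt s).

Lemma displacement_brownian a b k n w : displacement Z a b k n w =
  a * (W1 ((k + n)%:R * s) w - W1 (k%:R * s) w) +
  b * (W2 ((k + n)%:R * s) w - W2 (k%:R * s) w).
Proof.
elim: n => [|n IH]; first by rewrite /displacement big_ord0 addn0 !subrr !mulr0 addr0.
rewrite displacementS IH addnS /noise_increment /brownian_noise.
rewrite /= odd_double/= doubleK uphalf_double /grid_increment; ring.
Qed.

Definition strip_trap (A : set T) (k n j l : nat) : set T :=
  confined Z (cos (net_angle j)) (sin (net_angle j)) A k (net_center l) (127 / 80) n.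

Definition direction_trap (A : set T) (k n j : nat) : set T :=
  \big[setU/set0]_(l < 38) strip_trap A k n j l.

(** The part of [A] where the samples [k], ..., [k + n] of the path leave a
    square of half-side 120 around sample [k], or stay in a strip of the net. *)
Definition block_fail (A : set T) (k n : nat) : set T :=
  (A `\` confined Z 1 0 A k 0 120 n) `|` (A `\` confined Z 0 1 A k 0 120 n) `|`
  \big[setU/set0]_(j < 8000) direction_trap A k n j.

Let sigma_gt0 : 0 < sigma. Proof. by rewrite sqrtr_gt0. Qed.
Let hZ : gaussian_noise P Z sigma. Proof. exact: brownian_gaussian_noise. Qed.

Lemma block_fail_sub A k n : block_fail A k n `<=` A.
Proof.
move=> w [[[//]|[//]]|].
rewrite -bigcup_mkord => -[j _]; rewrite /direction_trap -bigcup_mkord => -[l _].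
by move=> /confinedP[].
Qed.

Lemma block_fail_measurable (A : set T) (k n : nat) : @measurable _ (past k.*2) A ->
  @measurable _ (past (k + n).*2) (block_fail A k n).
Proof.
move=> mA.
have mC a b u h : @measurable _ (past (k + n).*2) (confined Z a b A k u h n).
  exact: confined_measurable.
have mA' : @measurable _ (past (k + n).*2) A.
  by apply: past_subset mA; rewrite leq_double leq_addr.
apply: measurableU; first by apply: measurableU; exact: measurableD.
apply: bigsetU_measurable => j _; apply: bigsetU_measurable => l _; exact: mC.
Qed.

(** If no disk of radius 301/300 is in the hull, the samples are in a strip of
    width 301/100, which is caught by the net. *)
Lemma block_success A k n w : A w -> ~ block_fail A k n w ->
  exists c, euclidean_disk c (301 / 300) `<=`
    convex_hull [set ((W1 t w, W2 t w) : R^o * R^o) | t in `[0, (k + n)%:R * s]].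
Proof.
move=> Aw ok.
pose p (i : 'I_n.+1) : R^o * R^o := (W1 ((k + i)%:R * s) w, W2 ((k + i)%:R * s) w).
have psub : range p `<=`
    [set ((W1 t w, W2 t w) : R^o * R^o) | t in `[0, (k + n)%:R * s]].
  move=> _ [i _ <-]; exists ((k + i)%:R * s) => //=.
  rewrite in_itv/= mulr_ge0 ?ler0n ?(ltW s_gt0)//= ler_pM2r// ler_nat leq_add2l.
  by rewrite -ltnS ltn_ord.
have rho0 : 0 <= 301 / 300 :> R by lra.
case: (disk_or_strip p rho0) => [[c cp]|[n1 [n2 [b [nE strip]]]]].
  by exists c; apply: subset_trans cp (convex_hull_sub psub).
exfalso; apply: ok.
pose x (i : 'I_n.+1) := displacement Z 1 0 k i w.
pose y (i : 'I_n.+1) := displacement Z 0 1 k i w.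
have disp0 a b' : displacement Z a b' k 0 w = 0 by rewrite /displacement big_ord0.
have [C1|C1] := pselect (confined Z 1 0 A k 0 120 n w); last by left; left.
have [C2|C2] := pselect (confined Z 0 1 A k 0 120 n w); last by left; right.
right.
have bound a b' (i : 'I_n.+1) : confined Z a b' A k 0 120 n w ->
    `|displacement Z a b' k i w| <= 120.
  move=> /confinedP[_ near]; have [->|i0] := posnP i; first by rewrite disp0 normr0.
  by rewrite -[displacement _ _ _ _ _ _]subr0; apply: near; rewrite i0 -ltnS ltn_ord.
pose b0 := b - (n1 * W1 (k%:R * s) w + n2 * W2 (k%:R * s) w).
have strip0 i : b0 <= n1 * x i + n2 * y i <= b0 + 301 / 100.
  by have := strip i; rewrite /x /y !displacement_brownian /p /b0 /=; lra.
have x0 : x ord0 = 0 by exact: disp0.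
have y0 : y ord0 = 0 by exact: disp0.
have [j [l [j8000 l38 near]]] := strip_net_cover nE x0 y0
  (fun i => bound 1 0 i C1) (fun i => bound 0 1 i C2) strip0.
rewrite -bigcup_mkord; exists j => //; rewrite /direction_trap -bigcup_mkord; exists l => //.
apply/confinedP; split => // i /andP[i0 i_n].
have i_lt : (i < n.+1)%N by rewrite ltnS.
have := near (Ordinal i_lt); rewrite /x /y !displacement_brownian /=.
congr (`|_ - _| <= _); ring.
Qed.

Let mpast k (A : set T) : @measurable _ (past k) A -> @measurable _ T A.
Proof.
apply: past_measurable => j.
by case: hZ => gZ _; case: (gZ j).
Qed.

Let sigmaE : sigma ^+ 2 = s. Proof. by rewrite sqr_sqrtr// ltW. Qed.

Let sigma3E : sigma ^+ 3 = s * sigma. Proof. by rewrite exprSr sigmaE. Qed.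

(** With [kappa = pi / 240 <= 1 / 60] the decay over time 45 is at most
    [45 / 7200 = 625 / 10^5]; the rest accounts for large steps. *)
Lemma wide_exit_prob (a b : R) (A : set T) (k n : nat) : a ^+ 2 + b ^+ 2 = 1 ->
  n%:R * s = 45 -> sigma <= 1 / 1000 -> @measurable _ (past k.*2) A ->
  Pr (A `\` confined Z a b A k 0 120 n) <= 64 / 10 ^+ 4 * Pr A.
Proof.
move=> ab1 ns sigma_small mA.
have mC : @measurable _ T (confined Z a b A k 0 120 n).
  by apply: (@mpast (k + n).*2); exact: confined_measurable.
have mAT : @measurable _ T A := mpast mA.
pose kappa := pi / 2 / 120 :> R.
have kappa0 : 0 < kappa by rewrite !divr_gt0 ?pi_gt0.
have kappa60 : kappa <= 1 / 60 by have := @pihalf_lt2 R; rewrite /kappa; lra.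
have kappa2 : kappa ^+ 2 <= (1 / 60) ^+ 2 by rewrite ler_pXn2r// nnegrE ?ltW//; lra.
have s_small : s <= 1 / 1000.
  have : sigma * sigma <= 1 * (1 / 1000) by have sg := ltW sigma_gt0; apply: ler_pM => //; lra.
  by rewrite -expr2 sigmaE; lra.
pose c : R := (1 / 60) ^+ 2 / 2.
have c01 : 0 <= c <= 1 by rewrite /c; lra.
have sc : 0 <= s * c <= 1.
  case/andP: c01 => c0 c1; rewrite mulr_ge0 ?(ltW s_gt0)//=.
  by apply: le_trans (ler_wpM2l (ltW s_gt0) c1) _; lra.
have rho01 : 0 <= 1 - s * c <= 1 by lra.
have h0 : 0 <= 120 :> R by [].
have cos_le0 (x : R) : 120 < `|x| -> `|x| <= 120 + 60 -> cos (kappa * x) <= 0.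
  by move=> x1 x2; apply: cos_wave_le0 => //; rewrite ltW//=; lra.
have cos_ge0 (x : R) : `|x| <= 120 -> 0 <= cos (kappa * x) by exact: cos_wave_ge0.
have k2s : kappa ^+ 2 * s <= 2 * c * s.
  by rewrite ler_wpM2r ?(ltW s_gt0)// /c; lra.
have k2 : kappa ^+ 2 * sigma ^+ 2 <= 2 by rewrite sigmaE; move: k2s; case/andP: sc; lra.
have rho_le m : 1 - s * c <= cos_contraction P Z a b kappa m.
  apply: le_trans (cos_contraction_ge sigma_gt0 hZ ab1 m k2).
  by rewrite sigmaE; move: k2s; lra.
have r0 : 0 < 60 :> R by [].
have := confined_prob_ge sigma_gt0 hZ ab1 n r0 h0 rho01 mA cos_le0 cos_ge0 rho_le.
have := bernoulli_ge n sc.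
have -> : n%:R * (32 * sigma ^+ 3 / 60 ^+ 3) = (n%:R * s) * (32 * sigma / 60 ^+ 3).
  by rewrite sigma3E; ring.
rewrite mulrA ns => bern CA.
have CsubA : confined Z a b A k 0 120 n `<=` A by move=> w /confinedP[].
rewrite PrD//.
have PA0 : 0 <= Pr A by rewrite fine_ge0.
have rate : 1 - 64 / 10 ^+ 4 <= (1 - s * c) ^+ n - 45 * (32 * sigma / 60 ^+ 3).
  by move: bern; rewrite /c; lra.
have := le_trans (ler_wpM2r PA0 rate) CA.
by rewrite mulrBl mul1r; lra.
Qed.

(** The frequency 47/50 makes the cosine positive slightly beyond the strip,
    [47/50 * (127/80 + 1/20) < pi / 2]; its rate [(47/50)^2 / 2] exceeds 43/100
    by a margin which covers the error terms when the grid is fine. *)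
Lemma strip_trap_prob (A : set T) (k n j l : nat) : (l < 38)%N ->
  n%:R * s = 45 -> sigma <= 10 ^- 9 -> @measurable _ (past k.*2) A ->
  Pr (strip_trap A k n j l) <= 1 / (13 * 10 ^+ 6) * Pr A.
Proof.
move=> l38 ns sigma_small mA; rewrite /strip_trap.
have ab1 := cos2Dsin2 (net_angle j : R).
have r0 : 0 < 1 / 20 :> R by lra.
have g0 : 0 < 69 / 1000 :> R by lra.
have e9 : 10 ^- 9 <= 1 / 1000 :> R by lra.
have s_small : s <= 1 / 1000.
  have : sigma * sigma <= 1 * (1 / 1000) by have sg := ltW sigma_gt0; apply: ler_pM => //; lra.
  by rewrite -expr2 sigmaE; lra.
have th0 : 0 <= 1 - 43 / 100 * s by lra.
have sqr_norm (x c : R) : `|x| <= c -> (47 / 50 * x) ^+ 2 <= (47 / 50 * c) ^+ 2.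
  move=> xc; rewrite !exprMn ler_wpM2l ?sqr_ge0// -(real_normK (num_real x)).
  by rewrite ler_pXn2r// nnegrE// (le_trans _ xc).
have cos_ge_g (x : R) : `|x| <= 127 / 80 -> 69 / 1000 <= cos (47 / 50 * x).
  move=> xb; have x2 := sqr_norm _ _ xb.
  have : 2 * (457 / 625) ^+ 2 - 1 <= cos (47 / 50 * x).
    by apply: (@cos_quarter_ge _ (1163 / 1250)); lra.
  by apply: le_trans; lra.
have cos_ge0 (x : R) : `|x| <= 127 / 80 + 1 / 20 -> 0 <= cos (47 / 50 * x).
  move=> xb; have x2 := sqr_norm _ _ xb.
  have : 2 * (711 / 1000) ^+ 2 - 1 <= cos (47 / 50 * x).
    by apply: (@cos_quarter_ge _ (37 / 40)); lra.
  by apply: le_trans; lra.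
have kappa0 : 0 <= 47 / 50 :> R by lra.
have th_ge m : cos_contraction P Z (cos (net_angle j)) (sin (net_angle j)) (47 / 50) m +
    32 * sigma ^+ 3 / (1 / 20) ^+ 3 / (69 / 1000) <= 1 - 43 / 100 * s.
  have := cos_contraction_le sigma_gt0 hZ ab1 m kappa0.
  have -> : sigma ^+ 4 = s * s by rewrite -[4%N]/(2 + 2)%N exprD sigmaE.
  rewrite sigma3E sigmaE.
  have : s * sigma <= s * 10 ^- 9 by rewrite ler_wpM2l// ltW.
  have : s * s <= s * (1 / 1000) by rewrite ler_wpM2l// ltW.
  by move: s_gt0; lra.
have := confined_prob_le sigma_gt0 hZ ab1 n r0 g0 th0
  (net_center_le l38) mA
  cos_ge_g cos_ge0 th_ge.
move=> /le_trans -> //; rewrite mulrAC ler_wpM2r ?fine_ge0//.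
have : (1 - 43 / 100 * s) ^+ n <= expR (- (1935 / 100)).
  apply: (@le_trans _ _ (expR (- (43 / 100 * s)) ^+ n)).
    by apply: lerXn2r; rewrite ?nnegrE ?expR_ge0// expR_ge1Dx.
  rewrite -expRM_natl ler_expR mulrN mulrCA ns; lra.
move=> /le_trans /(_ (@expR_block_le R)) rate.
rewrite ler_pdivrMr//; apply: le_trans rate _; lra.
Qed.

(** Two coordinates and [8000 * 38] strips:
    [2 * 64 / 10^4 + 304000 / (13 * 10^6) < 1 / 25]. *)
Lemma block_fail_prob (A : set T) (k n : nat) :
  n%:R * s = 45 -> sigma <= 10 ^- 9 -> @measurable _ (past k.*2) A ->
  Pr (block_fail A k n) <= 1 / 25 * Pr A.
Proof.
move=> ns sigma_small mA.
have e9 : 10 ^- 9 <= 1 / 1000 :> R by lra.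
have mC a b u h : @measurable _ T (confined Z a b A k u h n).
  by apply: (@mpast (k + n).*2); exact: confined_measurable.
have mAT : @measurable _ T A := mpast mA.
have ab10 : 1 ^+ 2 + 0 ^+ 2 = 1 :> R by rewrite expr1n expr0n addr0.
have ab01 : 0 ^+ 2 + 1 ^+ 2 = 1 :> R by rewrite expr1n expr0n add0r.
have sigma_small' := le_trans sigma_small e9.
have w1 := wide_exit_prob ab10 ns sigma_small' mA.
have w2 := wide_exit_prob ab01 ns sigma_small' mA.
have w3 : Pr (\big[setU/set0]_(j < 8000) direction_trap A k n j) <=
    8000%:R * (38%:R * (1 / (13 * 10 ^+ 6) * Pr A)).
  apply: Pr_bigsetU_le => [j|j _]; first by apply: bigsetU_measurable => l _; exact: mC.
  apply: Pr_bigsetU_le => [l|l l38]; first exact: mC.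
  exact: strip_trap_prob.
have n8000 : 8000%:R = 8 * 10 ^+ 3 :> R by rewrite -natrX -natrM.
rewrite n8000 in w3.
have mD a b : @measurable _ T (A `\` confined Z a b A k 0 120 n) by exact: measurableD.
have mB : @measurable _ T (\big[setU/set0]_(j < 8000) direction_trap A k n j).
  by apply: bigsetU_measurable => j _; apply: bigsetU_measurable => l _; exact: mC.
have mW := measurableU _ _ (mD 1 0) (mD 0 1).
have u1 := PrU_le (mD 1 0) (mD 0 1).
have u2 := PrU_le mW mB.
have PA0 : 0 <= Pr A by rewrite fine_ge0.
by rewrite /block_fail; lra.
Qed.

End blocks.

(** * Integrals of nonnegative functions that may not be measurable *)

Section lower_integral.
Context {d : measure_display} {T : measurableType d} {R : realType}.
Variable P : probability T R.
Local Open Scope ereal_scope.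

Lemma le_lower_integral (f g : T -> \bar R) : (forall w, 0 <= f w) -> (forall w, f w <= g w) ->
  \int[P]_w f w <= \int[P]_w g w.
Proof.
move=> f0 fg; have g0 w : 0 <= g w by exact: le_trans (fg w).
rewrite !ge0_integralTE//; apply: le_ereal_sup => _ [h hf <-]; exists h => //= w.
exact: le_trans (fg w).
Qed.

Lemma lower_integral_le (f : T -> \bar R) (c : \bar R) : (forall w, 0 <= f w) ->
  (forall h : {nnsfun T >-> R}, (forall w, (h w)%:E <= f w) -> \int[P]_w (h w)%:E <= c) ->
  \int[P]_w f w <= c.
Proof.
move=> f0 hc; rewrite ge0_integralTE//; apply: ge_ereal_sup => _ [h hf <-].
by rewrite -integralT_nnsfun; exact: hc.
Qed.

Lemma ae_eq_of_le_integral (f g : T -> R) :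
  measurable_fun setT f -> measurable_fun setT g ->
  (forall w, (0 <= f w <= g w)%R) -> \int[P]_w (f w)%:E < +oo ->
  \int[P]_w (g w)%:E <= \int[P]_w (f w)%:E ->
  {ae P, forall w, g w = f w}.
Proof.
move=> mf mg fg ifoo igf.
have f0 w : (0 <= f w)%R by case/andP: (fg w).
have le_fg w : (f w <= g w)%R by case/andP: (fg w).
have mgf : measurable_fun setT (g \- f)%R by exact: measurable_funB.
have d0 w : 0 <= ((g \- f)%R w)%:E by rewrite lee_fin subr_ge0.
have split_g : \int[P]_w (g w)%:E = \int[P]_w (f w)%:E + \int[P]_w ((g \- f)%R w)%:E.
  rewrite -ge0_integralD//; last 3 first.
  - by move=> w _; rewrite lee_fin.
  - exact/measurable_EFinP.
  - exact/measurable_EFinP.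
  by apply: eq_integral => w _; rewrite -EFinD/= addrC subrK.
have ifin : \int[P]_w (f w)%:E \is a fin_num.
  by rewrite ge0_fin_numE// integral_ge0// => w _; rewrite lee_fin.
have id0 : \int[P]_w ((g \- f)%R w)%:E = 0.
  apply/eqP; rewrite eq_le integral_ge0// andbT.
  have : \int[P]_w (f w)%:E + \int[P]_w ((g \- f)%R w)%:E <= \int[P]_w (f w)%:E + 0.
    by rewrite -split_g adde0.
  by rewrite leeD2lE.
have abs0 : \int[P]_w `|((g \- f)%R w)%:E| = 0.
  by rewrite -[RHS]id0; apply: eq_integral => w _; rewrite gee0_abs.
have [|+ _] := @ae_eq_integral_abs _ _ _ P setT measurableT (fun w => ((g \- f)%R w)%:E).
  exact/measurable_EFinP.
move=> /(_ abs0); apply: filterS => w /(_ I) [] /eqP.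
by rewrite subr_eq0 => /eqP.
Qed.

(** The supremum of a sequence of simple minorants whose integrals approach
    that of [X].  A measurable minorant that exceeds it on a set of positive
    measure would increase the integral. *)
Lemma lower_envelope (X : T -> R) : (forall w, (0 <= X w)%R) ->
  \int[P]_w (X w)%:E < +oo ->
  exists Y : T -> R, [/\ measurable_fun setT Y, forall w, (0 <= Y w <= X w)%R,
    \int[P]_w (Y w)%:E = \int[P]_w (X w)%:E &
    forall Z : T -> R, measurable_fun setT Z -> {ae P, forall w, (Z w <= X w)%R} ->
      {ae P, forall w, (Z w <= Y w)%R}].
Proof.
move=> X0 iXoo.
have X0e w : 0 <= (X w)%:E by rewrite lee_fin.
have iX0 : 0 <= \int[P]_w (X w)%:E by exact: integral_ge0.
have iXfin : \int[P]_w (X w)%:E \is a fin_num by rewrite ge0_fin_numE.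
have approx (n : nat) : exists h : {nnsfun T >-> R}, (forall w, (h w <= X w)%R) /\
    \int[P]_w (X w)%:E - (n.+1%:R^-1)%:E < \int[P]_w (h w)%:E.
  have e0 : (0 < n.+1%:R^-1 :> R)%R by rewrite invr_gt0.
  have := iXfin; rewrite ge0_integralTE// => fin.
  have [_ [h hX <-] lth] := ub_ereal_sup_adherent e0 fin.
  exists h; split; first by move=> w; rewrite -lee_fin.
  by rewrite integralT_nnsfun.
have [h hP] := choice approx.
pose Y w := sups (fun n => h n w) 0%N.
have ub w : has_ubound (range (fun n => h n w)).
  by exists (X w) => _ [n _ <-]; case: (hP n).
have h_le n w : (h n w <= Y w)%R.
  by apply: ub_le_sup; [exists (X w) => _ [i _ <-]; case: (hP i)|exists n].
have mY : measurable_fun setT Y by apply: measurable_fun_sups => // w _; exact: ub.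
have Y0 w : (0 <= Y w)%R by exact: le_trans (h_le 0%N w).
have YX w : (Y w <= X w)%R.
  by apply: ge_sup; [exists (h 0%N w), 0%N|move=> _ [n _ <-]; case: (hP n)].
have iYX : \int[P]_w (Y w)%:E = \int[P]_w (X w)%:E.
  apply/eqP; rewrite eq_le; apply/andP; split.
    by apply: le_lower_integral => w; rewrite lee_fin.
  apply/lee_addgt0Pr => e e0.
  have [n ne] : exists n : nat, (n.+1%:R^-1 < e)%R.
    have ei : (0 <= e^-1)%R by rewrite invr_ge0 ltW.
    exists (Num.truncn e^-1)%R; rewrite invf_plt ?posrE//.
    by case/andP: (truncn_itv ei).
  have [_ lth] := hP n.
  have lehY : \int[P]_w (h n w)%:E <= \int[P]_w (Y w)%:E.
    by apply: le_lower_integral => w; rewrite lee_fin.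
  have := le_trans (ltW lth) lehY; rewrite leeBlDr// => /le_trans; apply.
  by rewrite leeD2l// lee_fin ltW.
exists Y; split => // [w|Z mZ ZX]; first by rewrite Y0 YX.
case: ZX => N [mN N0 NX].
pose Z' w := if w \in N then Y w else Num.max (Y w) (Z w).
have mZ' : measurable_fun setT Z'.
  apply: measurable_fun_ifT => //; last exact: measurable_maxr.
  by apply: (measurable_fun_bool true); rewrite setTI preimage_mem_true.
have Z'X w : (Z' w <= X w)%R.
  rewrite /Z'; case: ifPn => // /negP wN; rewrite ge_max YX/=.
  by apply: contrapT => nle; apply: wN; rewrite inE; exact: NX.
have YZ' w : (0 <= Y w <= Z' w)%R.
  by rewrite Y0 /Z' /=; case: ifP => _; rewrite ?le_max lexx.
have : {ae P, forall w, Z' w = Y w}.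
  apply: ae_eq_of_le_integral => //; first by rewrite iYX.
  rewrite iYX; apply: le_lower_integral => w; rewrite lee_fin//.
  by case/andP: (YZ' w) => /le_trans h' /h'.
have notN : {ae P, forall w, ~ N w} by exists N; split => // w /contrapT.
move: notN => + H; move: H; apply: filterS2 => w.
rewrite /Z' => + wN; rewrite ifN; last by apply/negP; rewrite inE.
by move=> <-; rewrite le_max lexx orbT.
Qed.

End lower_integral.

(** * Variance bounds *)

Section variance_bounds.
Context {d : measure_display} {T : measurableType d} {R : realType}.
Variable P : probability T R.
Variable X : T -> R.
Hypothesis X_ge0 : forall w, 0 <= X w.

Let ereal_le_shift (a b : \bar R) (x y z : R) :
  (a + x%:E + y%:E = b + z%:E)%E -> z <= x + y -> (a <= b)%E.
Proof.
case: a => [a| |] //; case: b => [b| |] //=; rewrite ?leey ?leNye//.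
by rewrite -!EFinD lee_fin => -[]; lra.
Qed.

Let ereal_ge_shift (a b : \bar R) (x y z : R) :
  (b + x%:E + y%:E = a + z%:E)%E -> x + y <= z -> (a <= b)%E.
Proof.
case: a => [a| |] //; case: b => [b| |] //=; rewrite ?leey ?leNye//.
by rewrite -!EFinD lee_fin => -[]; lra.
Qed.

Let icst (k : R) : (\int[P]_w k%:E = k%:E)%E.
Proof.
rewrite (integral_cst P measurableT k%:E).
transitivity (k%:E * P setT)%E; first by [].
by rewrite probability_setT mule1.
Qed.

Let varianceE : 'V_P[X] =
  (\int[P]_w ((X w - fine (\int[P]_w (X w)%:E)) ^+ 2)%:E)%E.
Proof. by rewrite /variance unlock unlock. Qed.

(** Whatever the mean is, it is at distance at least [(b - a) / 2] from all
    values of [X] on [A], or from all its values on [B]. *)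
Lemma variance_ge (A B : set T) (a b p : R) : a <= b -> 0 <= p ->
  measurable A -> measurable B ->
  (forall w, A w -> X w <= a) -> (forall w, B w -> b <= X w) ->
  p <= fine (P A) -> p <= fine (P B) ->
  ((p * ((b - a) / 2) ^+ 2)%:E <= 'V_P[X])%E.
Proof.
move=> ab p0 mA mB XA XB pA pB; rewrite varianceE.
set m := fine _; set c := ((b - a) / 2) ^+ 2.
have c0 : 0 <= c by exact: sqr_ge0.
have main (C : set T) : measurable C -> p <= fine (P C) ->
    (forall w, C w -> c <= (X w - m) ^+ 2) ->
    ((p * c)%:E <= \int[P]_w ((X w - m) ^+ 2)%:E)%E.
  move=> mC pC Cc.
  apply: (@le_trans _ _ (\int[P]_w (c * \1_C w)%:E)%E).
    under eq_integral do rewrite EFinM.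
    rewrite ge0_integralZl//; last exact/measurable_EFinP.
    rewrite integral_indic// setIT mulrC EFinM lee_wpmul2l// ?lee_fin//.
    by rewrite -[leRHS]fineK ?lee_fin// fin_num_measure.
  apply: le_lower_integral => w; first by rewrite lee_fin mulr_ge0.
  rewrite lee_fin indicE; case: (boolP (w \in C)) => [|_]; last by rewrite mulr0 sqr_ge0.
  by rewrite inE mulr1 => /Cc.
have [mab|mab] := leP ((a + b) / 2) m.
  apply: (main A) => // w /XA Xa.
  have : 0 <= (m - X w - (b - a) / 2) * (m - X w + (b - a) / 2) by apply: mulr_ge0; lra.
  by rewrite /c; lra.
apply: (main B) => // w /XB Xb.
have : 0 <= (X w - m - (b - a) / 2) * (X w - m + (b - a) / 2) by apply: mulr_ge0; lra.
by rewrite /c; lra.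
Qed.

(** For the measurable envelope [Y] of [X]: [q] dominates [(Y - c)^2], since
    [c - sqrt q] is a minorant of [X]; and a simple [phi] below [(X - m)^2] is
    below [(Y - m)^2], since [X] jumps over the gap between [m - sqrt phi] and
    [m + sqrt phi].  It remains that the mean minimises the quadratic
    deviation of [Y]. *)
Lemma variance_le_real (c : R) (q : T -> R) : 0 <= c ->
  measurable_fun setT q -> (forall w, 0 <= q w) ->
  {ae P, forall w, (X w - c) ^+ 2 <= q w} ->
  (\int[P]_w (q w)%:E < +oo)%E ->
  ('V_P[X] <= \int[P]_w (q w)%:E)%E.
Proof.
move=> c0 mq q0 Xq iq.
have X0e w : (0 <= (X w)%:E)%E by rewrite lee_fin.
have iX : (\int[P]_w (X w)%:E < +oo)%E.
  apply: (@le_lt_trans _ _ (\int[P]_w ((c + 1)%:E + (q w)%:E))%E); last first.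
    rewrite ge0_integralD//.
    - by rewrite icst lte_add_pinfty// ltry.
    - by move=> w _; rewrite lee_fin addr_ge0.
    - by move=> w _; rewrite lee_fin.
    - exact/measurable_EFinP.
  apply: lower_integral_le => // h hX; apply: ae_ge0_le_integral => //.
  - by move=> w _; rewrite lee_fin; exact: fun_ge0.
  - exact/measurable_EFinP.
  - by move=> w _; rewrite -EFinD lee_fin !addr_ge0.
  - by apply: emeasurable_funD => //; exact/measurable_EFinP.
  move: Xq; apply: filterS => w Xqw _; rewrite -EFinD lee_fin.
  have := hX w; rewrite lee_fin; have := sqr_ge0 (X w - c - 1 / 2); lra.
rewrite varianceE; set m := fine _.
have [Y [mY YX iY env]] := lower_envelope X_ge0 iX.
have iXm : (\int[P]_w (X w)%:E = m%:E)%E.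
  by rewrite /m fineK// ge0_fin_numE// integral_ge0.
have m0 : 0 <= m by rewrite /m fine_ge0// integral_ge0.
have Y0 w : 0 <= Y w by case/andP: (YX w).
have le_YX w : Y w <= X w by case/andP: (YX w).
have mYc (e : R) : measurable_fun setT (fun w => (Y w - e) ^+ 2).
  by apply: measurable_funX; exact: measurable_funB.
have Yq : {ae P, forall w, (Y w - c) ^+ 2 <= q w}.
  have mZ : measurable_fun setT (fun w => c - Num.sqrt (q w)).
    apply: measurable_funB => //; apply: (measurableT_comp _ mq).
    by apply: continuous_measurable_fun; exact: sqrt_continuous.
  have : {ae P, forall w, c - Num.sqrt (q w) <= X w}.
    move: Xq; apply: filterS => w Xqw.
    have := ler_norm (c - X w); rewrite -sqrtr_sqr => h.
    have : Num.sqrt ((c - X w) ^+ 2) <= Num.sqrt (q w).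
      by apply: ler_wsqrtr; rewrite -sqrrN opprB.
    by lra.
  move=> /(env _ mZ); move: Xq; apply: filterS2 => w Xqw Yw.
  have qs : q w = Num.sqrt (q w) ^+ 2 by rewrite sqr_sqrtr.
  have [Yc|Yc] := leP (Y w) c.
    rewrite qs -sqrrN ler_pXn2r// ?nnegrE ?sqrtr_ge0//; lra.
  apply: le_trans Xqw; rewrite ler_pXn2r// ?nnegrE; have := le_YX w; lra.
apply: lower_integral_le => [w|phi phiX]; first by rewrite lee_fin sqr_ge0.
have Yphi : {ae P, forall w, phi w <= (Y w - m) ^+ 2}.
  pose th w := Num.sqrt (phi w).
  have mth : measurable_fun setT th.
    apply: (measurableT_comp _ (measurable_funP phi)).
    by apply: continuous_measurable_fun; exact: sqrt_continuous.
  have th2 w : th w ^+ 2 = phi w by rewrite sqr_sqrtr//; exact: fun_ge0.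
  pose Z w := if m - th w < Y w then m + th w else 0.
  have mZ : measurable_fun setT Z.
    apply: measurable_fun_ifT => //; last exact: measurable_funD.
    by apply: measurable_fun_ltr => //; exact: measurable_funB.
  have ZX : {ae P, forall w, Z w <= X w}.
    apply: aeW => w; rewrite /Z; case: ifPn => // lt_Y.
    have := phiX w; rewrite lee_fin -th2 => le_sq.
    rewrite leNgt; apply/negP => X_lt.
    have : 0 < (th w - (X w - m)) * (th w + (X w - m)).
      by apply: mulr_gt0; have := le_YX w; lra.
    by lra.
  move: (env _ mZ ZX); apply: filterS => w; rewrite /Z -th2.
  have t0 : 0 <= th w by exact: sqrtr_ge0.
  case: ifPn => [lt_Y le_Y|]; first by rewrite ler_pXn2r// ?nnegrE; lra.
  rewrite -leNgt => Y_le _; rewrite -[leRHS]sqrrN ler_pXn2r// ?nnegrE; lra.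
have meas_phi : (\int[P]_w (phi w)%:E <= \int[P]_w ((Y w - m) ^+ 2)%:E)%E.
  apply: ae_ge0_le_integral => //.
  - by move=> w _; rewrite lee_fin; exact: fun_ge0.
  - exact/measurable_EFinP.
  - by move=> w _; rewrite lee_fin sqr_ge0.
  - exact/measurable_EFinP.
  by move: Yphi; apply: filterS => w Yw _; rewrite lee_fin.
have meas_q : (\int[P]_w ((Y w - c) ^+ 2)%:E <= \int[P]_w (q w)%:E)%E.
  apply: ae_ge0_le_integral => //.
  - by move=> w _; rewrite lee_fin sqr_ge0.
  - exact/measurable_EFinP.
  - by move=> w _; rewrite lee_fin.
  - exact/measurable_EFinP.
  by move: Yq; apply: filterS => w Yw _; rewrite lee_fin.
apply: (le_trans meas_phi); apply: (le_trans _ meas_q).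
have iYm : (\int[P]_w (Y w)%:E = m%:E)%E by rewrite iY.
(* quadratic minimisation, written with nonnegative integrands only *)
have lin (e k : R) : 0 <= k ->
    (\int[P]_w ((Y w - e) ^+ 2 + k * Y w)%:E =
     \int[P]_w ((Y w - e) ^+ 2)%:E + (k * m)%:E)%E.
  move=> k0; under eq_integral do rewrite EFinD.
  rewrite ge0_integralD//; last 4 first.
  - by move=> w _; rewrite lee_fin sqr_ge0.
  - exact/measurable_EFinP.
  - by move=> w _; rewrite lee_fin mulr_ge0.
  - by apply/measurable_EFinP; exact: measurable_funM.
  congr (_ + _)%E; under eq_integral do rewrite EFinM.
  rewrite ge0_integralZl//; last first.
  - by move=> w _; rewrite lee_fin.
  - exact/measurable_EFinP.
  by rewrite iYm.
have shift (f : T -> R) (k : R) : 0 <= k -> (forall w, 0 <= f w) -> measurable_fun setT f ->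
    (\int[P]_w (f w + k)%:E = \int[P]_w (f w)%:E + k%:E)%E.
  move=> k0 f0 mf; under eq_integral do rewrite EFinD.
  rewrite ge0_integralD//; last first.
  - exact/measurable_EFinP.
  - by move=> w _; rewrite lee_fin.
  by rewrite icst.
have f0 : forall (e k : R) (w : T), 0 <= k -> 0 <= (Y w - e) ^+ 2 + k * Y w.
  by move=> e k w k0; rewrite addr_ge0 ?sqr_ge0// mulr_ge0.
have mf : forall e k : R, measurable_fun setT (fun w => (Y w - e) ^+ 2 + k * Y w).
  by move=> e k; apply: measurable_funD => //; exact: measurable_funM.
have [mc|mc] := leP c m.
  have k0 : 0 <= 2 * (m - c) by lra.
  have e1 : (\int[P]_w (((Y w - m) ^+ 2 + 2 * (m - c) * Y w) + c ^+ 2)%:E =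
      \int[P]_w ((Y w - c) ^+ 2 + m ^+ 2)%:E)%E.
    by apply: eq_integral => w _; congr (_%:E); ring.
  rewrite (shift _ _ (sqr_ge0 c) (fun w => f0 m _ w k0) (mf _ _)) lin// in e1.
  rewrite (shift _ _ (sqr_ge0 m) (fun w => sqr_ge0 _) (mYc c)) in e1.
  apply: (ereal_le_shift e1); have := sqr_ge0 (m - c); lra.
have k0 : 0 <= 2 * (c - m) by lra.
have e1 : (\int[P]_w (((Y w - c) ^+ 2 + 2 * (c - m) * Y w) + m ^+ 2)%:E =
    \int[P]_w ((Y w - m) ^+ 2 + c ^+ 2)%:E)%E.
  by apply: eq_integral => w _; congr (_%:E); ring.
rewrite (shift _ _ (sqr_ge0 m) (fun w => f0 c _ w k0) (mf _ _)) lin// in e1.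
rewrite (shift _ _ (sqr_ge0 c) (fun w => sqr_ge0 _) (mYc m)) in e1.
apply: (ereal_ge_shift e1); have := sqr_ge0 (m - c); lra.
Qed.
End variance_bounds.

(** * The upper bound *)

Section upper_bound.
Context {d : measure_display} {T : measurableType d} {R : realType}.
Variable P : probability T R.
Variables W1 W2 : R -> T -> R.
Hypothesis hW : planar_brownian_motion P W1 W2.
Local Notation Pr A := (fine (P A)).
Local Notation time := (inradius_time W1 W2).

Lemma path_bounded (f : R -> R) (t : R) : {within `[0, +oo[, continuous f} -> 0 <= t ->
  exists M, forall x, 0 <= x <= t -> `|f x| <= M.
Proof.
move=> cf t0; have cf' : {within `[0, t], continuous f}.
  by apply: continuous_subspaceW cf => x /=; rewrite !in_itv/= => /andP[->].
have [u _ fu] := EVT_max t0 cf'; have [v _ fv] := EVT_min t0 cf'.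
exists (`|f u| + `|f v|) => x xt.
have xin : x \in `[0, t]%R by rewrite in_itv.
have := fu x xin; have := fv x xin.
have := ler_norm (f u); have := ler_norm (- f v); rewrite normrN ler_norml.
by have := normr_ge0 (f u); have := normr_ge0 (f v); lra.
Qed.

Lemma inradius_time_ge0 w : (0 <= time w)%E.
Proof. by apply: le_ereal_inf_tmp => _ [t [t0 _] <-]; rewrite lee_fin. Qed.

Lemma inradius_time_le (w : T) (t : R) c (rho : R) :
  {within `[0, +oo[, continuous (fun t => W1 t w)} -> 0 <= t -> 1 < rho ->
  euclidean_disk c rho `<=` path_hull W1 W2 t w -> (time w <= t%:E)%E.
Proof.
move=> cW t0 rho1 disk; have [M MP] := path_bounded cW t0.
apply: ereal_inf_lbound; exists t => //; split => //.
have rho0 : 0 <= rho by apply: le_trans (ltW rho1).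
apply: (inradius_gt rho0 rho1 _ disk) => _ [x /= xt <-] /=.
by apply: MP; rewrite in_itv/= in xt.
Qed.

Variables (s : R) (n : nat).
Hypothesis s_gt0 : 0 < s.
Hypothesis ns : n%:R * s = 45.
Hypothesis s_small : Num.sqrt s <= 10 ^- 9.
Local Notation Z := (brownian_noise W1 W2 s).

Fixpoint blocks_fail (m : nat) : set T :=
  if m is m'.+1 then block_fail W1 W2 s (blocks_fail m') (m' * n) n else setT.

Let fail_past m : @measurable _ (past Z (m * n).*2) (blocks_fail m).
Proof.
elim: m => [|m IH]; first exact: measurableT.
have -> : (m.+1 * n = m * n + n)%N by rewrite mulSn addnC.
exact: block_fail_measurable.
Qed.

Lemma blocks_fail_measurable m : measurable (blocks_fail m).
Proof.
have mZ j : measurable_fun setT (Z j).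
  by case: (brownian_gaussian_noise hW s_gt0) => gZ _; case: (gZ j).
exact: (past_measurable mZ (@fail_past m)).
Qed.

Let fail_measurable := blocks_fail_measurable.

Lemma blocks_fail_prob m : Pr (blocks_fail m) <= (1 / 25) ^+ m.
Proof.
elim: m => [|m IH].
  by rewrite expr0 /= (_ : Pr setT = 1)//; exact: (congr1 fine (probability_setT P)).
apply: le_trans (block_fail_prob hW s_gt0 ns s_small (@fail_past m)) _.
by rewrite exprS ler_wpM2l.
Qed.

Lemma blocks_fail_anti i m : (i <= m)%N -> blocks_fail m `<=` blocks_fail i.
Proof.
elim: m => [|m IH]; first by rewrite leqn0 => /eqP ->.
rewrite leq_eqVlt => /predU1P[->//|im] w /=.
by move=> /block_fail_sub; exact: IH.
Qed.

Lemma blocks_fail_last w : ~ (\bigcap_m blocks_fail m) w ->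
  exists m, blocks_fail m w /\ ~ blocks_fail m.+1 w.
Proof.
move=> notall; have [M notM] : exists M, ~ blocks_fail M w.
  by apply/existsNP => all; apply: notall => m _; exact: all.
elim: M notM => [[]//|M IH notM].
by have [FM|/IH] := pselect (blocks_fail M w); first by exists M.
Qed.

Lemma blocks_fail_all : P (\bigcap_m blocks_fail m) = 0.
Proof.
have mI : measurable (\bigcap_m blocks_fail m) by exact: bigcapT_measurable.
have le_m m : Pr (\bigcap_m blocks_fail m) <= (1 / 25) ^+ m.
  apply: le_trans (blocks_fail_prob m); apply: Pr_le => // w; exact.
have fin : P (\bigcap_m blocks_fail m) \is a fin_num by exact: fin_num_measure.
rewrite -(fineK fin); congr (_%:E).
apply/eqP; rewrite eq_le fine_ge0// andbT.
have cv : (1 / 25 : R) ^+ m @[m --> \oo] --> (0 : R).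
  by apply: cvg_expr; rewrite ger0_norm; lra.
by apply: (ler_cvg_to (cvg_cst _) cv); apply: nearW.
Qed.

Lemma inradius_time_block w m : {within `[0, +oo[, continuous (fun t => W1 t w)} ->
  blocks_fail m w -> ~ blocks_fail m.+1 w -> (time w <= (45 * m.+1%:R)%:E)%E.
Proof.
move=> cW Fm notF; have [c disk] := block_success s_gt0 Fm notF.
have tE : (m * n + n)%:R * s = 45 * m.+1%:R.
  by rewrite -mulSnr natrM -mulrA ns mulrC.
rewrite tE in disk.
have t0 : 0 <= 45 * m.+1%:R :> R by rewrite mulr_ge0.
have rho1 : 1 < 301 / 300 :> R by lra.
exact: (inradius_time_le cW t0 rho1 disk).
Qed.

(** The increments of [(2 m + 1)^2 * (45/2)^2], so that the partial sums bound
    the square of [tau - 45/2] when [tau] is at most [45 * (m + 1)]. *)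
Definition block_weight (m : nat) : R :=
  if m is 0 then (45 / 2) ^+ 2 else 8 * m%:R * (45 / 2) ^+ 2.

Lemma block_weight_ge0 m : 0 <= block_weight m.
Proof. by case: m => [|m] /=; rewrite ?sqr_ge0// mulr_ge0 ?sqr_ge0// mulr_ge0. Qed.

Let weight_ge0 := block_weight_ge0.

Lemma sum_block_weight m :
  \sum_(0 <= i < m.+1) block_weight i = (2 * m%:R + 1) ^+ 2 * (45 / 2) ^+ 2.
Proof.
elim: m => [|m IH]; first by rewrite big_nat1 mulr0 add0r expr1n mul1r.
by rewrite big_nat_recr//= IH -[m.+1%:R]natr1; ring.
Qed.

(** [sum_m 8 m x^m = 8 x / (1 - x)^2], which is 25/72 at [x = 1/25]; the
    remainder is kept in the induction. *)
Lemma sum_block_weight_prob m :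
  \sum_(0 <= i < m) block_weight i * (1 / 25) ^+ i <= 683.
Proof.
case: m => [|m]; first by rewrite big_geq; [exact: ler0n|].
have main : \sum_(0 <= i < m.+1) block_weight i * (1 / 25) ^+ i <=
    (45 / 2) ^+ 2 * (1 + 25 / 72 - (25 / 3 * m.+1%:R + 25 / 72) * (1 / 25) ^+ m.+1).
  elim: m => [|m IH]; first by rewrite big_nat1 expr0 expr1 /=; lra.
  rewrite big_nat_recr//= [_ ^+ m.+2]exprS; apply: le_trans (lerD IH (lexx _)) _.
  by rewrite -[m.+2%:R]natr1; lra.
apply: le_trans main _.
have : 0 <= (25 / 3 * m.+1%:R + 25 / 72) * (1 / 25 : R) ^+ m.+1.
  by rewrite mulr_ge0 ?exprn_ge0// addr_ge0// mulr_ge0.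
by lra.
Qed.

Definition deviation_bound (w : T) : \bar R :=
  (\sum_(0 <= m <oo) (block_weight m * \1_(blocks_fail m) w)%:E)%E.

Let term_ge0 m w : (0 <= (block_weight m * \1_(blocks_fail m) w)%:E :> \bar R)%E.
Proof. by rewrite lee_fin mulr_ge0. Qed.

Let term_measurable m :
  measurable_fun setT (fun w => (block_weight m * \1_(blocks_fail m) w)%:E).
Proof. by apply/measurable_EFinP; apply: measurable_funM => //; exact: measurable_indic. Qed.

Lemma deviation_bound_measurable : measurable_fun setT deviation_bound.
Proof. by apply: (@ge0_emeasurable_sum _ _ _ _ _ predT). Qed.

Lemma deviation_bound_integral : (\int[P]_w deviation_bound w <= 683%:E)%E.
Proof.
rewrite integral_nneseries//.
apply: lime_le; first by apply: is_cvg_nneseries => m _ _; apply: integral_ge0 => w _.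
apply: nearW => m; have termE i : (\int[P]_w (block_weight i * \1_(blocks_fail i) w)%:E =
    (block_weight i * Pr (blocks_fail i))%:E)%E.
  under eq_integral do rewrite EFinM.
  rewrite ge0_integralZl//; last 2 first.
  - by apply/measurable_EFinP; exact: measurable_indic.
  - by rewrite lee_fin.
  by rewrite integral_indic// setIT EFinM fineK// fin_num_measure.
under eq_bigr do rewrite termE.
rewrite sumEFin lee_fin; apply: le_trans (sum_block_weight_prob m).
by apply: ler_sum => i _; rewrite ler_wpM2l// blocks_fail_prob.
Qed.

Lemma deviation_le w : {within `[0, +oo[, continuous (fun t => W1 t w)} ->
  ~ (\bigcap_m blocks_fail m) w ->
  (time w < +oo)%E /\ (((fine (time w) - 45 / 2) ^+ 2)%:E <= deviation_bound w)%E.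
Proof.
move=> cW /blocks_fail_last[m [Fm notF]].
have time_le := inradius_time_block cW Fm notF.
have time_lt : (time w < +oo)%E by apply: le_lt_trans time_le _; rewrite ltry.
split => //; apply: (@le_trans _ _ (\sum_(0 <= i < m.+1) (block_weight i)%:E)%E).
  rewrite sumEFin lee_fin sum_block_weight.
  have time_fin : time w \is a fin_num by rewrite ge0_fin_numE// inradius_time_ge0.
  have xm : fine (time w) <= 45 * (m%:R + 1) by rewrite natr1 -lee_fin fineK.
  have x0 : 0 <= fine (time w) by rewrite fine_ge0// inradius_time_ge0.
  have m0 : 0 <= m%:R :> R by [].
  move: xm x0; set x := fine _ => xm x0.
  rewrite -exprMn; have : 0 <= ((2 * m%:R + 1) * (45 / 2) - (x - 45 / 2)) *
      ((2 * m%:R + 1) * (45 / 2) + (x - 45 / 2)) by apply: mulr_ge0; lra.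
  by lra.
apply: le_trans (nneseries_lim_ge m.+1 (fun i _ _ => term_ge0 i w)).
rewrite le_eqVlt; apply/orP; left; apply/eqP; apply: eq_big_nat => i /andP[_ im].
by rewrite indicE mem_set ?mulr1//; exact: blocks_fail_anti Fm.
Qed.
End upper_bound.

(** * The inradius may exceed 1 before time 8 *)

Section gaussian_box.
Context {R : realType}.

(** With standard deviation 2 the peak of the density is at least 1/6, as
    [8 * pi <= 36]. *)
Lemma normal_prob_itv_ge (a b M e : R) : a <= b ->
  (forall x, a <= x <= b -> `|x| <= M) -> 0 <= e -> e <= 6 * expR (- (M ^+ 2 / 8)) / 36 ->
  (((b - a) * e)%:E <= normal_prob 0 2 `[a, b])%E.
Proof.
move=> ab xM e0 e_le.
have -> : ((b - a) * e)%:E = (\int[lebesgue_measure]_(x in `[a, b]) e%:E)%E.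
  rewrite integral_cst//= lebesgue_measure_itv/= lte_fin.
  move: ab; rewrite le_eqVlt => /predU1P[->|ab]; first by rewrite ltxx subrr mul0r mule0.
  by rewrite ab -EFinD -EFinM mulrC.
rewrite /normal_prob; apply: ge0_le_integral => //.
- by apply/measurable_EFinP; apply: measurable_funTS; exact: measurable_normal_pdf.
move=> x x_in; have x_le : `|x| <= M by apply: xM; move: x_in; rewrite /= in_itv.
rewrite lee_fin.
rewrite normal_pdfE ?pnatr_eq0//.
change (e <= normal_peak 2 * normal_fun 0 2 x); rewrite /normal_fun /normal_peak.
have M0 : 0 <= M by exact: le_trans x_le.
apply: le_trans e_le _; rewrite mulrAC (_ : 6 / 36 = 6^-1 :> R); last by field.
apply: ler_pM; rewrite ?invr_ge0 ?expR_ge0//.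
  rewrite lef_pV2 ?posrE ?sqrtr_gt0//; last by rewrite mulrn_wgt0// mulr_gt0// pi_gt0.
  rewrite -[6](@ger0_norm R)// -sqrtr_sqr ler_wsqrtr//.
  have -> : 2 ^+ 2 * pi *+ 2 = 16 * (pi / 2) :> R by rewrite -mulr_natr; field.
  by have := @pihalf_lt2 R; lra.
rewrite ler_expR subr0 mulNr lerN2.
have x2 : x ^+ 2 <= M ^+ 2 by rewrite -(real_normK (num_real x)) ler_pXn2r// nnegrE.
rewrite (_ : 2 ^+ 2 *+ 2 = 8 :> R); last by rewrite -mulr_natr; ring.
by rewrite ler_wpM2r.
Qed.

Lemma normal_prob_center_ge : (7^-1%:E <= normal_prob 0 2 `[(- (1 / 2))%R, (1 / 2)%R : R])%E.
Proof.
have := @normal_prob_itv_ge (- (1 / 2)) (1 / 2) (1 / 2) 7^-1.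
have -> : (1 / 2 - - (1 / 2)) * 7^-1 = 7^-1 :> R by field.
apply; [lra|by move=> x; rewrite ler_norml|lra|].
by have := expR_ge1Dx (- ((1 / 2) ^+ 2 / 8) : R); lra.
Qed.

Lemma normal_prob_far_ge :
  ((1 / 3000)%:E <= normal_prob 0 2 `[(11 / 2)%R, (13 / 2)%R : R])%E.
Proof.
have := @normal_prob_itv_ge (11 / 2) (13 / 2) (13 / 2) (1 / 3000).
have -> : (13 / 2 - 11 / 2) * (1 / 3000) = 1 / 3000 :> R by field.
apply; [lra|by move=> x; rewrite ler_norml; lra|lra|].
have e1 : 7 / 9 <= expR (- (2 / 9)) :> R by have := expR_ge1Dx (- (2 / 9) : R); lra.
have e24 : (7 / 9) ^+ 24 <= expR (- (16 / 3)) :> R.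
  have -> : - (16 / 3) = 24%:R * - (2 / 9) :> R by field.
  by rewrite expRM_natl; apply: lerXn2r; rewrite ?nnegrE ?expR_ge0//; lra.
have e_le : expR (- (16 / 3)) <= expR (- ((13 / 2) ^+ 2 / 8)) :> R by rewrite ler_expR; lra.
have : 2 / 1000 <= (7 / 9) ^+ 24 :> R by lra.
by lra.
Qed.
End gaussian_box.

Section early_event.
Context {d : measure_display} {T : measurableType d} {R : realType}.
Variable P : probability T R.
Variables W1 W2 : R -> T -> R.
Hypothesis hW : planar_brownian_motion P W1 W2.
Local Notation time := (inradius_time W1 W2).
Local Notation Z := (brownian_noise W1 W2 4).

(** Entries 0 and 1 of the noise of mesh 4 are the increments of the two
    coordinates over [0, 4], entries 2 and 3 those over [4, 8]. *)
Definition turning_box (j : nat) : set R :=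
  if (j == 0%N) || (j == 3%N) then [set` `[11 / 2, 13 / 2]]
  else [set` `[- (1 / 2), 1 / 2]].

Definition turning_event : set T := \bigcap_(j in `I_4) Z j @^-1` turning_box j.

Let box_measurable j : measurable (turning_box j).
Proof. by rewrite /turning_box; case: ifP. Qed.

Let gaussZ : gaussian_noise P Z 2.
Proof.
have s4 : 0 < 4 :> R by [].
have := brownian_gaussian_noise hW s4.
by rewrite (_ : 4 = 2 ^+ 2 :> R) ?sqrtr_sqr ?ger0_norm//; ring.
Qed.

Lemma turning_event_measurable : measurable turning_event.
Proof.
apply: bigcap_measurableType => j _; rewrite -[X in measurable X]setTI.
by case: gaussZ => gZ _; case: (gZ j) => mZ _; exact: mZ.
Qed.

Lemma turning_event_prob : 10 ^- 9 <= fine (P turning_event).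
Proof.
case: gaussZ => gZ indep; rewrite -lee_fin fineK; last first.
  by apply: fin_num_measure; exact: turning_event_measurable.
have pj j : P (Z j @^-1` turning_box j) = normal_prob 0 2 (turning_box j).
  by case: (gZ j) => _; exact.
rewrite /turning_event indep// !big_ord_recl big_ord0 /= !pj /turning_box /= mule1.
have far := @normal_prob_far_ge R; have cen := @normal_prob_center_ge R.
apply: (@le_trans _ _ ((1 / 3000)%:E * (7^-1%:E * (7^-1%:E * (1 / 3000)%:E)))%E).
  by rewrite -!EFinM lee_fin; lra.
have q1 : (0 <= 7^-1%:E :> \bar R)%E by rewrite lee_fin invr_ge0 ler0n.
have q2 : (0 <= (1 / 3000)%:E :> \bar R)%E by rewrite lee_fin divr_ge0 ?ler0n.
exact: (lee_pmul q2 (mule_ge0 q1 (mule_ge0 q1 q2)) far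
  (lee_pmul q1 (mule_ge0 q1 q2) cen (lee_pmul q1 q2 cen far))).
Qed.

Lemma turning_event_time w : W1 0 w = 0 -> W2 0 w = 0 ->
  {within `[0, +oo[, continuous (fun t => W1 t w)} ->
  turning_event w -> (time w <= 8%:E)%E.
Proof.
move=> W10 W20 cW ev.
have t0 : 0 <= 8 :> R by [].
have rho1 : 1 < 101 / 100 :> R by lra.
apply: (inradius_time_le cW t0 rho1 (c := (17 / 4, 7 / 4))).
have on_path t : 0 <= t <= 8 ->
    [set ((W1 s w, W2 s w) : R^o * R^o) | s in `[0, 8]] (W1 t w, W2 t w).
  by move=> t8; exists t => //=; rewrite in_itv.
have p0 := on_path 0; rewrite W10 W20 in p0.
have e0 : 0%:R * 4 = 0 :> R by rewrite mul0r.
have e1 : 1%:R * 4 = 4 :> R by rewrite mul1r.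
have e2 : 2%:R * 4 = 8 :> R by ring.
have z0 := ev 0%N isT; have z1 := ev 1%N isT; have z2 := ev 2%N isT; have z3 := ev 3%N isT.
rewrite /turning_box /brownian_noise /grid_increment /= !in_itv/= in z0 z1 z2 z3.
rewrite e0 e1 W10 subr0 in z0; rewrite e0 e1 W20 subr0 in z1.
rewrite e1 e2 in z2; rewrite e1 e2 in z3.
apply: (@triangle_disk _ _ (W1 4 w) (W2 4 w) (W1 8 w) (W2 8 w)).
- by apply: p0; lra.
- by apply: on_path; lra.
- by apply: on_path; lra.
- exact: z0.
- by rewrite ler_norml.
- by rewrite ler_norml.
- exact: z3.
Qed.
End early_event.

(** * The inradius may stay below 1 until time 10 *)

Section late_event.
Context {d : measure_display} {T : measurableType d} {R : realType}.
Variable P : probability T R.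
Variables W1 W2 : R -> T -> R.
Hypothesis hW : planar_brownian_motion P W1 W2.
Local Notation time := (inradius_time W1 W2).
Local Notation Pr A := (fine (P A)).
Variable M : nat.
Hypothesis M_gt0 : (0 < M)%N.

Let cells (j : nat) : nat := (M * 2 ^ j)%N.

(** Dyadic refinements of the cells of length [1 / (10 M)], where [M] is
    large so that all steps are small. *)
Definition dyadic_step (j : nat) : R := (10 * (cells j)%:R)^-1.

Let cells_gt0 j : 0 < (cells j)%:R :> R.
Proof. by rewrite ltr0n muln_gt0 M_gt0 expn_gt0. Qed.

Let step_gt0 j : 0 < dyadic_step j.
Proof. by rewrite invr_gt0 mulr_gt0. Qed.

Let step_cells j : (cells j)%:R * dyadic_step j = 10^-1.
Proof. by have /lt0r_neq0 c0 := cells_gt0 j; rewrite /dyadic_step; field. Qed.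

Let stepS j : dyadic_step j = 2 * dyadic_step j.+1.
Proof.
have /lt0r_neq0 c0 := cells_gt0 j.
have cS : (cells j.+1)%:R = 2 * (cells j)%:R :> R by rewrite /cells expnS mulnCA natrM.
by rewrite /dyadic_step cS; field.
Qed.

Definition stay (j : nat) : set T :=
  confined (brownian_noise W1 W2 (dyadic_step j)) 1 0 setT 0 0 1 (100 * cells j).

Lemma stayP j w : stay j w <-> forall i, (0 < i <= 100 * cells j)%N ->
  `|W1 (i%:R * dyadic_step j) w - W1 0 w| <= 1.
Proof.
rewrite /stay confinedP; split => [[_ near] i /near|near].
  by rewrite displacement_brownian// mul1r !mul0r addr0 subr0 add0n.
split => // i /near.
by rewrite displacement_brownian// mul1r !mul0r addr0 subr0 add0n.
Qed.

Lemma stay_measurable j : measurable (stay j).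
Proof.
have gZ := brownian_gaussian_noise hW (step_gt0 j).
have mZ i : measurable_fun setT (brownian_noise W1 W2 (dyadic_step j) i).
  by case: gZ => gZ _; case: (gZ i).
apply: (past_measurable mZ (k := (0 + 100 * cells j).*2)).
exact: confined_measurable.
Qed.

Lemma stay_nonincreasing : nonincreasing_seq stay.
Proof.
apply/nonincreasing_seqP => j; apply/subsetPset => w /stayP near.
apply/stayP => i /andP[i0 iN]; rewrite stepS mulrA -natrM; apply: near.
have cS : (cells j.+1 = 2 * cells j)%N by rewrite /cells expnS mulnCA.
by rewrite muln_gt0 i0 /= cS mulnCA mulnC leq_mul2l.
Qed.

Let pow_le (x y : R) k : 0 <= x -> x <= y -> x ^+ k <= y ^+ k.
Proof. by move=> x0 xy; apply: lerXn2r; rewrite ?nnegrE// (le_trans x0). Qed.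

Let powers : 15 * 10 ^- 11 <= (4 / 5) ^+ 100 :> R.
Proof.
have p10 : 107 / 1000 <= (4 / 5) ^+ 10 :> R by lra.
rewrite (exprM _ 10 10); apply: (@le_trans _ _ ((107 / 1000) ^+ 10)); first by lra.
by apply: pow_le p10; lra.
Qed.

(** The decay over [100 * cells j] steps is at least
    [(1 - 2 * s)^(100 * cells j) >= (4/5)^100], by Bernoulli's inequality in
    each of 100 groups of steps. *)
Lemma stay_prob j : Num.sqrt (dyadic_step j) <= 10 ^- 14 -> 10 ^- 10 <= Pr (stay j).
Proof.
move=> small; set s := dyadic_step j in small *.
have s0 : 0 < s := step_gt0 j.
have sg0 : 0 < Num.sqrt s by rewrite sqrtr_gt0.
have sE : Num.sqrt s ^+ 2 = s by rewrite sqr_sqrtr// ltW.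
have s_small : s <= 1 / 100.
  have : Num.sqrt s * Num.sqrt s <= 1 * (1 / 100).
    by have sg := ltW sg0; apply: ler_pM => //; lra.
  by rewrite -expr2 sE; lra.
have ab10 : 1 ^+ 2 + 0 ^+ 2 = 1 :> R by rewrite expr1n expr0n addr0.
have gZ := brownian_gaussian_noise hW s0.
have r0 : 0 < 1 / 2 :> R by lra.
have h0 : 0 <= 1 :> R by [].
have rho01 : 0 <= 1 - 2 * s <= 1 by lra.
have mT : @measurable _ (past (brownian_noise W1 W2 s) 0.*2) setT by exact: measurableT.
pose kappa := pi / 2 / 1 :> R.
have kappa0 : 0 < kappa by rewrite !divr_gt0 ?pi_gt0.
have kappa2 : kappa ^+ 2 <= 2 ^+ 2.
  rewrite ler_pXn2r// ?nnegrE ?(ltW kappa0)//.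
  by have := @pihalf_lt2 R; rewrite /kappa; lra.
have ks : kappa ^+ 2 * s <= 2 ^+ 2 * s by rewrite ler_wpM2r// ltW.
have cos_le0 (x : R) : 1 < `|x| -> `|x| <= 1 + 1 / 2 -> cos (kappa * x) <= 0.
  by move=> x1 x2; apply: cos_wave_le0 => //; rewrite ltW//=; lra.
have cos_ge0 (x : R) : `|x| <= 1 -> 0 <= cos (kappa * x) by exact: cos_wave_ge0.
have k2 : kappa ^+ 2 * Num.sqrt s ^+ 2 <= 2 by rewrite sE; lra.
have rho_le m : 1 - 2 * s <= cos_contraction P (brownian_noise W1 W2 s) 1 0 kappa m.
  apply: le_trans (cos_contraction_ge sg0 gZ ab10 m k2).
  by rewrite sE; lra.
have := confined_prob_ge sg0 gZ ab10 (100 * cells j) r0 h0 rho01 mT cos_le0 cos_ge0 rho_le.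
have -> : Pr setT = 1 by exact: (congr1 fine (probability_setT P)).
rewrite mulr1 -/(stay j); apply: le_trans.
have s2 : 0 <= 2 * s <= 1 by lra.
have := bernoulli_ge (cells j) s2; rewrite mulrCA step_cells => bern.
have rate : (4 / 5) ^+ 100 <= (1 - 2 * s) ^+ (100 * cells j).
  by rewrite mulnC exprM; apply: pow_le; lra.
have -> : (100 * cells j)%:R * (32 * Num.sqrt s ^+ 3 / (1 / 2) ^+ 3) =
    100 * ((cells j)%:R * s) * (256 * Num.sqrt s).
  by rewrite natrM [_ ^+ 3]exprSr sE; field.
rewrite step_cells; have := powers; lra.
Qed.

Lemma stay_all_prob : (forall j, Num.sqrt (dyadic_step j) <= 10 ^- 14) ->
  10 ^- 10 <= Pr (\bigcap_j stay j).
Proof.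
move=> small.
have mI : measurable (\bigcap_j stay j) by apply: bigcapT_measurable => j; exact: stay_measurable.
have fin0 : (P (stay 0%N) < +oo)%E.
  by rewrite ltey_eq fin_num_measure//; exact: stay_measurable.
have cv := nonincreasing_cvg_mu fin0 stay_measurable mI stay_nonincreasing.
rewrite -lee_fin fineK ?fin_num_measure//.
rewrite -(cvg_lim (@ereal_hausdorff R) cv); apply: lime_ge; first by apply/cvg_ex; eexists; exact: cv.
apply: nearW => j; rewrite /= -[X in (_ <= X)%E]fineK; last first.
  by apply: fin_num_measure; exact: stay_measurable.
by rewrite lee_fin stay_prob.
Qed.

Lemma grid_bound (f : R -> R) : {within `[0, +oo[, continuous f} ->
  (forall j i, (0 < i <= 100 * cells j)%N -> `|f (i%:R * dyadic_step j)| <= 1) ->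
  f 0 = 0 -> forall t, 0 <= t <= 10 -> `|f t| <= 1.
Proof.
move=> /subspace_continuousP cf near f0 t /andP[t0 t10].
rewrite leNgt; apply/negP => ft.
have t_in : [set` `[0, +oo[] t by rewrite /= in_itv/= t0.
have cn : `|f x| @[x --> within [set` `[0, +oo[] (nbhs t)] --> `|f t|.
  by apply: cvg_norm; exact: cf.
have nb : nbhs t (fun x : R => [set` `[0, +oo[] x -> 1 < `|f x|).
  by apply: (cvgr_gt _ cn _ ft).
have [e /= e0 eP] := (nbhs_ballP _ _).1 nb.
have [j je] : exists j, dyadic_step j < e.
  pose j := Num.truncn (e^-1).
  have e10 : 0 <= e^-1 by rewrite invr_ge0 ltW.
  have /andP[_ j_gt] : j%:R <= e^-1 < j.+1%:R by exact: truncn_itv.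
  exists j; apply: (@le_lt_trans _ _ j.+1%:R^-1); last by rewrite invf_plt ?posrE.
  rewrite /dyadic_step lef_pV2 ?posrE ?mulr_gt0//.
  apply: (@le_trans _ _ (cells j)%:R); last by have := cells_gt0 j; lra.
  by rewrite ler_nat /cells; apply: (leq_trans (@ltn_expl 2 j isT)); rewrite leq_pmull.
pose i := Num.truncn (t / dyadic_step j).
have sj := step_gt0 j.
have ts0 : 0 <= t / dyadic_step j by rewrite divr_ge0// ltW.
have /andP[i_le i_gt] : i%:R <= t / dyadic_step j < i.+1%:R by exact: truncn_itv.
rewrite ler_pdivlMr// in i_le; rewrite ltr_pdivrMr// -natr1 mulrDl mul1r in i_gt.
have close : ball t e (i%:R * dyadic_step j).
  by rewrite /ball/= ger0_norm; lra.
have grid_in : [set` `[0, +oo[] (i%:R * dyadic_step j).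
  by rewrite /= in_itv/= mulr_ge0// ltW.
have := eP _ close grid_in; apply/negP; rewrite -leNgt.
have [->|i0] := posnP i; first by rewrite mul0r f0 normr0.
apply: near; rewrite i0 /= -(ler_nat R) natrM.
rewrite -(ler_pM2r sj); apply: (le_trans i_le).
by rewrite -mulrA step_cells; lra.
Qed.

(** The hull is then in the slab between the lines of abscissa -1 and 1. *)
Lemma stay_time w : W1 0 w = 0 -> {within `[0, +oo[, continuous (fun t => W1 t w)} ->
  (\bigcap_j stay j) w -> (10%:E <= time w)%E.
Proof.
move=> W10 cW st; apply: le_ereal_inf_tmp => _ [t [t0 inr] <-].
rewrite lee_fin leNgt; apply/negP => t10; move: inr; apply/negP; rewrite -leNgt.
apply: inradius_le => // _ [x /= + <-] /=; rewrite in_itv/= => /andP[x0 xt].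
apply: (grid_bound cW) => //; last by rewrite x0; lra.
move=> j i /(stayP j w).1; rewrite W10 subr0; apply.
exact: st.
Qed.
End late_event.

(** * Conclusion *)

Section conclusion.
Context {R : realType}.

Lemma small_step_exists (c e : R) : 0 < c -> 0 < e ->
  exists n : nat, (0 < n)%N /\ Num.sqrt (c / n%:R) <= e.
Proof.
move=> c0 e0; have ce0 : 0 <= c / e ^+ 2 by rewrite divr_ge0 ?sqr_ge0// ltW.
exists (Num.truncn (c / e ^+ 2)).+1; split => //.
have /andP[_ n_gt] := truncn_itv ce0.
rewrite -[leRHS](ger0_norm (ltW e0)) -sqrtr_sqr ler_wsqrtr// ler_pdivrMr ?ltr0n//.
by rewrite -ler_pdivrMl ?exprn_gt0// mulrC ltW.
Qed.

Context {d : measure_display} {T : measurableType d} (P : probability T R).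
Local Notation Pr A := (fine (P A)).

Lemma Pr_remove_null (A N : set T) : measurable A -> measurable N -> P N = 0 ->
  Pr A <= Pr (A `\` N).
Proof.
move=> mA mN N0; have mD := measurableD mA mN.
have : Pr A <= Pr ((A `\` N) `|` N).
  apply: Pr_le => //; first exact: measurableU.
  by move=> w Aw; have [Nw|Nw] := pselect (N w); [right|left].
move/le_trans => /(_ _ (PrU_le P mD mN)).
have PN : Pr N = 0 by rewrite N0.
by rewrite PN addr0.
Qed.
End conclusion.

Theorem theorem1p5 (R : realType) (d : measure_display) (T : measurableType d)
    (P : probability T R) (W1 W2 : R -> T -> R)
    (hW : planar_brownian_motion P W1 W2) :
  {ae P, forall w, (inradius_time W1 W2 w < +oo)%E} /\
  ((52 / 10 * 10 ^- 11)%:E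
     <= 'V_P[fun w => fine (inradius_time W1 W2 w)]
     <= (709 + 599 / 1000)%:E)%E.
Proof.
have [n [n0 s_small]] : exists n : nat, (0 < n)%N /\ Num.sqrt (45 / n%:R) <= 10 ^- 9 :> R.
  by apply: small_step_exists => //; rewrite invr_gt0 exprn_gt0.
have nR0 : 0 < n%:R :> R by rewrite ltr0n.
have s0 : 0 < 45 / n%:R :> R by rewrite divr_gt0.
have ns : n%:R * (45 / n%:R) = 45 :> R by rewrite mulrC divfK// gt_eqF.
pose fails := \bigcap_m blocks_fail W1 W2 (45 / n%:R) n m.
have [bm1 bm2 _] := hW.
have ae_fails : {ae P, forall w, ~ fails w}.
  exists fails; split.
  - by apply: bigcapT_measurable => m; exact: (blocks_fail_measurable hW n s0).
  - exact: (blocks_fail_all hW s0 ns s_small).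
  - by move=> w /contrapT.
have good : {ae P, forall w, [/\ W1 0 w = 0, W2 0 w = 0,
    {within `[0, +oo[, continuous (fun t => W1 t w)} & ~ fails w]}.
  have start : {ae P, forall w, W1 0 w = 0 /\ W2 0 w = 0}.
    by apply: filterS2 (bm_start bm1) (bm_start bm2) => w.
  by apply: filterS3 start (bm_continuous bm1) ae_fails => w [].
set time := inradius_time W1 W2.
have time_ge0 w : (0 <= time w)%E := inradius_time_ge0 _ _ w.
have X0 w : 0 <= fine (time w) by rewrite fine_ge0.
split.
  by move: good; apply: filterS => w [_ _ cW nf]; case: (deviation_le s0 ns cW nf).
apply/andP; split.
  have [M [M0 M_small]] : exists M : nat, (0 < M)%N /\ Num.sqrt (10^-1 / M%:R) <= 10 ^- 14 :> R.
    by apply: small_step_exists; rewrite invr_gt0// exprn_gt0.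
  have MR0 : 0 < M%:R :> R by rewrite ltr0n.
  have step_small j : Num.sqrt (dyadic_step M j) <= 10 ^- 14 :> R.
    apply: le_trans M_small; rewrite ler_wsqrtr// /dyadic_step invfM ler_wpM2l// lef_pV2 ?posrE//.
      by rewrite ler_nat leq_pmulr// expn_gt0.
    by rewrite ltr0n muln_gt0 M0 expn_gt0.
  case: good => N [mN N0 goodN].
  have in_good w : ~ N w -> [/\ W1 0 w = 0, W2 0 w = 0,
      {within `[0, +oo[, continuous (fun t => W1 t w)} & ~ fails w].
    by move=> nN; apply: contrapT => bad; apply: nN; exact: goodN.
  have mA := turning_event_measurable hW.
  have mB : measurable (\bigcap_j stay W1 W2 M j).
    by apply: bigcapT_measurable => j; exact: (stay_measurable hW M0).
  apply: (@le_trans _ _ (10 ^- 10 * ((10 - 8) / 2) ^+ 2)%:E); first by rewrite lee_fin; lra.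
  apply: (@variance_ge _ _ _ P _ (turning_event W1 W2 `\` N)
    ((\bigcap_j stay W1 W2 M j) `\` N)).
  - lra.
  - by rewrite invr_ge0 exprn_ge0.
  - exact: measurableD.
  - exact: measurableD.
  - move=> w [ev /in_good[W10 W20 cW nf]].
    have [t_lt _] := deviation_le s0 ns cW nf.
    by rewrite -lee_fin fineK ?ge0_fin_numE//; exact: turning_event_time.
  - move=> w [ev /in_good[W10 W20 cW nf]].
    have [t_lt _] := deviation_le s0 ns cW nf.
    by rewrite -lee_fin fineK ?ge0_fin_numE//; exact: (stay_time M0 W10 cW).
  - apply: le_trans (Pr_remove_null mA mN N0).
    by apply: le_trans (turning_event_prob hW); lra.
  - apply: le_trans (Pr_remove_null mB mN N0).
    exact: (stay_all_prob hW M0).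
set G := deviation_bound W1 W2 (45 / n%:R) n.
have mG : measurable_fun setT G by exact: (deviation_bound_measurable hW n s0).
have G0 w : (0 <= G w)%E.
  by apply: nneseries_ge0 => m _ _; rewrite lee_fin mulr_ge0 ?block_weight_ge0 ?indicE ?ler0n.
have iG : (\int[P]_w G w <= 683%:E)%E := deviation_bound_integral hW s0 ns s_small.
have G_fin : {ae P, forall w, G w \is a fin_num}.
  have integrable_G : P.-integrable setT G.
    apply/integrableP; split => //; under eq_integral do rewrite gee0_abs//.
    by apply: le_lt_trans iG _; rewrite ltry.
  by move: (integrable_ae measurableT integrable_G); apply: filterS => w /(_ I).
have fine_le w : ((fine (G w))%:E <= G w)%E.
  by move: (G0 w); case: (G w) => [r| |]//=; rewrite leey.
have i_fine : (\int[P]_w (fine (G w))%:E <= 683%:E)%E.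
  apply: le_trans iG; apply: le_lower_integral => // w.
  by rewrite lee_fin fine_ge0.
apply: (@le_trans _ _ (\int[P]_w (fine (G w))%:E)%E); last first.
  by apply: le_trans i_fine _; rewrite lee_fin; lra.
apply: (@variance_le_real _ _ _ P _ X0 (45 / 2)).
- lra.
- exact: measurableT_comp mG.
- by move=> w; rewrite fine_ge0.
- apply: filterS2 good G_fin => w [_ _ cW nf] fin.
  by rewrite -lee_fin (fineK fin); case: (deviation_le s0 ns cW nf).
- by apply: le_lt_trans i_fine _; rewrite ltry.
Qed.
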